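(* For each $\varepsilon>0$, $\mathcal{M}^\varepsilon(c)\subset\mathcal{M}^\varepsilon_\alpha(c)\subset\mathbb{T}^n$ and $\tilde{\mathcal{M}}^\varepsilon(c)\subset\tilde{\mathcal{M}}^\varepsilon_\alpha(c)\subset\mathbb{T}^n\times\mathbb{R}^n$.
   Context: $H:\mathbb{T}^n\times\mathbb{R}^n\to\mathbb{R}$ is $C^2$, $H_{pp}$ is positive definite, $H(x,p)/|p|\to+\infty$ as $|p|\to\infty$ uniformly in $x$; $L(x,\xi)=\sup_p\{\xi\cdot p-H(x,p)\}$; $\pi:\mathbb{T}^n\times\mathbb{R}^n\to\mathbb{T}^n$ is the projection. $c\in\mathbb{R}^n$ is fixed, $h(c)$ is the unique constant for which $H(x,c+v_x)=h(c)$ has a viscosity solution on $\mathbb{T}^n$. For $\varepsilon>0$, $v^\varepsilon$ is the unique viscosity solution of $\varepsilon v^\varepsilon+H(x,c+v^\varepsilon_x)=h(c)$ on $\mathbb{T}^n$; for all $x$, $T>0$, $v^\varepsilon(x)=\inf\{\int_{-T}^0e^{\varepsilon s}(L(\gamma,\gamma')-c\cdot\gamma'+h(c))ds+e^{-\varepsilon T}v^\varepsilon(\gamma(-T))\}$ over absolutely continuous $\gamma:[-T,0]\to\mathbb{T}^n$, $\gamma(0)=x$. A minimizing curve for $v^\varepsilon(x)$ is $\gamma^\varepsilon:(-\infty,0]\to\mathbb{T}^n$, $\gamma^\varepsilon(0)=x$, attaining this infimum on every $[-T,0]$. $\mathcal{M}^\varepsilon_\alpha(c)$ is the closure of the set of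 all $\alpha$-limit points (limits of $\gamma^\varepsilon(\tau_j)$, $\tau_j\to-\infty$) of all such minimizing curves, $x\in\mathbb{T}^n$; $v^\varepsilon$ is differentiable on it, and $\tilde{\mathcal{M}}^\varepsilon_\alpha(c):=\{(x,H_p(x,c+v^\varepsilon_x(x))):x\in\mathcal{M}^\varepsilon_\alpha(c)\}$. $\phi^s_{L,c,\varepsilon}$ is the flow on $\mathbb{T}^n\times\mathbb{R}^n$ of $\frac{d}{ds}L_\xi(x,x')=L_x(x,x')-\varepsilon L_\xi(x,x')+\varepsilon c$. A minimizing measure of problem (M1)$^\varepsilon$ is a $\phi^s_{L,c,\varepsilon}$-invariant probability measure $\mu$ on $\mathbb{T}^n\times\mathbb{R}^n$ attaining $\inf\int(L(x,\xi)-c\cdot\xi-\varepsilon v^\varepsilon(x))\,d\mu=-h(c)$, the infimum over all $\phi^s_{L,c,\varepsilon}$-invariant probability measures. $\tilde{\mathcal{M}}^\varepsilon(c)$ is the closure of the union of the supports of all minimizing measures of (M1)$^\varepsilon$, and $\mathcal{M}^\varepsilon(c)=\pi\tilde{\mathcal{M}}^\varepsilon(c)$. *)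

(* Defs.v *)
From HB Require Import structures.
From mathcomp Require Import all_boot all_order all_algebra.
From mathcomp Require Import all_classical all_reals all_analysis.
Import Order.TTheory GRing.Theory Num.Theory.
Import numFieldNormedType.Exports.

Set Implicit Arguments.
Unset Strict Implicit.
Unset Printing Implicit Defensive.

Local Open Scope classical_set_scope.
Local Open Scope ring_scope.

Section Defs.
Variables (R : realType) (n : nat).

Notation vec := 'rV[R]_n.

Definition zvec (k : 'rV[int]_n) : vec := map_mx (fun z : int => z%:~R) k.

Definition periodic (f : vec -> R) :=
  forall x (k : 'rV[int]_n), f (x + zvec k) = f x.

Definition periodic2 (F : vec -> vec -> R) :=
  forall x p (k : 'rV[int]_n), F (x + zvec k) p = F x p.

Definition ev (i : 'I_n) : vec := delta_mx 0 i.

Definition dot (u w : vec) : R := \sum_(i < n) u 0 i * w 0 i.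

Definition dd (F : vec -> vec -> R) (u w : vec) (x p : vec) : R :=
  derive1 (fun t : R => F (x + t *: u) (p + t *: w)) 0.
Definition ddable (F : vec -> vec -> R) (u w : vec) (x p : vec) : Prop :=
  derivable (fun t : R => F (x + t *: u) (p + t *: w)) 0 1.

Definition dir (d : 'I_n + 'I_n) : vec * vec :=
  match d with inl i => (ev i, 0) | inr i => (0, ev i) end.

Definition pdF (F : vec -> vec -> R) (d : 'I_n + 'I_n) : vec -> vec -> R :=
  dd F (dir d).1 (dir d).2.

Definition C1_2 (F : vec -> vec -> R) :=
  continuous (fun q : vec * vec => F q.1 q.2) /\
  forall d, (forall x p, ddable F (dir d).1 (dir d).2 x p) /\
            continuous (fun q : vec * vec => pdF F d q.1 q.2).
Definition C2_2 (F : vec -> vec -> R) :=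
  C1_2 F /\ forall d, C1_2 (pdF F d).

Definition Hess_p (F : vec -> vec -> R) (x p : vec) : 'M[R]_n :=
  \matrix_(i, j) pdF (pdF F (inr i)) (inr j) x p.
Definition grad_x (F : vec -> vec -> R) (x p : vec) : vec :=
  \row_i pdF F (inl i) x p.
Definition grad_p (F : vec -> vec -> R) (x p : vec) : vec :=
  \row_i pdF F (inr i) x p.

Definition posdef (A : 'M[R]_n) :=
  forall y : vec, y != 0 -> 0 < (y *m A *m y^T) 0 0.

Definition superlinear (H : vec -> vec -> R) :=
  forall M : R, exists r : R, forall x p, r <= `|p| -> M * `|p| <= H x p.

(* standing assumptions on the Hamiltonian (periodic in x = defined on T^n) *)
Definition tonelli_hamiltonian (H : vec -> vec -> R) :=
  [/\ periodic2 H, C2_2 H, (forall x p, posdef (Hess_p H x p)) &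
      superlinear H].

Definition lagrangian (H : vec -> vec -> R) (x xi : vec) : R :=
  sup [set dot xi p - H x p | p in [set: vec]].

Definition pd (f : vec -> R) (i : 'I_n) (x : vec) : R := derive f x (ev i).
Definition grad (f : vec -> R) (x : vec) : vec := \row_i pd f i x.
Definition C1 (f : vec -> R) :=
  continuous f /\
  forall i, (forall x, derivable f x (ev i)) /\ continuous (pd f i).

Definition visc_sol (H : vec -> vec -> R) (c : vec) (eps h : R) (v : vec -> R) :=
  [/\ continuous v, periodic v,
      (forall (phi : vec -> R) (x0 : vec), C1 phi ->
         (exists2 r : R, 0 < r & forall y, `|y - x0| < r ->
            v y - phi y <= v x0 - phi x0) ->
         eps * v x0 + H x0 (c + grad phi x0) <= h) &
      (forall (phi : vec -> R) (x0 : vec), C1 phi ->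
         (exists2 r : R, 0 < r & forall y, `|y - x0| < r ->
            v x0 - phi x0 <= v y - phi y) ->
         h <= eps * v x0 + H x0 (c + grad phi x0))].

Definition abs_cont (a b : R) (g : R -> vec) :=
  forall e : R, 0 < e -> exists2 delta : R, 0 < delta &
    forall (m : nat) (s t : nat -> R),
      (forall k, (k < m)%N -> [/\ a <= s k, s k <= t k, t k <= b &
                  ((k.+1 < m)%N -> t k <= s k.+1)]) ->
      \sum_(k < m) (t k - s k) < delta ->
      \sum_(k < m) `|g (t k) - g (s k)| < e.

Definition action (H : vec -> vec -> R) (c : vec) (eps h : R) (v : vec -> R)
    (T : R) (g : R -> vec) : \bar R :=
  (\int[@lebesgue_measure R]_(s in `[(- T)%R, 0%R]%classic)
     (expR (eps * s) * (lagrangian H (g s) (derive1 g s)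
                        - dot c (derive1 g s) + h))%:E
   + (expR (- (eps * T)) * v (g (- T)))%R%:E)%E.

Definition admissible (T : R) (x : vec) (g : R -> vec) :=
  abs_cont (- T) 0 g /\ g 0 = x.

(* the variational representation of v (a known property of v^eps) *)
Definition variational_repr H c eps h (v : vec -> R) :=
  forall (x : vec) (T : R), 0 < T ->
    (v x)%:E = ereal_inf [set action H c eps h v T g | g in admissible T x].

(* minimizing curve for v(x), defined on (-oo,0] (values on (0,+oo) unused) *)
Definition minimizing_curve H c eps h (v : vec -> R) (x : vec) (g : R -> vec) :=
  g 0 = x /\
  forall T : R, 0 < T -> abs_cont (- T) 0 g /\
                (v x)%:E = action H c eps h v T g.

(* alpha-limit points in T^n (lifted to R^n) *)
Definition alpha_limit (g : R -> vec) (y : vec) :=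
  exists (tau : nat -> R) (k : nat -> 'rV[int]_n),
    (tau @ \oo --> -oo%R) /\ ((fun j => g (tau j) + zvec (k j)) @ \oo --> y).

Definition Malpha H c eps h (v : vec -> R) : set vec :=
  closure [set y | exists x g, minimizing_curve H c eps h v x g /\
                               alpha_limit g y].

Definition Malpha_t H c eps h (v : vec -> R) : set (vec * vec) :=
  [set (x, grad_p H x (c + grad v x)) | x in Malpha H c eps h v].

Definition phase := (vec * vec)%type.
Definition phaseM := g_sigma_algebraType (@open phase).

Definition EL_flow H (c : vec) (eps : R) (Phi : R -> phase -> phase) :=
  forall p : phase,
    let g := fun s => (Phi s p).1 in
    let L := lagrangian H in
    Phi 0 p = p /\
    forall s : R,
      [/\ derivable g s 1, (Phi s p).2 = derive1 g s &
          forall i : 'I_n,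
            derivable (fun r => grad_p L (g r) (derive1 g r) 0 i) s 1 /\
            derive1 (fun r => grad_p L (g r) (derive1 g r) 0 i) s =
              grad_x L (g s) (derive1 g s) 0 i
              - eps * grad_p L (g s) (derive1 g s) 0 i + eps * c 0 i].

(* reduction modulo Z^n of the base point: T^n = [0,1)^n *)
Definition fracv (x : vec) : vec := \row_i (x 0 i - (Num.floor (x 0 i))%:~R).
Definition modT (q : phase) : phase := (fracv q.1, q.2).
Definition fund_dom : set phaseM := [set q : phase | forall i, 0 <= q.1 0 i < 1].

Definition invariant (Phi : R -> phase -> phase)
    (mu : probability phaseM R) :=
  mu fund_dom = 1%E /\
  forall (s : R) (A : set phaseM), measurable A ->
    mu ((fun q : phaseM => (modT (Phi s q) : phaseM)) @^-1` A) = mu A.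

Definition functional H (c : vec) (eps : R) (v : vec -> R)
    (mu : probability phaseM R) : \bar R :=
  \int[mu]_(q in [set: phaseM]) (lagrangian H q.1 q.2 - dot c q.2 - eps * v q.1)%:E.

Definition minimizing_measure H c eps v Phi (mu : probability phaseM R) :=
  invariant Phi mu /\
  functional H c eps v mu =
    ereal_inf [set functional H c eps v nu | nu in invariant Phi].

(* ball of radius r around p in T^n x R^n (lifted) *)
Definition tball (p : phase) (r : R) : set phaseM :=
  [set q | (exists k : 'rV[int]_n, `|q.1 - p.1 - zvec k| < r) /\
           `|q.2 - p.2| < r].

Definition supp (mu : probability phaseM R) : set phase :=
  [set p | forall r : R, 0 < r -> (0 < mu (tball p r))%E].

Definition Mt H c eps v Phi : set phase :=
  closure (\bigcup_(mu in minimizing_measure H c eps v Phi) supp mu).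
Definition Mset H c eps v Phi : set vec := fst @` Mt H c eps v Phi.

End Defs.

(* Main.v *)
(** Write q_s for the orbit of q under the flow and l = L - c.xi + h.

    Existence of an invariant probability with cost at most - h.  The discrete
    problem u(x) = min_xi (d l(x, xi) + (1 - eps d) u(x - d xi)) has a solution u with
    u <= v + o(1) as d -> 0, by comparison with the inf-convolution of v.  Its
    minimizing chains satisfy a discrete Hamilton equation, so they shadow the flow
    backwards in time, and their occupation measures have an invariant limit.

    Calibration.  By the variational representation of v, the defect
    D(q) = exp(- eps) v(q_(-1)) - v(q) + int_(-1)^0 exp(eps s) l(q_s) ds is nonnegative.
    Its integral against a minimizing measure is at most 0, by invariance and Fatou's
    lemma applied to Riemann sums.  Hence almost every orbit has zero defect along all
    its integer translates and is a minimizing curve, and Poincare recurrence makes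
    the points of the support alpha-limits of such curves.

    Graph property.  Adding to a calibrated orbit an affine perturbation of size |z| on
    a time interval of length proportional to |z| gives
    v(x + z) = v(x) + (P - c).z + o(|z|), P being the momentum, uniformly on the
    calibrated orbits that start near a given point.  The expansion passes to the
    closure and identifies the velocity with H_p(x, c + v_x). *)

Require Import Defs.
From HB Require Import structures.
From mathcomp Require Import all_boot all_order all_algebra.
From mathcomp Require Import all_classical all_reals all_analysis.
From mathcomp Require Import measurable_realfun.
From mathcomp Require Import ring lra.
Import Order.TTheory GRing.Theory Num.Theory.
Import numFieldNormedType.Exports.
Local Open Scope classical_set_scope.
Local Open Scope ring_scope.

Set Implicit Arguments.
Unset Strict Implicit.
Unset Printing Implicit Defensive.

(** * Calculus on the torus *)

(** The infimum over invariant measures has to be compared with - h before a minimizing measure says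
    anything: the bound by - h is what makes the mean defect nonpositive. Chains keep every
    minimization finite dimensional, so no existence or regularity theory for minimizing curves
    enters, and the one-sided bound on u rests on the supersolution inequality of v. The
    representation of v is tested only on curves with continuous velocity, whose action is an
    increment of a primitive. On the measure side the obstacle is that reduction modulo Z^n jumps on
    the faces of the unit cell. Limits are therefore taken of the visit frequencies of all sets
    along one ultrafilter, which yields a finitely additive function; sigma-additivity is recovered
    on periodic open sets, where a slab supplies compactness, and only then is the result carried to
    the cell. *)

Section VecAnalysis.
Context {R : realType} {n : nat}.
Local Notation vec := 'rV[R]_n.

Lemma norm_coord (x : vec) i : `|x 0 i| <= `|x|.
Proof.
rewrite /Num.Def.normr /= mx_normrE.
exact: (le_bigmax _ (fun ij : 'I_1 * 'I_n => `|x ij.1 ij.2|) (0, i)).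
Qed.

Lemma norm_le_coord (x : vec) e : 0 <= e -> (forall i, `|x 0 i| <= e) -> `|x| <= e.
Proof.
move=> e0 h; rewrite /Num.Def.normr /= mx_normrE; apply: bigmax_le => //.
by move=> [i j] _ /=; rewrite ord1.
Qed.

Lemma continuous_ed {V W : normedModType R} (f : V -> W) (a : V) :
  {for a, continuous f} <->
  forall e : R, 0 < e -> exists2 d : R, 0 < d &
    forall b, `|b - a| < d -> `|f b - f a| < e.
Proof.
split.
- move=> /cvgrPdist_lt h e /h /nbhs_ballP[d /= d0 H]; exists d => // b ba.
  rewrite distrC; apply: H; rewrite -ball_normE /=; by rewrite distrC.
- move=> h; apply/cvgrPdist_lt => e /h [d d0 H]; apply/nbhs_ballP; exists d => //= b.
  by rewrite -ball_normE /= distrC => /H; rewrite distrC.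
Qed.

(** No order between [a] and [b] is assumed and the intermediate point is given by a parameter,
    since increments of either sign occur below. *)
Lemma mvt_between (f df : R -> R) (a b : R) :
  (forall x : R, is_derive x 1 f (df x)) ->
  exists2 t, 0 <= t <= 1 & f b - f a = df (a + t * (b - a)) * (b - a).
Proof.
move=> h.
have key x y : x < y -> exists2 t, 0 <= t <= 1 & f y - f x = df (x + t * (y - x)) * (y - x).
  move=> xy; have cf : {within `[x, y], continuous f}.
    apply: continuous_subspaceT => z.
    by apply: differentiable_continuous; apply/derivable1_diffP; case: (h z).
  have [c /itvP cxy ->] := MVT_segment (ltW xy) (fun z _ => h z) cf.
  have xy0 : 0 < y - x by rewrite subr_gt0.
  exists ((c - x) / (y - x)).
    by rewrite divr_ge0 ?subr_ge0 ?cxy ?(ltW xy)//= ler_pdivrMr // mul1r lerD2r cxy.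
  by rewrite divfK ?gt_eqF // (addrC x) subrK.
have [->|/lt_total/orP[ab|ab]] := eqVneq a b.
- by exists 0; rewrite ?lexx ?ler01 // !subrr mulr0.
- exact: key.
- have [t /andP[t0 t1] E] := key _ _ ab; exists (1 - t); first by apply/andP; split; lra.
  rewrite -(opprB (f a)) E -(opprB a b) mulrN; congr (- (df _ * _)); ring.
Qed.

Lemma mvt_open (f df : R -> R) (a b : R) : a < b ->
  (forall x : R, is_derive x 1 f (df x)) ->
  exists2 c, a < c < b & f b - f a = df c * (b - a).
Proof.
move=> ab h; have cf : {within `[a, b], continuous f}.
  apply: continuous_subspaceT => z.
  by apply: differentiable_continuous; apply/derivable1_diffP; case: (h z).
by have [c /itvP cab ->] := MVT ab (fun z _ => h z) cf; exists c => //; rewrite !cab.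
Qed.

(** Partial derivatives only, to match [C1_2]; continuity of [g] is a separate hypothesis wherever
    it is needed. *)
Definition hasgrad (f : vec -> R) (g : vec -> vec) :=
  forall y i, is_derive (0 : R) 1 (fun t => f (y + t *: ev R i)) (g y 0 i).

Lemma is_derive_shift (f : R -> R) (x l : R) :
  is_derive (0 : R) 1 (fun t => f (x + t)) l <-> is_derive x 1 f l.
Proof.
split=> h.
- have : is_derive (x : R) 1 ((fun t => f (x + t)) \o (fun t => t - x)) (l * 1).
    apply: is_derive1_comp; first by rewrite subrr.
    by rewrite -[X in is_derive _ _ _ X]subr0; apply: is_deriveB.
  rewrite mulr1; congr is_derive; apply/funext => t /=.
  by rewrite addrC subrK.
- have : is_derive (0 : R) 1 (f \o (fun t => x + t)) (l * 1).
    apply: is_derive1_comp; first by rewrite addr0.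
    by rewrite -[X in is_derive _ _ _ X]add0r; apply: is_deriveD.
  by rewrite mulr1.
Qed.

Lemma hasgrad_line f g (y : vec) i : hasgrad f g ->
  forall t : R, is_derive t 1 (fun t => f (y + t *: ev R i)) (g (y + t *: ev R i) 0 i).
Proof.
move=> h t; apply/(is_derive_shift (fun t => f (y + t *: ev R i))).
have := h (y + t *: ev R i) i; congr is_derive; apply/funext => s.
by rewrite -addrA -scalerDl.
Qed.

Lemma evE i j : (ev R i : vec) 0 j = (j == i)%:R.
Proof. by rewrite /ev mxE eqxx. Qed.

(* The increments are taken one coordinate at a time, so that only partial
   derivatives are involved and the path stays in the box spanned by x and x'. *)
Lemma mean_value_box (f : vec -> R) g (x x' G : vec) (eta : R) :
  hasgrad f g ->
  (forall y : vec, (forall j, exists2 t, 0 <= t <= 1 & y 0 j = x 0 j + t * (x' 0 j - x 0 j)) ->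
     forall i, `|g y 0 i - G 0 i| <= eta) ->
  `|f x' - f x - dot G (x' - x)| <= eta * \sum_i `|x' 0 i - x 0 i|.
Proof.
move=> fg hg.
pose m k : vec := \row_j (if (j < k)%N then x' 0 j else x 0 j).
have m0 : m 0%N = x by apply/rowP => j; rewrite mxE ltn0.
have mn : m n = x' by apply/rowP => j; rewrite mxE ltn_ord.
have step (i : 'I_n) : m i.+1 = m i + (x' 0 i - x 0 i) *: ev R i.
  apply/rowP => j; rewrite !mxE eqxx /= ltnS leq_eqVlt.
  have [->|ji] := eqVneq j i; first by rewrite eqxx ltnn mulr1 addrC subrK.
  by rewrite -val_eqE /= in ji; rewrite (negbTE ji) /= mulr0 addr0.
have -> : f x' - f x = \sum_(i < n) (f (m i.+1) - f (m i)).
  by rewrite -(big_mkord xpredT (fun i => f (m i.+1) - f (m i))) telescope_sumr // m0 mn.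
rewrite /dot -sumrB mulr_sumr; apply: le_trans (ler_norm_sum _ _ _) _.
apply: ler_sum => i _.
have [c /= hc E] := mvt_between 0 (x' 0 i - x 0 i) (hasgrad_line (m i) i fg).
rewrite scale0r addr0 subr0 add0r in E; rewrite step E !mxE -mulrBl normrM.
apply: ler_wpM2r => //; apply: hg => j; rewrite !mxE eqxx /=.
case: ifPn => [ji|ji].
  have -> : (j == i) = false by apply/negbTE; rewrite -val_eqE /= ltn_eqF.
  by exists 1; rewrite ?lexx ?ler01 // mulr0 addr0 mul1r addrC subrK.
have [->|_] := eqVneq j i; first by exists c => //; rewrite mulr1.
by exists 0; rewrite ?lexx ?ler01 // mulr0 mul0r.
Qed.

Lemma norm_dot (u w : vec) : `|dot u w| <= n%:R * (`|u| * `|w|).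
Proof.
apply: le_trans (ler_norm_sum _ _ _) _.
have -> : n%:R * (`|u| * `|w|) = \sum_(i < n) `|u| * `|w|.
  by rewrite sumr_const card_ord mulr_natl.
by apply: ler_sum => i _; rewrite normrM ler_pM // norm_coord.
Qed.

Lemma sum_norm_le (u : vec) : \sum_i `|u 0 i| <= n%:R * `|u|.
Proof.
have -> : n%:R * `|u| = \sum_(i < n) `|u|.
  by rewrite sumr_const card_ord mulr_natl.
by apply: ler_sum => i _; exact: norm_coord.
Qed.

Lemma dotDl (u v w : vec) : dot (u + v) w = dot u w + dot v w.
Proof. by rewrite -big_split; apply: eq_bigr => i _; rewrite mxE mulrDl. Qed.
Lemma dotC (u v : vec) : dot u v = dot v u.
Proof. by apply: eq_bigr => i _; rewrite mulrC. Qed.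
Lemma dotDr (u v w : vec) : dot u (v + w) = dot u v + dot u w.
Proof. by rewrite dotC dotDl !(dotC u). Qed.
Lemma dotZl a (u v : vec) : dot (a *: u) v = a * dot u v.
Proof. by rewrite mulr_sumr; apply: eq_bigr => i _; rewrite mxE mulrA. Qed.
Lemma dotZr a (u v : vec) : dot u (a *: v) = a * dot u v.
Proof. by rewrite dotC dotZl dotC. Qed.
Lemma dotNl (u v : vec) : dot (- u) v = - dot u v.
Proof. by rewrite -scaleN1r dotZl mulN1r. Qed.
Lemma dotNr (u v : vec) : dot u (- v) = - dot u v.
Proof. by rewrite dotC dotNl dotC. Qed.
Lemma dotBl (u v w : vec) : dot (u - v) w = dot u w - dot v w.
Proof. by rewrite dotDl dotNl. Qed.
Lemma dotBr (u v w : vec) : dot u (v - w) = dot u v - dot u w.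
Proof. by rewrite dotDr dotNr. Qed.
Lemma dot0l (u : vec) : dot 0 u = 0.
Proof. by rewrite -(scale0r (0 : vec)) dotZl mul0r. Qed.
Lemma dot0r (u : vec) : dot u 0 = 0.
Proof. by rewrite dotC dot0l. Qed.
Lemma dot_ev (u : vec) i : dot u (ev R i) = u 0 i.
Proof.
rewrite /dot (bigD1 i) //= evE eqxx mulr1 big1 ?addr0 // => j ji.
by rewrite evE (negbTE ji) mulr0.
Qed.
Lemma dot_ge0 (u : vec) : 0 <= dot u u.
Proof. by apply: sumr_ge0 => i _; rewrite -expr2 sqr_ge0. Qed.
Lemma sqr_norm_le_dot (u : vec) : `|u| ^+ 2 <= dot u u.
Proof.
have hi i : `|u 0 i| ^+ 2 <= dot u u.
  rewrite /dot (bigD1 i) //= real_normK ?num_real // expr2 lerDl.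
  by apply: sumr_ge0 => j _; rewrite -expr2 sqr_ge0.
have : `|u| <= Num.sqrt (dot u u).
  apply: norm_le_coord; first exact: sqrtr_ge0.
  by move=> i; rewrite -(ger0_norm (normr_ge0 (u 0 i))) -sqrtr_sqr ler_sqrt ?dot_ge0.
by move=> h; rewrite -[leRHS]sqr_sqrtr ?dot_ge0 // lerXn2r ?nnegrE ?sqrtr_ge0.
Qed.

Lemma dot_continuous : continuous (fun q : vec * vec => dot q.1 q.2).
Proof.
rewrite /dot.
elim: (index_enum 'I_n) => [|i s IH].
  by under eq_fun do rewrite big_nil; exact: cst_continuous.
under eq_fun do rewrite big_cons.
move=> q; apply: cvgD; last exact: IH.
have c1 : continuous (fun q : vec * vec => q.1 0 i).
  by move=> z; apply: (@continuous_comp _ _ _ fst (fun y : vec => y 0 i));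
    [exact: cvg_fst|exact: coord_continuous].
have c2 : continuous (fun q : vec * vec => q.2 0 i).
  by move=> z; apply: (@continuous_comp _ _ _ snd (fun y : vec => y 0 i));
    [exact: cvg_snd|exact: coord_continuous].
by apply: cvgM; [exact: c1|exact: c2].
Qed.

Lemma zvecD (k l : 'rV[int]_n) : zvec R (k + l) = zvec R k + zvec R l.
Proof. by apply/rowP => i; rewrite !mxE rmorphD. Qed.
Lemma zvecN (k : 'rV[int]_n) : zvec R (- k) = - zvec R k.
Proof. by apply/rowP => i; rewrite !mxE rmorphN. Qed.

(** The sign makes reduction to the unit cell a translation by [zvec], the form in which periodicity
    applies. *)
Definition floorv (x : vec) : 'rV[int]_n := \row_i (- Num.floor (x 0 i)).

Lemma fracvE (x : vec) : fracv x = x + zvec R (floorv x).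
Proof. by apply/rowP => i; rewrite !mxE rmorphN. Qed.

Lemma fracv_itv (x : vec) i : 0 <= fracv x 0 i < 1.
Proof.
rewrite !mxE subr_ge0; have /andP[-> h] := floor_itv (x 0 i).
by rewrite ltrBlDl; move: h; rewrite rmorphD /= addrC.
Qed.

Lemma fracv_norm (x : vec) : `|fracv x| <= 1.
Proof.
apply: norm_le_coord => // i; have /andP[h0 h1] := fracv_itv x i.
by rewrite ger0_norm // ltW.
Qed.

Lemma fracvD (x : vec) (k : 'rV[int]_n) : fracv (x + zvec R k) = fracv x.
Proof.
apply/rowP => i; rewrite !mxE.
rewrite floorDrz ?intrKfloor ?intr_int //; first by rewrite rmorphD /=; lra.
Qed.

(** Compact, and by [fracv_norm] it contains a translate of every state whose second component is at
    most [r]: the substitute for compactness of the torus. *)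
Definition slab (r : R) : set (vec * vec) := [set q | `|q.1| <= 1 /\ `|q.2| <= r].

Lemma closed_ball0_compact (r : R) : compact [set x : vec | `|x| <= r].
Proof.
apply: bounded_closed_compact.
  exists r; split; first exact: num_real.
  by move=> y ry x /= /le_trans; apply; exact: ltW.
have -> : [set x : vec | `|x| <= r] = Num.norm @^-1` [set y | y <= r] by [].
by apply: closed_comp => [x _|]; [exact: norm_continuous|exact: closed_le].
Qed.

Lemma slab_compact r : compact (slab r).
Proof.
have -> : slab r = [set x : vec | `|x| <= 1] `*` [set x : vec | `|x| <= r] by [].
by apply: compact_setX; exact: closed_ball0_compact.
Qed.

Lemma compact_bounded_fun {T : topologicalType} (A : set T) (f : T -> R) :
  compact A -> continuous f -> exists2 M, 0 < M & forall a, A a -> `|f a| <= M.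
Proof.
move=> cA cf.
have cfA : {within A, continuous (fun x => `|f x|)}.
  apply: continuous_subspaceT => x; apply: continuous_comp; first exact: cf.
  exact: norm_continuous.
have [->|/set0P A0] := eqVneq A set0; first by exists 1.
have [c _ H] := compact_EVT_max A0 cA cfA.
exists (`|f c| + 1); first by rewrite ltr_wpDl.
by move=> a Aa; rewrite (le_trans (H _ _)) ?inE // lerDl.
Qed.

Lemma periodic2_fracv (F : vec -> vec -> R) : periodic2 F ->
  forall x p, F (fracv x) p = F x p.
Proof. by move=> per x p; rewrite fracvE per. Qed.

Lemma periodic_fracv (f : vec -> R) : Defs.periodic f -> forall x, f (fracv x) = f x.
Proof. by move=> per x; rewrite fracvE per. Qed.

Lemma periodic_slab_bounded (F : vec -> vec -> R) (r : R) :
  continuous (fun q : vec * vec => F q.1 q.2) -> periodic2 F ->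
  exists2 M, 0 < M & forall x p, `|p| <= r -> `|F x p| <= M.
Proof.
move=> cF per; have [M M0 H] := compact_bounded_fun (slab_compact (r := r)) cF.
exists M => // x p pr; rewrite -(periodic2_fracv per).
by apply: (H (fracv x, p)); split => //=; exact: fracv_norm.
Qed.

Lemma periodic_bounded (f : vec -> R) : continuous f -> Defs.periodic f ->
  exists2 M, 0 < M & forall x, `|f x| <= M.
Proof.
move=> cf per; have [M M0 H] := compact_bounded_fun (closed_ball0_compact (r := 1)) cf.
exists M => // x; rewrite -(periodic_fracv per); apply: H; exact: fracv_norm.
Qed.

Lemma C1_2_hasgrad_x (F : vec -> vec -> R) p : C1_2 F ->
  hasgrad (fun x => F x p) (fun x => grad_x F x p).
Proof.
move=> [_ h] y i; have [/(_ y p) hd _] := h (inl i).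
rewrite mxE /pdF /dd; rewrite /ddable /= in hd *.
have -> : (fun t : R => F (y + t *: ev R i) p) =
          (fun t : R => F (y + t *: ev R i) (p + t *: 0)).
  by apply/funext => t; rewrite scaler0 addr0.
by apply: DeriveDef => //; rewrite derive1E.
Qed.

Lemma C1_2_hasgrad_p (F : vec -> vec -> R) x : C1_2 F ->
  hasgrad (fun p => F x p) (fun p => grad_p F x p).
Proof.
move=> [_ h] y i; have [/(_ x y) hd _] := h (inr i).
rewrite mxE /pdF /dd; rewrite /ddable /= in hd *.
have -> : (fun t : R => F x (y + t *: ev R i)) =
          (fun t : R => F (x + t *: 0) (y + t *: ev R i)).
  by apply/funext => t; rewrite scaler0 addr0.
by apply: DeriveDef => //; rewrite derive1E.
Qed.

Lemma pdF_periodic (F : vec -> vec -> R) d : periodic2 F -> periodic2 (pdF F d).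
Proof.
move=> per x p k; rewrite /pdF /dd; congr (derive1 _ 0); apply/funext => t.
by rewrite addrAC per.
Qed.

(** Periodicity makes the bounds on the partial derivatives global in the base point. The increment
    is split at (x, p'); coordinatewise paths from p to p' stay in the ball because sup-norm balls
    are boxes. *)
Lemma periodic_C1_lipschitz (F : vec -> vec -> R) (r : R) :
  C1_2 F -> periodic2 F -> exists2 K, 0 < K &
  forall q q' : vec * vec, `|q.2| <= r -> `|q'.2| <= r ->
    `|F q'.1 q'.2 - F q.1 q.2| <= K * `|q' - q|.
Proof.
move=> CF per.
have bnd d : exists2 M, 0 < M & forall x p, `|p| <= r -> `|pdF F d x p| <= M.
  by apply: periodic_slab_bounded; [case: CF => _ /(_ d)[]|exact: pdF_periodic].
have /choice[M HM] : forall d, exists m, 0 < m /\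
    forall x p, `|p| <= r -> `|pdF F d x p| <= m.
  by move=> d; case: (bnd d) => m; exists m.
pose K0 := \sum_d M d.
have K0M d : M d <= K0.
  by rewrite /K0 (bigD1 d) //= lerDl; apply: sumr_ge0 => e _; apply: ltW; case: (HM e).
have K00 : 0 <= K0 by apply: sumr_ge0 => e _; apply: ltW; case: (HM e).
(* The factor 2 counts the two halves of the split; the added 1 ensures positivity. *)
exists (2 * (K0 * n%:R) + 1) => [|[x p] [x' p'] /= pr p'r].
  by rewrite ltr_wpDl // !mulr_ge0.
have q1 : `|x' - x| <= `|(x', p') - (x, p)| by rewrite prod_normE /= le_max lexx.
have q2 : `|p' - p| <= `|(x', p') - (x, p)| by rewrite prod_normE /= le_max lexx orbT.
have E1 : `|F x' p' - F x p'| <= K0 * (n%:R * `|x' - x|).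
  have := @mean_value_box (fun x => F x p') _ x x' 0 K0 (C1_2_hasgrad_x p' CF).
  rewrite dot0l subr0 => h.
  apply: le_trans (h _) _ => [y _ i|].
    rewrite !mxE subr0; case: (HM (inl i)) => _ /(_ y p' p'r) /le_trans; apply.
    exact: K0M.
  apply: ler_wpM2l => //; apply: le_trans _ (sum_norm_le _).
  by apply: ler_sum => i _; rewrite !mxE.
have E2 : `|F x p' - F x p| <= K0 * (n%:R * `|p' - p|).
  have := @mean_value_box (fun p => F x p) _ p p' 0 K0 (C1_2_hasgrad_p x CF).
  rewrite dot0l subr0 => h.
  apply: le_trans (h _) _ => [y hy i|].
    rewrite !mxE subr0.
    have yr : `|y| <= r.
      apply: norm_le_coord => [|j]; first exact: le_trans (normr_ge0 _) pr.
      have [t /andP[t0 t1] ->] := hy j.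
      have h1 := le_trans (norm_coord p j) pr; have h2 := le_trans (norm_coord p' j) p'r.
      have -> : p 0 j + t * (p' 0 j - p 0 j) = (1 - t) * p 0 j + t * p' 0 j by ring.
      apply: le_trans (ler_normD _ _) _; rewrite !normrM (ger0_norm t0).
      rewrite ger0_norm ?subr_ge0 //; nra.
    case: (HM (inr i)) => _ /(_ x y yr) /le_trans; apply.
    exact: K0M.
  apply: ler_wpM2l => //; apply: le_trans _ (sum_norm_le _).
  by apply: ler_sum => i _; rewrite !mxE.
rewrite -(subrKA (F x p')); apply: le_trans (ler_normD _ _) _.
apply: le_trans (lerD E1 E2) _.
set N := `|_ - _| in q1 q2 *.
have N0 : 0 <= N by exact: normr_ge0.
have n0 : 0 <= n%:R :> R by [].
have := ler_wpM2l K00 (ler_wpM2l n0 q1).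
have := ler_wpM2l K00 (ler_wpM2l n0 q2).
rewrite mulrDl mul1r; lra.
Qed.

End VecAnalysis.

(** * Legendre duality *)

Section Derivatives.
Context {R : realType} {n : nat}.
Local Notation vec := 'rV[R]_n.

Lemma is_derive_ed (f : R -> R) (a l : R) :
  (forall e : R, 0 < e -> exists2 d : R, 0 < d &
    forall t, `|t| < d -> `|f (a + t) - f a - t * l| <= e * `|t|) ->
  is_derive a 1 f l.
Proof.
move=> h.
have cv : h^-1 *: (f (h *: (1 : R) + a) - f a) @[h --> 0^'] --> l.
  apply/cvgrPdist_le => e /h[d d0 H]; near=> t.
  have t0 : t != 0 by near: t; exact: nbhs_dnbhs_neq.
  have td : `|t| < d by near: t; apply: dnbhs0_lt.
  have := H t td; rewrite /GRing.scale /= mulr1 (addrC t) => Ht.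
  rewrite distrC -(ler_pM2l (_ : 0 < `|t|)) ?normr_gt0 //.
  by rewrite -normrM mulrBr mulrA mulfV // mul1r mulrC [in leRHS]mulrC mulrC
    (mulrC `|t|) in Ht *.
apply: DeriveDef; first by apply/cvg_ex; exists l.
exact/cvg_lim.
Unshelve. all: by end_near. Qed.

Lemma is_derive_ed_inv (f : R -> R) (a l : R) : is_derive a 1 f l ->
  forall e : R, 0 < e -> exists2 d : R, 0 < d &
    forall t, `|t| < d -> `|f (a + t) - f a - t * l| <= e * `|t|.
Proof.
move=> [dv vl] e e0.
have cv : h^-1 *: (f (h *: (1 : R) + a) - f a) @[h --> 0^'] --> l.
  by rewrite -vl /derive; exact: dv.
move/cvgrPdist_le : cv => /(_ e e0) /nbhs_ballP[d /= d0 H]; exists d => // t td.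
have [->|t0] := eqVneq t 0; first by rewrite addr0 subrr mul0r subr0 normr0 mulr0.
have := H t; rewrite /ball /= sub0r normrN => /(_ td t0).
rewrite /GRing.scale /= mulr1 (addrC t) distrC => {}H.
have -> : f (a + t) - f a - t * l = t * (t^-1 * (f (a + t) - f a) - l).
  by rewrite mulrBr mulrA mulfV // mul1r.
by rewrite normrM mulrC ler_wpM2r.
Qed.

Lemma is_derive_continuous (f : R -> R) (a l : R) : is_derive a 1 f l ->
  {for a, continuous f}.
Proof.
by move=> [h _]; apply: differentiable_continuous; apply/derivable1_diffP.
Qed.

Lemma is_derive_mulr (f : R -> R) (a l c : R) : is_derive a 1 f l ->
  is_derive a 1 (fun t => f t * c) (l * c).
Proof.
move=> h; have -> : (fun t => f t * c) = c \*: f by apply/funext => t; rewrite mulrC.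
by rewrite mulrC; exact: is_deriveZ.
Qed.

(** Continuity of [g] at the single point [y] makes its oscillation on the box between y and y + t w
    small, and [mean_value_box] turns this into a directional derivative. *)
Lemma hasgrad_dir (f : vec -> R) g (y w : vec) : hasgrad f g ->
  {for y, continuous g} ->
  is_derive (0 : R) 1 (fun t => f (y + t *: w)) (dot (g y) w).
Proof.
move=> fg /continuous_ed cg; apply: is_derive_ed => e e0.
pose C := n%:R * `|w| + 1; have C0 : 0 < C by rewrite ltr_wpDl // mulr_ge0.
have [d d0 Hd] := cg (e / C) (divr_gt0 e0 C0).
exists (d / C) => [|t]; first exact: divr_gt0.
rewrite ltr_pdivlMr // => td; rewrite add0r scale0r addr0.
have := @mean_value_box _ _ f g y (y + t *: w) (g y) (e / C) fg.
rewrite (addrC y) addrK dotZr => h; apply: le_trans (h _) _ => [z hz i|].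
  have : `|z - y| < d.
    apply: le_lt_trans td; apply: norm_le_coord => [|j].
      by rewrite mulr_ge0 // ltW.
    have [s /andP[s0 s1]] := hz j; rewrite !mxE => ->.
    have -> : y 0 j + s * (t * w 0 j + y 0 j - y 0 j) - y 0 j = s * (t * w 0 j) by ring.
    rewrite !normrM (ger0_norm s0).
    have h1 := norm_coord w j; have h2 : `|w| <= C.
      have [n0|n0] := posnP n; last first.
        rewrite /C -[leLHS]mul1r; apply: le_trans (_ : n%:R * `|w| <= _); last by rewrite lerDl.
        by rewrite ler_wpM2r // ler1n.
      by exfalso; have := ltn_ord j; rewrite {2}n0.
    apply: le_trans (_ : `|t| * `|w 0 j| <= _).
      by rewrite -[leRHS]mul1r; apply: ler_wpM2r => //; rewrite mulr_ge0.
    by apply: ler_wpM2l => //; exact: le_trans h1 h2.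
  move=> /Hd/ltW; apply: le_trans; have := norm_coord (g z - g y) i.
  by rewrite !mxE.
under eq_bigr do rewrite !mxE addrK normrM.
rewrite -mulr_sumr mulrAC ler_pdivrMr // -mulrA; apply: ler_wpM2l; first exact: ltW.
by apply: ler_wpM2l => //; rewrite (le_trans (sum_norm_le _)) // lerDl.
Qed.

Lemma hasgrad_dir_at (f : vec -> R) g (y w : vec) (t : R) : hasgrad f g ->
  continuous g ->
  is_derive t 1 (fun t => f (y + t *: w)) (dot (g (y + t *: w)) w).
Proof.
move=> fg cg; apply/(is_derive_shift (fun t => f (y + t *: w))).
have := @hasgrad_dir f g (y + t *: w) w fg (@cg _); congr is_derive.
by apply/funext => s; rewrite -addrA -scalerDl.
Qed.

Lemma continuous_coord {T : topologicalType} (g : T -> vec) :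
  (forall i, continuous (fun x => g x 0 i)) -> continuous g.
Proof.
move=> h x; apply/cvgrPdist_lt => e e0.
have h2 i : \forall y \near x, `|g x 0 i - g y 0 i| < e / 2.
  by move: (h i x) => /cvgrPdist_lt; apply; rewrite divr_gt0.
have : \forall y \near x, forall i, `|g x 0 i - g y 0 i| < e / 2.
  by apply: filter_forall.
apply: filterS => y hy; apply: le_lt_trans (_ : e / 2 < e); last by lra.
by apply: norm_le_coord => [|i]; [lra|rewrite !mxE ltW].
Qed.

Lemma C1_2_grad_p_continuous (F : vec -> vec -> R) : C1_2 F ->
  continuous (fun q : vec * vec => grad_p F q.1 q.2).
Proof.
move=> [_ h]; apply: continuous_coord => i; have [_] := h (inr i).
have -> : (fun q : vec * vec => grad_p F q.1 q.2 0 i) = (fun q => pdF F (inr i) q.1 q.2).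
  by apply/funext => q; rewrite mxE.
exact.
Qed.

Lemma C1_2_grad_x_continuous (F : vec -> vec -> R) : C1_2 F ->
  continuous (fun q : vec * vec => grad_x F q.1 q.2).
Proof.
move=> [_ h]; apply: continuous_coord => i; have [_] := h (inl i).
have -> : (fun q : vec * vec => grad_x F q.1 q.2 0 i) = (fun q => pdF F (inl i) q.1 q.2).
  by apply/funext => q; rewrite mxE.
exact.
Qed.

Lemma continuous_pair {T : topologicalType} {U V : normedModType R}
    (f : T -> U) (g : T -> V) :
  continuous f -> continuous g -> continuous (fun t => (f t, g t)).
Proof. by move=> cf cg t; exact: (cvg_pair (cf t) (cg t)). Qed.

Lemma continuous_after {T U V : topologicalType} (f : T -> U) (g : U -> V) :
  continuous f -> continuous g -> continuous (fun t => g (f t)).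
Proof. by move=> cf cg t; apply: (continuous_comp (cf t)); exact: cg. Qed.

Lemma C1_2_line_p (F : vec -> vec -> R) x p w (t : R) : C1_2 F ->
  is_derive t 1 (fun t => F x (p + t *: w)) (dot (grad_p F x (p + t *: w)) w).
Proof.
move=> CF; apply: (hasgrad_dir_at (f := F x)); first exact: C1_2_hasgrad_p.
apply: (continuous_after (f := fun p : vec => (x, p)) (g := fun q => grad_p F q.1 q.2)).
  by apply: continuous_pair => q; [exact: cst_continuous|exact: cvg_id].
exact: C1_2_grad_p_continuous.
Qed.

End Derivatives.

Section Legendre.
Context {R : realType} {n : nat}.
Local Notation vec := 'rV[R]_n.
Context (H : vec -> vec -> R).
Hypothesis tonH : tonelli_hamiltonian H.

Lemma ham_periodic : periodic2 H. Proof. by case: tonH. Qed.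
Lemma ham_C1 : C1_2 H. Proof. by case: tonH => _ []. Qed.
Lemma ham_continuous : continuous (fun q : vec * vec => H q.1 q.2).
Proof. by case: ham_C1. Qed.
Lemma ham_pd_C1 d : C1_2 (pdF H d). Proof. by case: tonH => _ [_]. Qed.
Lemma ham_hess x p : posdef (Hess_p H x p). Proof. by case: tonH. Qed.
Lemma ham_superlinear : superlinear H. Proof. by case: tonH. Qed.
Lemma grad_p_periodic x p k : grad_p H (x + zvec R k) p = grad_p H x p.
Proof. by apply/rowP => i; rewrite !mxE pdF_periodic //; exact: ham_periodic. Qed.
Lemma grad_x_periodic x p k : grad_x H (x + zvec R k) p = grad_x H x p.
Proof. by apply/rowP => i; rewrite !mxE pdF_periodic //; exact: ham_periodic. Qed.

(** The function t -> H_p(x, p + t w).w has the Hessian form at w as its derivative. *)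
Lemma grad_p_strict_monotone x p p' : p' != p ->
  0 < dot (grad_p H x p' - grad_p H x p) (p' - p).
Proof.
move=> pp'; set w := p' - p; have w0 : w != 0 by rewrite subr_eq0.
pose psi (t : R) := dot (grad_p H x (p + t *: w)) w.
pose dpsi (t : R) := (w *m Hess_p H x (p + t *: w) *m w^T) 0 0.
have dp (t : R) : is_derive t 1 psi (dpsi t).
  have -> : psi = \sum_(i < n) (fun t => pdF H (inr i) x (p + t *: w) * w 0 i).
    by apply/funext => s; rewrite /psi /dot fct_sumE; apply: eq_bigr => i _; rewrite !mxE.
  have -> : dpsi t = \sum_(i < n) dot (grad_p (pdF H (inr i)) x (p + t *: w)) w * w 0 i.
    rewrite /dpsi -mulmxA mxE; apply: eq_bigr => i _; rewrite mulrC; congr (_ * _).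
    by rewrite mxE; apply: eq_bigr => j _; rewrite !mxE.
  apply: is_derive_sum => i.
  have hd := C1_2_line_p x p w t (ham_pd_C1 (inr i)).
  exact: is_derive_mulr.
have [t _] := mvt_between 0 1 dp.
rewrite subr0 mulr1 add0r mulr1 /psi scale1r scale0r addr0 -dotBl {1}/w (addrC p) subrK => ->.
exact: ham_hess.
Qed.

Lemma ham_convex_lt x p p' : p' != p ->
  H x p + dot (grad_p H x p) (p' - p) < H x p'.
Proof.
move=> pp'; set w := p' - p; have w0 : w != 0 by rewrite subr_eq0.
have dH (t : R) := C1_2_line_p x p w t ham_C1.
have psi_lt (t : R) : 0 < t -> dot (grad_p H x p) w < dot (grad_p H x (p + t *: w)) w.
  move=> t0; have : p + t *: w != p.
    by rewrite -subr_eq0 (addrC p) addrK scaler_eq0 negb_or gt_eqF.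
  move=> /(grad_p_strict_monotone x); rewrite (addrC p) addrK dotZr pmulr_rgt0 //.
  by rewrite dotBl subr_gt0.
(* An interior point is required: the strict gain of [psi_lt] is lost at parameter 0. *)
have [c /andP[c0 _]] := mvt_open ltr01 dH.
rewrite subr0 mulr1 scale1r scale0r addr0 {1}/w (addrC p) subrK => E.
by rewrite -ltrBrDl E psi_lt.
Qed.

Lemma legendre_max_exists s : 0 <= s -> exists2 r : R, 0 <= r & forall x xi, `|xi| <= s ->
  (forall p, r < `|p| -> dot xi p - H x p < - H x 0) /\
  exists p, forall p', dot xi p' - H x p' <= dot xi p - H x p.
Proof.
(* The slope [n%:R * s] absorbs xi.p, and the remaining |p| exceeds the bound [C] of |H(x, 0)|, so
   points beyond [r] lose to p = 0. *)
move=> s0; have [r0 Hr] := ham_superlinear (n%:R * s + 1).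
have [C C0 HC] := periodic_slab_bounded 0 ham_continuous ham_periodic.
pose r := Num.max (Num.max r0 C) 0.
have r0r : r0 <= r by rewrite /r !le_max lexx.
have Cr : C <= r by rewrite /r !le_max lexx orbT.
have rge : 0 <= r by rewrite /r le_max lexx orbT.
exists r => // x xi xis.
have far p : r < `|p| -> dot xi p - H x p < - H x 0.
  move=> rp; have h1 := Hr x p (ltW (le_lt_trans r0r rp)).
  have h2 : dot xi p <= n%:R * s * `|p|.
    apply: le_trans (ler_norm _) _; apply: le_trans (norm_dot _ _) _.
    rewrite -mulrA ler_wpM2l // ler_wpM2r //.
  have := HC x 0; rewrite normr0 => /(_ (lexx _)) /ler_normlP[h3 h4].
  have : C < `|p| by exact: le_lt_trans Cr rp.
  move: h1; rewrite mulrDl mul1r; lra.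
split => //.
have cf : continuous (fun p => dot xi p - H x p).
  have c1 : continuous (fun p => dot xi p).
    apply: (continuous_after (f := fun p : vec => (xi, p)) (g := fun q => dot q.1 q.2)).
      by apply: continuous_pair => q; [exact: cst_continuous|exact: cvg_id].
    exact: dot_continuous.
  have c2 : continuous (fun p => H x p).
    apply: (continuous_after (f := fun p : vec => (x, p)) (g := fun q => H q.1 q.2)).
      by apply: continuous_pair => q; [exact: cst_continuous|exact: cvg_id].
    exact: ham_continuous.
  by move=> p; exact: cvgB (c1 p) (c2 p).
have A0 : [set p : vec | `|p| <= r] !=set0 by exists 0; rewrite /= normr0.
have [p _ Hp] := compact_EVT_max A0 (closed_ball0_compact (r := r))
  (continuous_subspaceT cf).
exists p => p'; have [pr|pr] := lerP `|p'| r; first by apply: Hp; rewrite inE.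
apply: le_trans (ltW (far _ pr)) _.
have := Hp 0; rewrite dot0r sub0r; apply; by rewrite inE /= normr0.
Qed.

(** A maximizer in the supremum defining L: it exists by [legendre_max_exists], is unique by strict
    convexity, and equals L_xi by [lagrangian_grad_pE]. *)
Definition momentum (x xi : vec) : vec :=
  xget 0 [set p | forall p', dot xi p' - H x p' <= dot xi p - H x p].

Lemma momentum_max x xi p' :
  dot xi p' - H x p' <= dot xi (momentum x xi) - H x (momentum x xi).
Proof.
rewrite /momentum; have [r _ /(_ x xi (lexx _))[_ [p hp]]] := legendre_max_exists (normr_ge0 xi).
by case: xgetP => [y _|/(_ p)]; [exact|case].
Qed.

Lemma momentum_crit x xi : grad_p H x (momentum x xi) = xi.
Proof.
set p := momentum x xi; apply/rowP => i.
have dH (t : R) := hasgrad_line p i (C1_2_hasgrad_p x ham_C1) t.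
pose f (t : R) := t * xi 0 i - H x (p + t *: ev R i).
have df (t : R) : is_derive t 1 f (1 * xi 0 i - grad_p H x (p + t *: ev R i) 0 i).
  have h1 := @is_derive_mulr _ id t 1 (xi 0 i) (is_derive_id t 1).
  exact: is_deriveB h1 (dH t).
have h0 : is_derive (0 : R) 1 f 0.
  apply: (@derive1_at_max _ f (- 1) 1 0).
  - by lra.
  - by move=> t _; case: (df t).
  - by rewrite in_itv /=; apply/andP; split; lra.
  - move=> t _; have := momentum_max x xi (p + t *: ev R i); rewrite -/p.
    by rewrite dotDr dotZr dot_ev /f scale0r addr0 mul0r; lra.
have [_ e1] := h0; have [_ e2] := df 0.
by move: e2; rewrite e1 scale0r addr0; lra.
Qed.

(** Strict convexity leaves no maximizer other than the critical point. *)
Lemma momentumP x xi p : grad_p H x p = xi <-> momentum x xi = p.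
Proof.
split=> [E|<-]; last exact: momentum_crit.
apply/eqP; apply: contraT => /(ham_convex_lt x).
have := momentum_max x xi p; rewrite E dotBr; lra.
Qed.

Lemma momentum_grad_p x p : momentum x (grad_p H x p) = p.
Proof. exact/momentumP. Qed.

Lemma lagrangianE x xi :
  lagrangian H x xi = dot xi (momentum x xi) - H x (momentum x xi).
Proof.
apply/eqP; rewrite eq_le; apply/andP; split.
  apply: ge_sup; first by exists (dot xi 0 - H x 0); exists 0.
  by move=> _ [p _ <-]; exact: momentum_max.
apply: ub_le_sup; last by exists (momentum x xi).
by exists (dot xi (momentum x xi) - H x (momentum x xi)) => _ [p _ <-]; exact: momentum_max.
Qed.

Lemma fenchel x xi p : dot xi p - H x p <= lagrangian H x xi.
Proof. by rewrite lagrangianE; exact: momentum_max. Qed.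

Lemma lagrangian_grad_p x p :
  lagrangian H x (grad_p H x p) = dot (grad_p H x p) p - H x p.
Proof. by rewrite lagrangianE momentum_grad_p. Qed.

Lemma momentum_bounded s : exists2 r : R, 0 <= r & forall x xi, `|xi| <= s ->
  `|momentum x xi| <= r.
Proof.
have [r r0 hr] := legendre_max_exists (normr_ge0 s).
exists r => // x xi xis; have [far _] := hr x xi (le_trans xis (ler_norm s)).
case: lerP => // /far; have := momentum_max x xi 0; rewrite dot0r; lra.
Qed.

Lemma momentum_periodic x xi k : momentum (x + zvec R k) xi = momentum x xi.
Proof. by apply/momentumP; rewrite grad_p_periodic; exact: momentum_crit. Qed.

Lemma lagrangian_periodic : periodic2 (lagrangian H).
Proof.
by move=> x xi k; rewrite !lagrangianE momentum_periodic ham_periodic.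
Qed.

(** Momenta are locally bounded, and any cluster point p at q0 = (x, xi) solves H_p(x, p) = xi,
    hence is the momentum at q0; a unique cluster point in a compact set is a limit. *)
Lemma momentum_continuous : continuous (fun q : vec * vec => momentum q.1 q.2).
Proof.
move=> q0; pose s := `|q0.2| + 1.
have [r r0 Hr] := momentum_bounded s.
pose V := [set p : vec | `|p| <= r + 1].
have near_s : \forall q \near q0, `|q.2| <= s.
  apply/nbhs_ballP; exists 1 => //= q; rewrite ball_prod_normE /ball_ /= => h.
  have : `|q0.2 - q.2| < 1 by apply: le_lt_trans h; rewrite prod_normE /= le_max lexx orbT.
  move=> h2; rewrite /s -(subrK q0.2 q.2) (le_trans (ler_normD _ _)) // addrC lerD2l.
  by rewrite distrC ltW.
have q0s : `|q0.2| <= s by rewrite lerDl.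
pose F := (fun q : vec * vec => momentum q.1 q.2) @ q0.
have FF : ProperFilter F by exact: fmap_proper_filter.
have FV : F V.
  apply: filterS near_s => q qs; rewrite /V /= (le_trans (Hr _ _ qs)) //; lra.
have cV : compact V by exact: closed_ball0_compact.
have sub : cluster F `<=` [set momentum q0.1 q0.2].
  move=> p cp; apply/esym/momentumP/eqP; apply: contraT => ne.
  pose e := `|grad_p H q0.1 p - q0.2|; have e0 : 0 < e by rewrite normr_gt0 subr_eq0.
  have e20 : 0 < e / 2 by rewrite divr_gt0.
  have cgp := C1_2_grad_p_continuous ham_C1.
  have [d d0 Hd] := (continuous_ed (fun q : vec * vec => grad_p H q.1 q.2)
    (q0.1, p)).1 (@cgp _) (e / 2) e20.
  have FA : F [set p' | exists2 q, `|q - q0| < Num.min d (e / 2) & p' = momentum q.1 q.2].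
    apply/nbhs_ballP; exists (Num.min d (e / 2)); first by rewrite /= lt_min d0.
    move=> q; rewrite ball_prod_normE /ball_ /= distrC => hq; by exists q.
  have nB : nbhs p (ball p d) by exact: nbhsx_ballx.
  have [p' [[q hq ->]]] := cp _ _ FA nB.
  rewrite -ball_normE /ball_ /= => hp.
  move: hq; rewrite lt_min => /andP[hq1 hq2].
  have h1 : `|q.1 - q0.1| <= `|q - q0| by rewrite prod_normE /= le_max lexx.
  have h2 : `|q.2 - q0.2| <= `|q - q0| by rewrite prod_normE /= le_max lexx orbT.
  have := Hd (q.1, momentum q.1 q.2); rewrite prod_normE /= momentum_crit gt_max.
  rewrite (le_lt_trans h1 hq1) /= distrC hp => /(_ isT) h3.
  have : e <= `|q.2 - grad_p H q0.1 p| + `|q.2 - q0.2|.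
    rewrite (distrC q.2) /e; apply: le_trans (ler_normD _ _).
    by rewrite addrA subrK.
  move: (le_lt_trans h2 hq2); lra.
have cl : cluster F = [set momentum q0.1 q0.2].
  apply/seteqP; split => // _ ->; have [p [_ cp]] := cV _ FF FV.
  by rewrite -(sub _ cp).
apply: (@compact_cluster_set1 vec (momentum q0.1 q0.2) F V) => //.
apply/nbhs_ballP; exists 1 => //= p; rewrite -ball_normE /ball_ /= => hp.
rewrite /V /= -(subrK (momentum q0.1 q0.2) p) (le_trans (ler_normD _ _)) //.
by rewrite addrC lerD ?Hr // distrC ltW.
Qed.

Lemma lagrangian_continuous : continuous (fun q : vec * vec => lagrangian H q.1 q.2).
Proof.
have -> : (fun q : vec * vec => lagrangian H q.1 q.2) =
  (fun q => dot q.2 (momentum q.1 q.2) - H q.1 (momentum q.1 q.2)).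
  by apply/funext => q; rewrite lagrangianE.
have c1 : continuous (fun q : vec * vec => dot q.2 (momentum q.1 q.2)).
  apply: (continuous_after (f := fun q : vec * vec => (q.2, momentum q.1 q.2))
    (g := fun q => dot q.1 q.2)); last exact: dot_continuous.
  by apply: continuous_pair; [move=> ?; exact: cvg_snd|exact: momentum_continuous].
have c2 : continuous (fun q : vec * vec => H q.1 (momentum q.1 q.2)).
  apply: (continuous_after (f := fun q : vec * vec => (q.1, momentum q.1 q.2))
    (g := fun q => H q.1 q.2)); last exact: ham_continuous.
  by apply: continuous_pair; [move=> ?; exact: cvg_fst|exact: momentum_continuous].
by move=> q; exact: cvgB (c1 q) (c2 q).
Qed.

(** The maximizer at (x', xi') is a competitor at (x, xi). The derivatives of L and its Lipschitz
    bounds are drawn from this one-sided comparison. *)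
Lemma lagrangian_upper x xi x' xi' :
  lagrangian H x' xi' - lagrangian H x xi <=
  dot (xi' - xi) (momentum x' xi') - (H x' (momentum x' xi') - H x (momentum x' xi')).
Proof. have := fenchel x xi (momentum x' xi'); rewrite (lagrangianE x' xi') dotBl; lra. Qed.

Lemma lagrangian_superlinear (K : R) : 0 <= K ->
  exists2 C, 0 < C & forall x xi, K * `|xi| - C <= lagrangian H x xi.
Proof.
move=> K0; have [C C0 HC] := periodic_slab_bounded K ham_continuous ham_periodic.
exists C => // x xi.
have [/eqP xi0|xi0] := boolP (xi == 0).
  rewrite xi0 normr0 mulr0 sub0r; apply: le_trans (fenchel x 0 0).
  rewrite dot0l sub0r lerN2; apply: le_trans (ler_norm _) (HC _ _ _); by rewrite normr0.
have [[i0 i] /= Ei] : exists i : 'I_1 * 'I_n, `|xi| = `|xi i.1 i.2|.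
  apply: mx_norm_neq0; apply: contra xi0 => /eqP h; apply/eqP.
  exact: mx_norm_eq0.
rewrite ord1 in Ei.
(* The sup norm of xi is attained at coordinate [i], so this p has norm at most K and pairs with xi
   to exactly K |xi|. *)
pose p : vec := (K * Num.sg (xi 0 i)) *: ev R i.
have pK : `|p| <= K.
  apply: norm_le_coord => // j; rewrite !mxE eqxx /=.
  case: (j == i); rewrite ?mulr1 ?mulr0 ?normr0 // normrM (ger0_norm K0).
  rewrite -[leRHS]mulr1 ler_wpM2l // normr_sg; by case: (_ != _).
apply: le_trans (fenchel x xi p).
have -> : dot xi p = K * `|xi| by rewrite dotZr dot_ev Ei normrEsg mulrA.
rewrite lerD2l lerN2; exact: le_trans (ler_norm _) (HC _ _ pK).
Qed.

(** Envelope argument: [lagrangian_upper] in both directions encloses the increment between those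
    obtained with the momentum frozen at either end, and these momenta converge by continuity. The
    scalar [a] lets base and velocity vary together or separately. *)
Lemma lagrangian_is_derive (x xi w : vec) i (a : R) :
  is_derive (0 : R) 1 (fun t => lagrangian H (x + t *: (a *: ev R i)) (xi + t *: w))
   (dot w (momentum x xi) - a * grad_x H x (momentum x xi) 0 i).
Proof.
set P := momentum x xi.
pose Pt (t : R) := momentum (x + t *: (a *: ev R i)) (xi + t *: w).
pose g (q : vec * vec) := dot w q.2 - a * grad_x H q.1 q.2 0 i.
have cg : continuous g.
  have c1 : continuous (fun q : vec * vec => dot w q.2).
    apply: (continuous_after (f := fun q : vec * vec => (w, q.2)) (g := fun q => dot q.1 q.2)).
      by apply: continuous_pair => q; [exact: cst_continuous|exact: cvg_snd].
    exact: dot_continuous.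
  have c2 : continuous (fun q : vec * vec => grad_x H q.1 q.2 0 i).
    apply: (continuous_after (g := fun y : vec => y 0 i)); last exact: coord_continuous.
    exact: C1_2_grad_x_continuous ham_C1.
  by move=> q; apply: cvgB (c1 q) _; apply: cvgMr; exact: c2.
have cPt : continuous Pt.
  apply: (continuous_after (f := fun t : R => (x + t *: (a *: ev R i), xi + t *: w))
    (g := fun q => momentum q.1 q.2)); last exact: momentum_continuous.
  have cz (y z : vec) : continuous (fun t : R => y + t *: z).
    by move=> t; apply: cvgD; [exact: cvg_cst|apply: cvgZr_tmp; exact: cvg_id].
  by apply: continuous_pair; exact: cz.
apply: is_derive_ed => e e0.
have [d d0 Hd] := (continuous_ed g (x, P)).1 (@cg _) e e0.
have [d1 d10 Hd1] := (continuous_ed Pt 0).1 (@cPt _) d d0.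
have Pt0 : Pt 0 = P by rewrite /Pt !scale0r !addr0.
exists (Num.min d1 (d / (`|a| + 1))) => [|t].
  by rewrite lt_min d10 divr_gt0 // ltr_wpDl.
rewrite lt_min => /andP[td1 td2]; rewrite add0r !scale0r !addr0.
have hPt : `|Pt t - P| < d by rewrite -Pt0; apply: Hd1; rewrite subr0.
have key Q : `|Q - P| < d -> exists2 s,
    `|s - g (x, P)| < e &
    dot (t *: w) Q - (H (x + t *: (a *: ev R i)) Q - H x Q) = t * s.
  move=> QP.
  have [s /andP[s0 s1]] := mvt_between 0 (t * a)
    (hasgrad_line x i (C1_2_hasgrad_x Q ham_C1)).
  rewrite scale0r addr0 !subr0 add0r scalerA => E.
  exists (g (x + (s * (t * a)) *: ev R i, Q)); last by rewrite E dotZl /g /=; ring.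
  apply: Hd; rewrite prod_normE /= gt_max QP andbT addrC addKr.
  apply: le_lt_trans (_ : `|t| * (`|a| + 1) < d); last by rewrite -ltr_pdivlMr // ltr_wpDl.
  apply: norm_le_coord => [|j]; first by rewrite mulr_ge0 // addr_ge0.
  rewrite !mxE eqxx /= !normrM (ger0_norm s0) -mulrA.
  have h1 : `|t| * `|a| <= `|t| * (`|a| + 1) by rewrite ler_wpM2l // lerDl.
  have h2 : `|(j == i)%:R : R| <= 1 by case: (j == i); rewrite ?normr1 ?normr0.
  apply: le_trans h1.
  have ta : 0 <= `|t| * `|a| by rewrite mulr_ge0.
  have -> : s * (`|t| * `|a| * `|(j == i)%:R|) = `|t| * `|a| * (s * `|(j == i)%:R|) by ring.
  rewrite -[leRHS]mulr1 ler_wpM2l // -[leRHS]mulr1 ler_pM //.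
have [s1 hs1 E1] := key _ hPt.
have [s2 hs2 E2] : exists2 s, `|s - g (x, P)| < e &
    dot (t *: w) P - (H (x + t *: (a *: ev R i)) P - H x P) = t * s.
  by apply: key; rewrite subrr normr0.
have up := lagrangian_upper x xi (x + t *: (a *: ev R i)) (xi + t *: w).
have X1 : xi + t *: w - xi = t *: w by rewrite addrC addKr.
have X2 : xi - (xi + t *: w) = - (t *: w) by rewrite opprD addrA subrr add0r.
have lo := lagrangian_upper (x + t *: (a *: ev R i)) (xi + t *: w) x xi.
rewrite -/(Pt t) X1 E1 in up; rewrite -/P X2 dotNl in lo.
have b1 : t * (s1 - g (x, P)) <= e * `|t|.
  apply: le_trans (ler_norm _) _; rewrite normrM mulrC; apply: ler_wpM2r => //; exact: ltW.
have b2 : - (e * `|t|) <= t * (s2 - g (x, P)).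
  rewrite lerNl; apply: le_trans (ler_norm _) _; rewrite normrN normrM mulrC.
  by apply: ler_wpM2r => //; exact: ltW.
have Eg : dot w P - a * grad_x H x P 0 i = g (x, P) by [].
rewrite Eg ler_norml; apply/andP; split; move: b1 b2 up lo E2; rewrite !mulrBr; lra.
Qed.

Lemma lagrangian_grad_pE x xi : grad_p (lagrangian H) x xi = momentum x xi.
Proof.
apply/rowP => i; rewrite !mxE /pdF /dd /= derive1E.
have [_] := lagrangian_is_derive x xi (ev R i) i 0.
rewrite mul0r subr0 dotC dot_ev => <-; congr (derive _ (0 : R) (1 : R)); apply/funext => t.
by rewrite scale0r scaler0.
Qed.

Lemma lagrangian_grad_xE x xi :
  grad_x (lagrangian H) x xi = - grad_x H x (momentum x xi).
Proof.
apply/rowP => i; rewrite !mxE /pdF /dd /= derive1E.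
have [_] := lagrangian_is_derive x xi 0 i 1.
rewrite mul1r dot0l sub0r mxE => <-; congr (derive _ (0 : R) (1 : R)); apply/funext => t.
by rewrite scale1r.
Qed.

End Legendre.

(** * The Euler-Lagrange flow in Hamiltonian form *)

Section Bootstrap.
Context {R : realType}.

(** If the bound failed, there would be a first time with m >= 1 by compactness, and there [step]
    gives m < 1. *)
Lemma bootstrap (m : R -> R) (a b : R) : continuous m ->
  (forall t, a <= t <= b -> (forall s, a <= s < t -> m s < 1) -> m t < 1) ->
  forall t, a <= t <= b -> m t < 1.
Proof.
move=> cm step t /andP[at_ tb]; rewrite ltNge; apply/negP => m1.
pose S := `[a, b]%classic `&` (m @^-1` [set y | 1 <= y]).
have cS : compact S.
  apply: (@subclosed_compact _ S `[a, b]%classic).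
  - apply: closedI; first exact: itv_closed.
    by apply: closed_comp => [x _|]; [exact: cm|exact: closed_ge].
  - exact: segment_compact.
  - by move=> x [].
have S0 : S !=set0 by exists t; split => //=; rewrite in_itv /= at_ tb.
have [t0 + min] := compact_EVT_min S0 cS (@continuous_subspaceT _ _ S id (fun x => cvg_id)).
rewrite inE => -[/=]; rewrite in_itv /= => /andP[at0 t0b] mt0.
have : m t0 < 1.
  apply: step; first by rewrite at0.
  move=> s /andP[as_ st0]; rewrite ltNge; apply/negP => ms.
  have := min s; rewrite inE => /(_ _); rewrite leNgt st0 => /(_ _)/negP; apply => //.
  by split => //=; rewrite in_itv /= as_ (le_trans (ltW st0)).
by rewrite ltNge mt0.
Qed.

End Bootstrap.

(** * Euler polygons, uniqueness and continuous dependence for autonomous systems *)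

Section ODE.
Context {R : realType} {n : nat}.
Local Notation vec := 'rV[R]_n.
Local Notation state := (vec * vec)%type.

Definition solution (X : state -> state) (z : R -> state) := forall (t : R) i,
  is_derive t 1 (fun s => (z s).1 0 i) ((X (z t)).1 0 i) /\
  is_derive t 1 (fun s => (z s).2 0 i) ((X (z t)).2 0 i).

(** Only the second component is confined: the field to be treated is periodic in the first, so its
    bounds are uniform there. *)
Definition locally_lipschitz (X : state -> state) := forall r : R,
  exists K M : R, [/\ 0 < K, 0 < M,
    forall a b, `|a.2| <= r -> `|b.2| <= r -> `|X a - X b| <= K * `|a - b| &
    forall a, `|a.2| <= r -> `|X a| <= M].

Lemma norm_fst (q : state) : `|q.1| <= `|q|.
Proof. by rewrite prod_normE le_max lexx. Qed.
Lemma norm_snd (q : state) : `|q.2| <= `|q|.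
Proof. by rewrite prod_normE le_max lexx orbT. Qed.
Lemma norm_pair_le (q : state) e : `|q.1| <= e -> `|q.2| <= e -> `|q| <= e.
Proof. by move=> h1 h2; rewrite prod_normE ge_max h1. Qed.

Lemma locally_lipschitz_opp X : locally_lipschitz X -> locally_lipschitz (fun q => - X q).
Proof.
move=> LX r; have [K [M [K0 M0 h1 h2]]] := LX r; exists K, M; split => //.
  by move=> a b ha hb; rewrite -opprD normrN h1.
by move=> a ha; rewrite normrN h2.
Qed.

Lemma solution_opp X z : solution X z -> solution (fun q => - X q) (fun t => z (- t)).
Proof.
have key (f : R -> R) l (t : R) : is_derive (- t) 1 f l -> is_derive t 1 (fun s => f (- s)) (- l).
  move=> h; have h2 : is_derive t 1 (fun s : R => - s) (- 1).
    exact: (is_deriveN (is_derive_id t 1)).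
  by have := is_derive1_comp h h2; rewrite mulrN1.
by move=> sz t i /=; have [h1 h2] := sz (- t) i; split; rewrite !mxE; exact: key.
Qed.

Lemma solution_shift X z t0 : solution X z -> solution X (fun t => z (t + t0)).
Proof.
have key (f : R -> R) l (t : R) : is_derive (t + t0) 1 f l ->
    is_derive t 1 (fun s => f (s + t0)) l.
  move=> h; have h2 : is_derive t 1 (fun s : R => s + t0) 1.
    by have := is_deriveD (is_derive_id t 1) (is_derive_cst t0 t 1); rewrite addr0.
  by have := @is_derive1_comp _ f (fun s : R => s + t0) t _ _ h h2; rewrite mulr1.
by move=> sz t i /=; have [h1 h2] := sz (t + t0) i; split; exact: key.
Qed.

Lemma solution_continuous X z : solution X z -> continuous z.
Proof.
move=> sz; have -> : z = (fun t => ((z t).1, (z t).2)) by apply/funext => t; case: (z t).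
by apply: continuous_pair; apply: continuous_coord => i t;
  have [h1 h2] := sz t i; [exact: is_derive_continuous h1|exact: is_derive_continuous h2].
Qed.

(** The sup norm allows each coordinate its own intermediate time in the mean value theorem. *)
Lemma solution_increment X z (a b eta : R) (G : state) : solution X z -> a <= b ->
  (forall s, a < s < b -> `|X (z s) - G| <= eta) ->
  `|z b - z a - (b - a) *: G| <= eta * (b - a).
Proof.
move=> sz; rewrite le_eqVlt => /predU1P[->|ab] h.
  by rewrite !subrr scale0r subrr normr0 mulr0.
have ba0 : 0 < b - a by rewrite subr_gt0.
have e0 : 0 <= eta.
  apply: le_trans (normr_ge0 _) (h ((a + b) / 2) _); apply/andP; split; lra.
have key (f : R -> R) (df : R -> R) g : (forall t : R, is_derive t 1 f (df t)) ->
    (forall s, a < s < b -> `|df s - g| <= eta) ->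
    `|f b - f a - (b - a) * g| <= eta * (b - a).
  move=> hf hd; have [s sab ->] := mvt_open ab hf.
  by rewrite (mulrC (b - a)) -mulrBl normrM (gtr0_norm ba0) ler_wpM2r ?hd // ltW.
apply: norm_pair_le => /=; apply: norm_le_coord; rewrite ?mulr_ge0 ?(ltW ba0) // => i; rewrite !mxE.
- apply: (key (fun s => (z s).1 0 i) (fun s => (X (z s)).1 0 i)).
    by move=> t; have [] := sz t i.
  move=> s /h; apply: le_trans; apply: le_trans (norm_fst _).
  by have := norm_coord (X (z s) - G).1 i; rewrite !mxE.
- apply: (key (fun s => (z s).2 0 i) (fun s => (X (z s)).2 0 i)).
    by move=> t; have [] := sz t i.
  move=> s /h; apply: le_trans; apply: le_trans (norm_snd _).
  by have := norm_coord (X (z s) - G).2 i; rewrite !mxE.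
Qed.

(** As long as the second component has moved by less than 1 the speed is at most [M], and in time
    less than 1 / M it cannot move by 1; [bootstrap] closes the circle. *)
Lemma solution_stays X z (r M a b : R) : solution X z -> 0 < M ->
  (forall q, `|q.2| <= r + 1 -> `|X q| <= M) ->
  `|(z a).2| <= r -> M * (b - a) < 1 ->
  forall t, a <= t <= b -> `|(z t).2| <= r + 1 /\ `|z t - z a| <= M * (t - a).
Proof.
move=> sz M0 hM za hb.
have inc t : a <= t -> (forall s, a <= s < t -> `|(z s).2 - (z a).2| < 1) ->
    `|z t - z a| <= M * (t - a).
  move=> at_ hs; have := @solution_increment X z a t M 0 sz at_.
  rewrite scaler0 subr0; apply => s /andP[as_ st]; rewrite subr0; apply: hM.
  rewrite -(subrK (z a).2 (z s).2) (le_trans (ler_normD _ _)) // addrC lerD //.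
  by apply: ltW; apply: hs; rewrite st ltW.
have key : forall t, a <= t <= b -> `|(z t).2 - (z a).2| < 1.
  apply: (@bootstrap R (fun t => `|(z t).2 - (z a).2|)).
    have cz := solution_continuous sz.
    move=> t; apply: (@continuous_comp _ _ _ (fun t => (z t).2 - (z a).2)); last exact: norm_continuous.
    apply: cvgB; last exact: cvg_cst.
    by apply: (@continuous_comp _ _ _ z snd); [exact: cz|exact: cvg_snd].
  move=> t /andP[at_ tb] hs; apply: le_lt_trans (norm_snd (z t - z a)) _.
  apply: le_lt_trans (inc t at_ hs) _; apply: le_lt_trans hb.
  by rewrite ler_pM2l // lerD2r.
move=> t /andP[at_ tb]; have kt := key t; split.
  rewrite -(subrK (z a).2 (z t).2) (le_trans (ler_normD _ _)) // addrC lerD //.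
  by rewrite ltW // kt // at_.
apply: inc => // s /andP[as_ st]; apply: key; rewrite as_ ltW //; exact: lt_le_trans st tb.
Qed.

(** One step of the error in [euler_error]: local error of the solution, previous error, difference
    of the two field values, local error of the polygon. *)
Lemma telescope4 (a b c d e f : state) :
  a - c = (a - b - e) + (b - d) + (e - f) - (c - d - f).
Proof.
case: a b c d e f => [a1 a2] [b1 b2] [c1 c2] [d1 d2] [e1 e2] [f1 f2].
by congr pair => /=; apply/rowP => i; rewrite !mxE; ring.
Qed.

(** A discrete Gronwall estimate. The field is controlled up to r + 2 because the polygon lives in
    radius r, the accumulated error is at most 1 by the smallness hypothesis, and the solution moves
    by less than 1 during a step. *)
Lemma euler_error X z (y : nat -> state) (r K M A T dlt : R) (N : nat) :
  solution X z -> 0 < K -> 0 < M -> 0 <= A -> 0 < dlt ->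
  (forall a b, `|a.2| <= r + 2 -> `|b.2| <= r + 2 -> `|X a - X b| <= K * `|a - b|) ->
  (forall a, `|a.2| <= r + 2 -> `|X a| <= M) ->
  (forall k, `|(y k).2| <= r) ->
  (forall k, (k < N)%N -> `|y k.+1 - y k - dlt *: X (y k)| <= A * dlt ^+ 2) ->
  N%:R * dlt <= T -> M * dlt < 1 ->
  expR (K * T) * (`|z 0 - y 0%N| + T * (A + K * M) * dlt) <= 1 ->
  forall k, (k <= N)%N ->
  `|z (k%:R * dlt) - y k| <= expR (K * T) * (`|z 0 - y 0%N| + T * (A + K * M) * dlt).
Proof.
move=> sz K0 M0 A0 d0 LX BX yr ystep NT Md small.
set B := A + K * M; have B0 : 0 <= B by rewrite addr_ge0 // mulr_ge0 ?ltW.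
set e0 := `|z 0 - y 0%N| in small *.
have e00 : 0 <= e0 by exact: normr_ge0.
(* A majorant of the recursion e_(k+1) <= (1 + K dlt) e_k + B dlt^2 started at [e0]. *)
pose f k := (1 + K * dlt) ^+ k * (e0 + k%:R * (B * dlt ^+ 2)).
have f_le k : (k <= N)%N -> f k <= expR (K * T) * (e0 + T * B * dlt).
  move=> kN; have kT : k%:R * dlt <= T.
    by apply: le_trans NT; rewrite ler_pM2r // ler_nat.
  apply: ler_pM.
  - by rewrite exprn_ge0 // addr_ge0 // mulr_ge0 ?ltW.
  - by rewrite addr_ge0 // mulr_ge0 // mulr_ge0 // sqr_ge0.
  - apply: le_trans (_ : expR (K * dlt) ^+ k <= _).
      apply: lerXn2r; rewrite ?nnegrE; last exact: expR_ge1Dx.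
        by rewrite addr_ge0 // mulr_ge0 // ltW.
      exact: expR_ge0.
    by rewrite -expRM_natl ler_expR mulrCA ler_pM2l.
  - rewrite lerD2l; have -> : k%:R * (B * dlt ^+ 2) = (k%:R * dlt) * (B * dlt) by ring.
    by rewrite -[T * B * dlt]mulrA ler_wpM2r // mulr_ge0 // ltW.
suff main k : (k <= N)%N -> `|z (k%:R * dlt) - y k| <= f k.
  by move=> k kN; exact: le_trans (main k kN) (f_le k kN).
elim: k => [|k IH] kN.
  by rewrite mul0r /f expr0 mul1r mul0r addr0.
have {}IH := IH (ltnW kN).
set tk := k%:R * dlt in IH *; set ek := `|z tk - y k| in IH.
have zk1 : `|(z tk).2| <= r + 1.
  rewrite -(subrK (y k).2 (z tk).2) (le_trans (ler_normD _ _)) // addrC lerD //.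
  apply: le_trans (norm_snd (z tk - y k)) _; apply: le_trans IH _.
  by apply: le_trans (f_le _ (ltnW kN)) _.
have E : k.+1%:R * dlt = tk + dlt by rewrite -natr1 mulrDl mul1r.
have r2 : r + 1 + 1 = r + 2 by ring.
have stay := @solution_stays X z (r + 1) M tk (tk + dlt) sz M0.
rewrite r2 in stay; have {}stay := stay BX zk1.
have {}stay : forall t, tk <= t <= tk + dlt -> `|(z t).2| <= r + 2 /\ `|z t - z tk| <= M * (t - tk).
  by apply: stay; rewrite (addrC tk dlt) addrK.
have tkd : tk <= tk + dlt by rewrite lerDl ltW.
have stz : tk <= tk <= tk + dlt by rewrite lexx.
have yr2 : `|(y k).2| <= r + 2 by apply: le_trans (yr k) _; lra.
have := @solution_increment X z tk (tk + dlt) (K * (M * dlt)) (X (z tk)) sz tkd.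
rewrite (addrC tk) addrK => inc; rewrite E (addrC tk).
have {}inc : `|z (dlt + tk) - z tk - dlt *: X (z tk)| <= K * (M * dlt) * dlt.
  apply: inc => s /andP[s1 s2]; have stk : tk <= s <= tk + dlt.
    by rewrite (ltW s1) addrC ltW.
  have [b1 b2] := stay s stk.
  apply: le_trans (LX _ _ b1 (stay _ stz).1) _; rewrite ler_pM2l //.
  by apply: le_trans b2 _; rewrite ler_pM2l // lerBlDr ltW.
have lip : `|dlt *: (X (z tk) - X (y k))| <= dlt * (K * ek).
  by rewrite normrZ gtr0_norm // ler_pM2l // LX // (stay _ stz).1.
have -> : z (dlt + tk) - y k.+1 = (z (dlt + tk) - z tk - dlt *: X (z tk)) +
   (z tk - y k) + dlt *: (X (z tk) - X (y k)) - (y k.+1 - y k - dlt *: X (y k)).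
  rewrite scalerBr; exact: telescope4.
apply: le_trans (_ : K * (M * dlt) * dlt + ek + dlt * (K * ek) + A * dlt ^+ 2 <= _).
  apply: le_trans (ler_normD _ _) _; rewrite normrN; apply: lerD; last exact: ystep.
  apply: le_trans (ler_normD _ _) _; apply: lerD => //.
  by apply: le_trans (ler_normD _ _) _; apply: lerD.
rewrite /f [(1 + K * dlt) ^+ k.+1]exprS; set q := (1 + K * dlt) ^+ k in IH *.
have q1 : 1 <= q by rewrite exprn_ege1 // lerDl mulr_ge0 // ltW.
have h1 : (1 + K * dlt) * ek <= (1 + K * dlt) * f k.
  by apply: ler_wpM2l => //; rewrite addr_ge0 // mulr_ge0 // ltW.
have h2 : B * dlt ^+ 2 <= (1 + K * dlt) * q * (B * dlt ^+ 2).
  rewrite -[leLHS]mul1r; apply: ler_wpM2r; first by rewrite mulr_ge0 // sqr_ge0.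
  by rewrite mulr_ege1 // lerDl mulr_ge0 // ltW.
rewrite -natr1; move: h1 h2; rewrite /f /B -/q; lra.
Qed.

(** Sampled with mesh d, [w] is an Euler polygon up to K M d^2, so [euler_error] applies and its
    mesh term tends to 0 with d. The value 1 / 2 leaves room for that term in the smallness
    hypothesis. *)
Lemma solution_stability X z w (r K M T : R) :
  solution X z -> solution X w -> 0 < K -> 0 < M -> 0 <= T ->
  (forall a b, `|a.2| <= r + 2 -> `|b.2| <= r + 2 -> `|X a - X b| <= K * `|a - b|) ->
  (forall a, `|a.2| <= r + 2 -> `|X a| <= M) ->
  (forall t, 0 <= t <= T -> `|(w t).2| <= r) ->
  expR (K * T) * `|z 0 - w 0| <= 1 / 2 ->
  `|z T - w T| <= expR (K * T) * `|z 0 - w 0|.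
Proof.
move=> sz sw K0 M0; rewrite le_eqVlt => /predU1P[<-|T0] LX BX wr small.
  by rewrite mulr0 expR0 mul1r.
apply/ler_addgt0Pr => e e0.
set ex := expR (K * T) in small *; have ex0 : 0 < ex by exact: expR_gt0.
pose C := ex * T * (K * M + K * M).
have C0 : 0 < C by rewrite !mulr_gt0 // addr_gt0 ?mulr_gt0.
pose m := Num.min (1 / M / 2) (Num.min (1 / 2 / C) (e / C)).
have m0 : 0 < m by rewrite !lt_min !divr_gt0.
pose N := (Num.truncn (T / m)).+1.
have N0 : 0 < N%:R :> R by rewrite ltr0n.
pose d := T / N%:R; have d0 : 0 < d by rewrite divr_gt0.
have dm : d < m.
  by rewrite ltr_pdivrMr // mulrC -ltr_pdivrMr // truncnS_gt.
have Nd : N%:R * d = T by rewrite mulrC divfK // gt_eqF.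
move: dm; rewrite !lt_min => /and3P[dm1 dm2 dm3].
have Md : M * d < 1.
  have : 1 / M / 2 < 1 / M by rewrite ltr_pdivrMr // ltr_pMr ?divr_gt0 //; lra.
  by move=> /(lt_trans dm1); rewrite ltr_pdivlMr // mulrC.
(* Sampling stops at T because [euler_error] bounds every y k, also beyond N. *)
pose y k := w (Num.min (k%:R * d) T).
have min_in k : 0 <= Num.min (k%:R * d) T <= T.
  by rewrite le_min ge_min lexx orbT (ltW T0) mulr_ge0 // ltW.
have ystep k : (k < N)%N -> `|y k.+1 - y k - d *: X (y k)| <= (K * M) * d ^+ 2.
  move=> kN; have kd : k%:R * d + d <= T.
    have -> : k%:R * d + d = k.+1%:R * d by rewrite -natr1 mulrDl mul1r.
    by rewrite -Nd ler_pM2r // ler_nat.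
  have yk : y k = w (k%:R * d) by rewrite /y min_l // (le_trans _ kd) // lerDl ltW.
  have yk1 : y k.+1 = w (k%:R * d + d) by rewrite /y -natr1 mulrDl mul1r min_l.
  have kd0 : 0 <= k%:R * d by rewrite mulr_ge0 // ltW.
  have wr2 t : 0 <= t <= T -> `|(w t).2| <= r + 2 by move=> /wr/le_trans; apply; lra.
  have := @solution_increment X w (k%:R * d) (k%:R * d + d) (K * (M * d)) (X (y k)) sw.
  rewrite lerDl (ltW d0) (addrC (k%:R * d) d) addrK => /(_ isT) inc.
  rewrite yk1 {1}yk (addrC (k%:R * d) d).
  have -> : K * M * d ^+ 2 = K * (M * d) * d by ring.
  apply: inc => s /andP[s1 s2]; rewrite yk.
  have sT : 0 <= s <= T by apply/andP; split; lra.
  apply: le_trans (LX _ _ (wr2 _ sT) (wr2 _ _)) _; first by apply/andP; split; lra.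
  rewrite ler_pM2l //.
  have := @solution_increment X w (k%:R * d) s M 0 sw (ltW s1).
  rewrite scaler0 subr0 => h; apply: le_trans (h _) _ => [u /andP[u1 u2]|].
    by rewrite subr0; apply/BX/wr2; apply/andP; split; lra.
  by rewrite ler_pM2l //; lra.
have KM0 : 0 <= K * M by rewrite mulr_ge0 // ltW.
have yr k : `|(y k).2| <= r by exact/wr/min_in.
have NdT : N%:R * d <= T by rewrite Nd.
have y0 : y 0%N = w 0 by rewrite /y mul0r min_l // ltW.
have yN : y N = w T by rewrite /y Nd min_l.
have := @euler_error X z y r K M (K * M) T d N sz K0 M0 KM0 d0 LX BX yr ystep NdT Md.
rewrite -/ex y0 => h.
have Cd2 : ex * (T * (K * M + K * M) * d) < 1 / 2.
  by move: dm2; rewrite ltr_pdivlMr // /C mulrC !mulrA.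
have Cde : ex * (T * (K * M + K * M) * d) < e.
  by move: dm3; rewrite ltr_pdivlMr // /C mulrC !mulrA.
have := h _ N (leqnn N); rewrite Nd yN mulrDr => h2.
apply: le_trans (h2 _) _; [move: small; lra|by rewrite lerD2l ltW].
Qed.

Lemma solution_unique X z w : locally_lipschitz X -> solution X z -> solution X w ->
  z 0 = w 0 -> z = w.
Proof.
have fwd X' z' w' T : locally_lipschitz X' -> solution X' z' -> solution X' w' ->
    z' 0 = w' 0 -> 0 <= T -> z' T = w' T.
  move=> LX sz sw E T0.
  have cz := solution_continuous sw.
  have [r r0 Hr] := compact_bounded_fun (@segment_compact R 0 T)
    (fun t => @continuous_comp _ _ _ w' Num.norm t (@cz t) (@norm_continuous _ _ _)).
  have [K [M [K0 M0 hL hB]]] := LX (r + 2).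
  have := @solution_stability X' z' w' r K M T sz sw K0 M0 T0 hL hB.
  rewrite E subrr normr0 mulr0 => h; apply/eqP; rewrite -subr_eq0 -normr_le0.
  apply: h => [t /andP[t0 tT]|]; last by lra.
  apply: le_trans (norm_snd _) _; have := Hr t; rewrite /= in_itv /= t0 tT.
  by rewrite normr_id; apply.
move=> LX sz sw E; apply/funext => t; have [t0|t0] := lerP 0 t; first exact: (fwd X).
(* Negative times are positive times of the opposite field. *)
rewrite -(opprK t).
apply: (fwd (fun q => - X q) (fun t => z (- t)) (fun t => w (- t))).
- exact: locally_lipschitz_opp.
- exact: solution_opp.
- exact: solution_opp.
- by rewrite oppr0.
- by rewrite oppr_ge0 ltW.
Qed.

Lemma solution_dependence X w T : locally_lipschitz X -> solution X w ->
  exists C d : R, [/\ 0 < C, 0 < d & forall z, solution X z -> `|z 0 - w 0| <= d ->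
    `|z T - w T| <= C * `|z 0 - w 0|].
Proof.
have fwd X' w' T' : locally_lipschitz X' -> solution X' w' -> 0 <= T' ->
  exists C d : R, [/\ 0 < C, 0 < d & forall z, solution X' z -> `|z 0 - w' 0| <= d ->
    `|z T' - w' T'| <= C * `|z 0 - w' 0|].
  move=> LX sw T0.
  have cz := solution_continuous sw.
  have [r r0 Hr] := compact_bounded_fun (@segment_compact R 0 T')
    (fun t => @continuous_comp _ _ _ w' Num.norm t (@cz t) (@norm_continuous _ _ _)).
  have [K [M [K0 M0 hL hB]]] := LX (r + 2).
  have ex0 := expR_gt0 (K * T').
  exists (expR (K * T')), (1 / 2 / expR (K * T')); split => // [|z sz zd].
    by rewrite divr_gt0.
  apply: (@solution_stability X' z w' r K M T' sz sw K0 M0 T0 hL hB).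
    move=> t /andP[t0 tT]; apply: le_trans (norm_snd _) _.
    by have := Hr t; rewrite /= in_itv /= t0 tT normr_id; apply.
  by rewrite mulrC -ler_pdivlMr.
move=> LX sw; have [t0|t0] := lerP 0 T; first exact: (fwd X).
have [|C [d [C0 d0 h]]] := fwd _ _ (- T) (locally_lipschitz_opp LX) (solution_opp sw).
  by rewrite oppr_ge0 ltW.
rewrite opprK oppr0 in h; exists C, d; split => // z sz zd.
by have := h _ (solution_opp sz); rewrite opprK oppr0; apply.
Qed.

End ODE.

Section Flow.
Context {R : realType} {n : nat}.
Local Notation vec := 'rV[R]_n.
Local Notation state := (vec * vec)%type.
Context (H : vec -> vec -> R) (c : vec) (eps : R) (Phi : R -> phase R n -> phase R n).
Hypothesis tonH : tonelli_hamiltonian H.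
Hypothesis flow : EL_flow H c eps Phi.

(** The Euler-Lagrange equation in the variables (x, L_xi), where L_x = - H_x: the right side
    involves only first derivatives of H, which are locally Lipschitz. *)
Definition ham_field (q : state) : state :=
  (grad_p H q.1 q.2, eps *: (c - q.2) - grad_x H q.1 q.2).

Definition legendre (q : state) : state := (q.1, momentum H q.1 q.2).
Definition legendre_inv (q : state) : state := (q.1, grad_p H q.1 q.2).

Lemma legendreK : cancel legendre legendre_inv.
Proof. by case=> x xi; rewrite /legendre /legendre_inv /= momentum_crit. Qed.

Lemma legendre_continuous : continuous legendre.
Proof.
by apply: continuous_pair; [move=> ?; exact: cvg_fst|exact: momentum_continuous].
Qed.

Lemma legendre_inv_continuous : continuous legendre_inv.
Proof.
apply: continuous_pair; [move=> ?; exact: cvg_fst|].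
exact: C1_2_grad_p_continuous (ham_C1 tonH).
Qed.

Lemma grad_lipschitz (r : R) : exists2 K, 0 < K &
  forall a b : state, `|a.2| <= r -> `|b.2| <= r ->
    `|grad_p H a.1 a.2 - grad_p H b.1 b.2| <= K * `|a - b| /\
    `|grad_x H a.1 a.2 - grad_x H b.1 b.2| <= K * `|a - b|.
Proof.
have /choice[K HK] : forall d, exists K, 0 < K /\
  forall q q' : state, `|q.2| <= r -> `|q'.2| <= r ->
    `|pdF H d q'.1 q'.2 - pdF H d q.1 q.2| <= K * `|q' - q|.
  move=> d; have [K K0 h] := @periodic_C1_lipschitz R n (pdF H d) r (ham_pd_C1 tonH d)
    (pdF_periodic d (ham_periodic tonH)).
  by exists K; split.
pose K0 := \sum_d K d.
have KM d : K d <= K0.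
  by rewrite /K0 (bigD1 d) //= lerDl; apply: sumr_ge0 => e _; apply: ltW; case: (HK e).
have K00 : 0 <= K0 by apply: sumr_ge0 => e _; apply: ltW; case: (HK e).
exists (K0 + 1) => [|a b ar br]; first by rewrite ltr_wpDl.
have b0 d : `|pdF H d a.1 a.2 - pdF H d b.1 b.2| <= (K0 + 1) * `|a - b|.
  case: (HK d) => _ h; apply: le_trans (h b a br ar) _.
  by rewrite ler_wpM2r // (le_trans (KM d)) // lerDl.
have nn : 0 <= (K0 + 1) * `|a - b| by rewrite mulr_ge0 // addr_ge0.
by split; apply: norm_le_coord => // i; rewrite !mxE.
Qed.

Lemma ham_field_locally_lipschitz : locally_lipschitz ham_field.
Proof.
move=> r; have [K K0 hK] := grad_lipschitz r.
pose L := K + `|eps| + 1.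
have L0 : 0 < L by rewrite ltr_wpDl // addr_ge0 // ltW.
have lip a b : `|a.2| <= r -> `|b.2| <= r -> `|ham_field a - ham_field b| <= L * `|a - b|.
  move=> ar br; have [h1 h2] := hK a b ar br.
  have nab : 0 <= `|a - b| by exact: normr_ge0.
  apply: norm_pair_le => /=.
    by apply: le_trans h1 _; rewrite ler_wpM2r // /L -addrA lerDl addr_ge0.
  have -> : eps *: (c - a.2) - grad_x H a.1 a.2 - (eps *: (c - b.2) - grad_x H b.1 b.2)
    = - (eps *: (a - b).2) - (grad_x H a.1 a.2 - grad_x H b.1 b.2).
    by apply/rowP => i; rewrite !mxE; ring.
  apply: le_trans (ler_normB _ _) _; rewrite normrN normrZ.
  have h3 : `|eps| * `|(a - b).2| <= `|eps| * `|a - b| by rewrite ler_wpM2l // norm_snd.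
  by apply: le_trans (lerD h3 h2) _; rewrite -mulrDl ler_wpM2r // /L (addrC `|eps|) lerDl.
exists L, (`|ham_field (0, 0)| + L * (`|r| + 1) + 1); split => //.
  by rewrite ltr_wpDl // addr_ge0 // mulr_ge0 ?ltW // ltr_wpDl.
move=> a ar; have r0 : 0 <= r by exact: le_trans (normr_ge0 _) ar.
have per : ham_field a = ham_field (fracv a.1, a.2).
  by rewrite /ham_field /= fracvE grad_p_periodic // grad_x_periodic.
rewrite per -(subrK (ham_field (0, 0)) (ham_field _)).
apply: le_trans (ler_normD _ _) _; rewrite addrC -addrA lerD2l.
apply: le_trans (lip _ _ _ _) _ => //=; first by rewrite normr0.
rewrite (le_trans (_ : _ <= L * (`|r| + 1))) ?lerDl // ler_pM2l //.
apply: norm_pair_le => /=; rewrite subr0.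
  by rewrite (le_trans (fracv_norm _)) // lerDr.
by rewrite (le_trans ar) // (le_trans (ler_norm _)) // lerDl.
Qed.

Lemma flow0 q : Phi 0 q = q.
Proof. by have [] := flow q. Qed.

Lemma flow_derivable q (s : R) : derivable (fun s => (Phi s q).1) s 1.
Proof. by have [_ /(_ s)[]] := flow q. Qed.

Lemma flow_velocity q s : (Phi s q).2 = derive1 (fun s => (Phi s q).1) s.
Proof. by have [_ /(_ s)[]] := flow q. Qed.

Lemma flow_is_derive q (s : R) i :
  is_derive s 1 (fun s => (Phi s q).1 0 i) ((Phi s q).2 0 i).
Proof.
have d := @flow_derivable q s; rewrite flow_velocity derive1E derive_mx // mxE.
by apply: DeriveDef => //; move/derivable_mxP : d; apply.
Qed.

Lemma flow_solution q : solution ham_field (fun s => legendre (Phi s q)).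
Proof.
move=> s i; rewrite /ham_field /legendre /= momentum_crit //; split.
  exact: flow_is_derive.
have [_ /(_ s)[_ vel /(_ i)[dv]]] := flow q.
have E : (fun r => grad_p (lagrangian H) (Phi r q).1
      (derive1 (fun s => (Phi s q).1) r) 0 i) =
    (fun r => momentum H (Phi r q).1 (Phi r q).2 0 i).
  by apply/funext => r; rewrite -flow_velocity lagrangian_grad_pE.
rewrite E in dv *; rewrite -flow_velocity lagrangian_grad_pE // lagrangian_grad_xE //.
rewrite derive1E => Ed; apply: DeriveDef => //; rewrite Ed !mxE; ring.
Qed.

Lemma flow_unique z q : solution ham_field z -> z 0 = legendre q ->
  forall s, z s = legendre (Phi s q).
Proof.
move=> sz E s; have -> : z = (fun s => legendre (Phi s q)); last by [].
apply: (solution_unique ham_field_locally_lipschitz sz (flow_solution q)).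
by rewrite flow0.
Qed.

(** [EL_flow] only prescribes solutions through each point; the group law comes from uniqueness for
    the Hamiltonian field. *)
Lemma flowD s t q : Phi (s + t) q = Phi s (Phi t q).
Proof.
have := flow_unique (solution_shift t (flow_solution q)) _ s.
rewrite /= add0r => /(_ (Phi t q) erefl) E.
by rewrite -(legendreK (Phi (s + t) q)) E legendreK.
Qed.

(** The translated orbit solves the same periodic field, so uniqueness applies again. *)
Lemma flow_translate s q (k : 'rV[int]_n) :
  Phi s (q.1 + zvec R k, q.2) = ((Phi s q).1 + zvec R k, (Phi s q).2).
Proof.
pose z s := ((legendre (Phi s q)).1 + zvec R k, (legendre (Phi s q)).2).
have sz : solution ham_field z.
  move=> t i; have [h1 h2] := flow_solution q t i; split; last first.
    by move: h2; rewrite /ham_field /= grad_x_periodic.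
  rewrite /z /ham_field /= grad_p_periodic //.
  have -> : (fun s => ((Phi s q).1 + zvec R k) 0 i) =
      (fun s => (legendre (Phi s q)).1 0 i) + cst (zvec R k 0 i).
    by apply/funext => u; rewrite mxE.
  by rewrite -[X in is_derive _ _ _ X]addr0; exact: is_deriveD h1 (is_derive_cst _ _ _).
have := flow_unique sz _ s; rewrite {1}/z flow0 => /(_ (q.1 + zvec R k, q.2)).
rewrite /legendre /= momentum_periodic // => /(_ erefl) E.
rewrite -[LHS]legendreK /legendre -E /z /legendre /legendre_inv /=.
by rewrite grad_p_periodic // momentum_crit.
Qed.

Lemma flow_continuous s : continuous (Phi s).
Proof.
have -> : Phi s = legendre_inv \o (fun q => legendre (Phi s q)).
  by apply/funext => q /=; rewrite legendreK.
move=> q; apply: continuous_comp; last exact: legendre_inv_continuous.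
apply/continuous_ed => e e0.
have [C [d [C0 d0 h]]] := solution_dependence s ham_field_locally_lipschitz (flow_solution q).
have m0 : 0 < Num.min d (e / C) by rewrite lt_min d0 divr_gt0.
have [d1 d10 h1] := (continuous_ed legendre q).1 (@legendre_continuous q) _ m0.
exists d1 => // b /h1; rewrite lt_min => /andP[b1 b2].
have := h _ (flow_solution b); rewrite !flow0 => /(_ (ltW b1)) hb.
by apply: le_lt_trans hb _; rewrite mulrC -ltr_pdivlMr.
Qed.

Lemma flow_time_continuous q : continuous (fun s => Phi s q).
Proof.
have -> : (fun s => Phi s q) = legendre_inv \o (fun s => legendre (Phi s q)).
  by apply/funext => s /=; rewrite legendreK.
move=> s; apply: continuous_comp; last exact: legendre_inv_continuous.
exact: (solution_continuous (flow_solution q)).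
Qed.

(** Continuity jointly in time and starting point at (0, p). One [d] for all q near p is what makes
    the later perturbation estimates uniform. *)
Lemma flow_small_time p e : 0 < e -> exists2 d : R, 0 < d &
  forall s q, `|s| <= d -> `|q - p| < d -> `|Phi s q - p| < e.
Proof.
move=> e0.
have [d1 d10 h1] := (continuous_ed legendre_inv (legendre p)).1
  (@legendre_inv_continuous _) _ e0.
pose m := Num.min (d1 / 2) 1.
have m0 : 0 < m by rewrite lt_min ltr01 andbT divr_gt0.
have [d2 d20 h2] := (continuous_ed legendre p).1 (@legendre_continuous _) _ m0.
pose r := `|(legendre p).2| + 1.
have [K [M [K0 M0 hL hB]]] := ham_field_locally_lipschitz (r + 1).
pose d := Num.min d2 (Num.min (d1 / 2 / M / 2) (1 / M / 2)).
have d0 : 0 < d by rewrite !lt_min d20 !divr_gt0.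
have dd2 : d <= d2 by rewrite /d ge_min lexx.
have dM1 : M * d < d1 / 2.
  have h : d <= d1 / 2 / M / 2 by rewrite /d !ge_min lexx !orbT.
  have : d1 / 2 / M / 2 < d1 / 2 / M by rewrite ltr_pdivrMr // ltr_pMr ?divr_gt0 //; lra.
  by move=> /(le_lt_trans h); rewrite ltr_pdivlMr // mulrC.
have dM2 : M * d < 1.
  have h : d <= 1 / M / 2 by rewrite /d !ge_min lexx !orbT.
  have : 1 / M / 2 < 1 / M by rewrite ltr_pdivrMr // ltr_pMr ?divr_gt0 //; lra.
  by move=> /(le_lt_trans h); rewrite ltr_pdivlMr // mulrC.
exists d => // s q sd qd.
have := h2 q (lt_le_trans qd dd2); rewrite lt_min => /andP[l1 l2].
have lr : `|(legendre q).2| <= r.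
  rewrite -(subrK (legendre p).2 (legendre q).2) (le_trans (ler_normD _ _)) //.
  rewrite addrC /r lerD2l; apply: ltW; apply: le_lt_trans l2.
  exact: (norm_snd (legendre q - legendre p)).
have key : `|legendre (Phi s q) - legendre q| <= M * `|s|.
  have := flow_solution q => sol.
  have [s0|s0] := lerP 0 s.
    have := @solution_stays _ _ ham_field _ r M 0 s sol M0 hB.
    rewrite /= flow0 subr0 => /(_ lr); rewrite (ger0_norm s0) in sd *.
    move=> /(_ (le_lt_trans _ dM2)) h; have [] := h _ s.
    - by rewrite ler_pM2l.
    - by rewrite s0 lexx.
    - by move=> _; rewrite subr0.
  have hB' a : `|a.2| <= r + 1 -> `|- ham_field a| <= M by rewrite normrN; exact: hB.
  have := @solution_stays _ _ _ _ r M 0 (- s) (solution_opp sol) M0 hB'.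
  rewrite /= oppr0 flow0 addr0 => /(_ lr); rewrite (ltr0_norm s0) in sd *.
  move=> /(_ (le_lt_trans _ dM2)) h; have [] := h _ (- s).
  - by rewrite ler_pM2l.
  - by rewrite lexx oppr_ge0 ltW.
  - by move=> _; rewrite opprK addr0.
have := h1 (legendre (Phi s q)); rewrite !legendreK; apply.
rewrite -(subrKA (legendre q)); apply: le_lt_trans (ler_normD _ _) _.
have : M * `|s| <= M * d by rewrite ler_pM2l.
lra.
Qed.

End Flow.

(** * Probabilities from finitely additive periodic set functions *)

Section PeriodicSets.
Context {R : realType} {n : nat}.
Local Notation vec := 'rV[R]_n.
Local Notation state := (phase R n).

Definition periodic_set (A : set state) := forall q (k : 'rV[int]_n),
  A q -> A (q.1 + zvec R k, q.2).

Lemma periodic_setE A : periodic_set A -> forall q (k : 'rV[int]_n),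
  A (q.1 + zvec R k, q.2) <-> A q.
Proof.
move=> pA [x xi] k; split; last exact: pA.
by move=> h; have := pA _ (- k) h; rewrite /= zvecN addrK.
Qed.

Lemma periodic_set_modT A : periodic_set A -> @modT R n @^-1` A = A.
Proof.
move=> pA; apply/seteqP; split => q; rewrite /preimage /= /modT fracvE.
  by move=> /(periodic_setE pA).
by move=> Aq; apply/(periodic_setE pA).
Qed.

Lemma modT_periodic A : periodic_set (@modT R n @^-1` A).
Proof. by move=> q k; rewrite /preimage /= /modT /= fracvD. Qed.

(** Points at distance at least eta from the complement, phrased without a distance function so that
    an empty complement needs no convention. The margin absorbs errors of size eta between a chain
    and the flow. *)
Definition inner (U : set state) (eta : R) : set state :=
  [set q | forall b, ~ U b -> eta <= `|q - b|].

Lemma inner_sub U eta : 0 < eta -> inner U eta `<=` U.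
Proof.
move=> e0 q h; apply: contrapT => /h; rewrite subrr normr0.
by rewrite leNgt e0.
Qed.

Lemma inner_closed U eta : closed (inner U eta).
Proof.
have -> : inner U eta = \bigcap_(b in [set b | ~ U b]) [set q | eta <= `|q - b|].
  by apply/seteqP; split => q h b; exact: h.
apply: closed_bigI => b _.
have -> : [set q : state | eta <= `|q - b|] = (fun q : state => `|q - b|) @^-1` [set y | eta <= y] by [].
apply: closed_comp => [x _|]; last exact: closed_ge.
apply: (@continuous_comp _ _ _ (fun x : state => x - b)); last exact: norm_continuous.
by apply: cvgB; [exact: cvg_id|exact: cvg_cst].
Qed.

Lemma inner_periodic U eta : periodic_set U -> periodic_set (inner U eta).
Proof.
move=> pU q k h b Ub.
have -> : ((q.1 + zvec R k, q.2) : state) - b = q - (b.1 + zvec R (- k), b.2).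
  case: q b {h Ub} => [x xi] [y yi]; rewrite zvecN; congr pair => /=.
  by rewrite opprB addrA addrAC.
by apply: h => /(periodic_setE pU).
Qed.

Lemma inner_shrink U eta q a : inner U (2 * eta) a -> `|q - a| <= eta -> inner U eta q.
Proof.
move=> h qa b /h; rewrite -(subrKA q) => /le_trans /(_ (ler_normD _ _)).
by rewrite (distrC a) => hb; move: hb qa; rewrite mulrDl mul1r; lra.
Qed.

(** A Lebesgue number: in the near-covering form of compactness a single index j bounds both the
    number of sets and, through 1 / (j + 1), the margin. *)
Lemma compact_sub_inner (K : set state) (U : nat -> set state) :
  compact K -> (forall i, open (U i)) -> K `<=` \bigcup_i U i ->
  exists m (eta : R), 0 < eta /\ forall q, K q -> exists2 i, (i < m)%N & inner (U i) eta q.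
Proof.
move=> cK oU KU.
have := (compact_near_coveringP K).1 cK nat \oo
  (fun j q => exists2 i, (i < j)%N & inner (U i) (j.+1%:R^-1) q) _.
case.
  move=> x /KU[i _ Uix]; have := oU i; rewrite openE => /(_ x Uix)/nbhs_ballP[e /= e0 he].
  have e20 : 0 < e / 2 by rewrite divr_gt0.
  exists (ball x (e / 2), [set j | (i < j)%N /\ (j.+1%:R^-1 < e / 2)%R]).
    split; first exact: nbhsx_ballx.
    apply: filterI; first exact: nbhs_infty_gt.
    exact: near_infty_natSinv_lt (PosNum e20).
  move=> [q j] [/= qx [ij je]]; exists i => // b Ub.
  rewrite leNgt; apply/negP => qb; apply: Ub; apply: he.
  move: qx; rewrite !ball_prod_normE /ball_ /= => qx.
  rewrite -(subrKA q); apply: le_lt_trans (ler_normD _ _) _.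
  by rewrite [ltRHS]splitr ltrD //; exact: lt_trans qb je.
move=> N _ hN; exists N, (N.+1%:R^-1); split; first by rewrite invr_gt0 ltr0n.
by move=> q Kq; exact: (hN N (leqnn N) q Kq).
Qed.

Lemma compact_sub_inner1 (K U : set state) : compact K -> open U -> K `<=` U ->
  exists2 eta : R, 0 < eta & K `<=` inner U eta.
Proof.
move=> cK oU KU; have [||m [eta [e0 h]]] := @compact_sub_inner K (fun=> U) cK.
- by [].
- by move=> q /KU; exists 0%N.
by exists eta => // q /h[].
Qed.

End PeriodicSets.

(** * Measurability of the reduction modulo Z^n *)

Section ModT.
Context {R : realType} {n : nat}.
Local Notation state := (phase R n).

Lemma coord_fst_le (a b : state) i : `|a.1 0 i - b.1 0 i| <= `|a - b|.
Proof.
apply: le_trans (norm_fst (a - b)); have := norm_coord (a - b).1 i.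
by rewrite !mxE.
Qed.

(** The only jump possible near y0 is to below the integer floor(y0), where the fractional part is
    close to 1; the bound [a] excludes it. *)
Lemma floor_locally_constant (y0 a : R) : a < 1 -> exists2 d : R, 0 < d &
  forall y, `|y - y0| < d -> y - (Num.floor y)%:~R <= a -> Num.floor y = Num.floor y0.
Proof.
move=> a1; set f := Num.floor y0.
have /andP[f1] := floor_itv y0; rewrite rmorphD /= -/f => f2.
exists (Num.min (1 - a) (f%:~R + 1 - y0)).
  by rewrite lt_min !subr_gt0 a1.
move=> y; rewrite lt_min => /andP[]; rewrite !ltr_norml => /andP[h1 h2] /andP[h3 h4] ya.
have [fy|yf] := lerP f%:~R y.
  by apply: floor_def; rewrite rmorphD /= fy /=; lra.
have E1 : (f - 1)%:~R = f%:~R - 1 :> R by rewrite rmorphB rmorph1.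
have E : Num.floor y = f - 1.
  by apply: floor_def; rewrite subrK yf andbT E1; lra.
by exfalso; move: ya; rewrite E E1; lra.
Qed.

(** Closed pieces of A inside the unit cell that keep away from the faces x_i = 1, where the
    reduction jumps. *)
Definition fund_slice (A : set state) (j : nat) : set state :=
  [set q : state | (forall i, 0 <= q.1 0 i <= 1 - j.+1%:R^-1) /\ inner A (j.+1%:R^-1) q].

(** Near any q0, the points reduced into the slice all have the floor of q0, so the reduction acts
    on them as one fixed translation and the closed conditions pass to the limit. *)
Lemma modT_fund_slice_closed (A : set state) j : closed (@modT R n @^-1` fund_slice A j).
Proof.
set a : R := 1 - j.+1%:R^-1; have a1 : a < 1 by rewrite ltrBlDr ltrDl invr_gt0 ltr0n.
move=> q0 cl.
have near_floor : exists2 d : R, 0 < d & forall q : state, `|q - q0| < d ->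
    fund_slice A j (modT q) -> modT q - modT q0 = q - q0.
  have /choice[d Hd] : forall i : 'I_n, exists d : R, 0 < d /\
     forall y, `|y - q0.1 0 i| < d -> y - (Num.floor y)%:~R <= a ->
       Num.floor y = Num.floor (q0.1 0 i).
    by move=> i; have [d d0 h] := floor_locally_constant (q0.1 0 i) a1; exists d.
  exists (\big[Num.min/1]_i d i).
    by apply: lt_bigmin => // i _; case: (Hd i).
  move=> q qd [qa _]; congr pair => //=; apply/rowP => i; rewrite !mxE.
  have /andP[_ qai] := qa i; rewrite /= mxE in qai.
  have -> : Num.floor (q.1 0 i) = Num.floor (q0.1 0 i).
    case: (Hd i) => _; apply => //.
    apply: lt_le_trans (_ : \big[Num.min/1]_i d i <= _); last exact: bigmin_le_cond.
    by apply: le_lt_trans qd; exact: coord_fst_le.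
  by ring.
have [d d0 hd] := near_floor.
have approx (e : R) : 0 < e -> exists2 q : state, fund_slice A j (modT q) & `|modT q - modT q0| < e.
  move=> e0; have m0 : 0 < Num.min d e by rewrite lt_min d0.
  have [q [Aq]] := cl _ (nbhsx_ballx q0 _ m0).
  rewrite ball_prod_normE /ball_ /= distrC lt_min => /andP[q1 q2].
  by exists q => //; rewrite hd.
split.
  move=> i; set y := (modT q0).1 0 i.
  have ye q : `|y - (modT q).1 0 i| <= `|modT q - modT q0|.
    by rewrite distrC; exact: coord_fst_le.
  have key (e : R) : 0 < e -> 0 <= y + e /\ y <= a + e.
    move=> e0; have [q [qa _] qe] := approx e e0.
    have /andP[] := qa i; rewrite -/a; set y' := (modT q).1 0 i => y1 y2.
    by have := le_lt_trans (ye q) qe; rewrite -/y' ltr_norml => /andP[z1 z2]; split; lra.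
  by apply/andP; split; apply/ler_addgt0Pr => e /key[].
move=> b Ab; apply/ler_addgt0Pr => e /approx[q [_ hq] qe].
have := hq b Ab; rewrite -(subrKA (modT q0)) => /le_trans/(_ (ler_normD _ _)) /le_trans; apply.
by rewrite addrC lerD2l ltW.
Qed.

(** A point of A in the cell keeps a positive distance both from the complement of A and from the
    faces x_i = 1, so some slice contains it. Preimages of open sets are thus countable unions of
    closed sets. *)
Lemma modT_preimage_open (A : set state) : open A ->
  @modT R n @^-1` A = \bigcup_j (@modT R n @^-1` fund_slice A j).
Proof.
move=> oA; apply/seteqP; split => q /=; last first.
  by move=> [j _ [_ h]]; apply: (inner_sub _ h); rewrite invr_gt0 ltr0n.
move=> Aq; set x := modT q in Aq *.
have : open A by []; rewrite openE => /(_ x Aq)/nbhs_ballP[e /= e0 he].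
pose d := Num.min e (\big[Num.min/1]_i (1 - x.1 0 i)).
have d0 : 0 < d.
  rewrite lt_min e0 /=; apply: lt_bigmin => // i _; rewrite subr_gt0.
  by have /andP[] := fracv_itv q.1 i.
have [j] : exists j : nat, j.+1%:R^-1 < d.
  have [N _ /(_ N (leqnn N))] := near_infty_natSinv_lt (PosNum d0).
  by exists N.
rewrite lt_min => /andP[je jx]; exists j => //; split => [i|].
  have /andP[-> _] /= := fracv_itv q.1 i.
  rewrite lerBrDr -lerBrDl; apply: le_trans (ltW jx) _.
  exact: (bigmin_le_cond _ (fun i => 1 - x.1 0 i)).
move=> b Ab; rewrite leNgt; apply/negP => xb; apply: Ab; apply: he.
by rewrite ball_prod_normE /ball_ /=; exact: lt_trans xb je.
Qed.

Lemma closed_measurable (F : set (phaseM R n)) : closed (F : set state) -> measurable F.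
Proof.
move=> cF; rewrite -(setCK F); apply: measurableC; apply: sub_sigma_algebra.
exact: closed_openC.
Qed.

Lemma open_measurable_phase (F : set (phaseM R n)) : open (F : set state) -> measurable F.
Proof. exact: sub_sigma_algebra. Qed.

Lemma measurable_modT : measurable_fun [set: phaseM R n] (@modT R n : phaseM R n -> phaseM R n).
Proof.
apply: (@measurability _ _ (phaseM R n) (phaseM R n) setT (@modT R n) (@open state)) => // _ [A oA <-].
rewrite setTI modT_preimage_open //; apply: bigcup_measurable => j _.
by apply: closed_measurable; exact: modT_fund_slice_closed.
Qed.

Lemma continuous_measurable_phase (f : state -> state) : continuous f ->
  measurable_fun [set: phaseM R n] (f : phaseM R n -> phaseM R n).
Proof.
move=> cf.
apply: (@measurability _ _ (phaseM R n) (phaseM R n) setT f (@open state)) => // _ [A oA <-].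
rewrite setTI.
by apply: open_measurable_phase; apply: open_comp => // x _; exact: cf.
Qed.

End ModT.

Section FinitelyAdditive.
Context {R : realType} {n : nat}.
Local Notation vec := 'rV[R]_n.
Local Notation state := (phase R n).
Variables (P : set state -> R) (r : R).
Hypothesis P_ge0 : forall A, 0 <= P A.
Hypothesis P_add : forall A B, A `&` B = set0 -> P (A `|` B) = P A + P B.
Hypothesis P_T : P setT = 1.
Hypothesis P_far : P [set q | r < `|q.2|] = 0.

Lemma P_mono A B : A `<=` B -> P A <= P B.
Proof.
move=> AB; rewrite -(setDUK AB) P_add ?lerDl //.
by rewrite setDE setICA setICr setI0.
Qed.

Lemma P0 : P set0 = 0.
Proof.
have := @P_add set0 set0; rewrite setIid setUid => /(_ erefl) h.
by apply: (addrI (P set0)); rewrite addr0 -h.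
Qed.

Lemma P_le1 A : P A <= 1. Proof. by rewrite -P_T P_mono. Qed.

Lemma P_subU A B : P (A `|` B) <= P A + P B.
Proof.
have -> : A `|` B = A `|` (B `\` A) by rewrite setDE setUIr setUCr setIT.
rewrite P_add; last by rewrite setDE setICA setICr setI0.
by rewrite lerD2l P_mono // => x [].
Qed.

(** States beyond [r] carry no mass, so inclusions need only be checked where compactness is
    available. *)
Lemma P_far_mono A B : (forall q, `|q.2| <= r -> A q -> B q) -> P A <= P B.
Proof.
move=> h; apply: le_trans (_ : P (B `|` [set q | r < `|q.2|]) <= _).
  apply: P_mono => q Aq; have [qr|qr] := lerP `|q.2| r; [left; exact: h|by right].
by apply: le_trans (P_subU _ _) _; rewrite P_far addr0.
Qed.

(* P is finitely additive only: countable additivity is gained by regularizing it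
   from inside by closed sets and then from outside by open ones. *)
Definition rho (U : set state) : R :=
  sup [set P F | F in [set F | [/\ closed F, periodic_set F & F `<=` U]]].

Let rho_has_sup U :
  has_sup [set P F | F in [set F | [/\ closed F, periodic_set F & F `<=` U]]].
Proof.
split; first by exists (P set0), set0 => //; split => //; exact: closed0.
by exists 1 => _ [F _ <-]; exact: P_le1.
Qed.

Lemma P_le_rho U F : closed F -> periodic_set F -> F `<=` U -> P F <= rho U.
Proof. by move=> cF pF FU; apply: sup_upper_bound => //; exists F. Qed.

Lemma rho_le U M : (forall F, closed F -> periodic_set F -> F `<=` U -> P F <= M) ->
  rho U <= M.
Proof.
move=> h; apply: ge_sup; first by case: (rho_has_sup U).
by move=> _ [F [cF pF FU] <-]; exact: h.
Qed.

Lemma rho_ge0 U : 0 <= rho U.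
Proof. by rewrite -P0; apply: P_le_rho => //; exact: closed0. Qed.

Lemma rho_le_P U : rho U <= P U.
Proof. by apply: rho_le => F _ _; exact: P_mono. Qed.

Lemma periodic_slab (F : set state) q : periodic_set F -> F q -> `|q.2| <= r ->
  exists2 k : 'rV[int]_n, slab r (q.1 + zvec R k, q.2) & F (q.1 + zvec R k, q.2).
Proof.
move=> pF Fq qr; exists (floorv q.1); last exact: pF.
by rewrite -fracvE; split => //; exact: fracv_norm.
Qed.

(** Up to translations and massless states a closed F is compact, so finitely many U_i, each shrunk
    by a common margin to a closed set, cover it; finite subadditivity then suffices. *)
Lemma rho_bigcup_le (U : nat -> set state) M :
  (forall i, open (U i)) -> (forall i, periodic_set (U i)) ->
  (forall m, \sum_(i < m) rho (U i) <= M) -> rho (\bigcup_i U i) <= M.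
Proof.
move=> oU pU hM; apply: rho_le => F cF pF FU.
have cK : compact (F `&` slab r).
  by rewrite setIC; apply: compact_closedI => //; exact: slab_compact.
have [|m [eta [e0 h]]] := @compact_sub_inner _ _ (F `&` slab r) U cK oU.
  by move=> q [/FU].
apply: le_trans (hM m).
have : P F <= P (\big[setU/set0]_(i < m) inner (U i) eta).
  apply: P_far_mono => q qr Fq; have [k sk Fk] := periodic_slab pF Fq qr.
  have [i im hi] := h _ (conj Fk sk); 
  have : (\bigcup_(i < m) inner (U i) eta) q.
    by exists i => //; exact: (periodic_setE (@inner_periodic _ _ (U i) eta (pU i)) q k).1 hi.
  by rewrite bigcup_mkord.
move=> /le_trans; apply; elim: {hM h} m => [|m IH]; first by rewrite !big_ord0 P0.
rewrite !big_ord_recr /=; apply: le_trans (P_subU _ _) _; apply: lerD => //.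
apply: P_le_rho; [exact: inner_closed|exact: inner_periodic|exact: inner_sub].
Qed.

Definition mu_set (A : set state) : set R :=
  [set rho U | U in [set U | [/\ open U, periodic_set U & A `<=` U]]].
Definition mu_real (A : set state) : R := inf (mu_set A).
Definition mu_star (A : set state) : \bar R := (mu_real A)%:E.

Let mu_has_inf A : has_inf (mu_set A).
Proof.
split; first by exists (rho setT), setT => //; split => //; exact: openT.
by exists 0 => _ [U _ <-]; exact: rho_ge0.
Qed.

Lemma mu_real_le A U : open U -> periodic_set U -> A `<=` U -> mu_real A <= rho U.
Proof.
by move=> oU pU AU; apply: ge_inf; [case: (mu_has_inf A)|exists U].
Qed.

Lemma le_mu_real A M :
  (forall U, open U -> periodic_set U -> A `<=` U -> M <= rho U) -> M <= mu_real A.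
Proof.
move=> h; apply: lb_le_inf; first by case: (mu_has_inf A).
by move=> _ [U [oU pU AU] <-]; exact: h.
Qed.

Lemma mu_real_ge0 A : 0 <= mu_real A.
Proof. by apply: le_mu_real => *; exact: rho_ge0. Qed.

Lemma mu_real_mono A B : A `<=` B -> mu_real A <= mu_real B.
Proof.
by move=> AB; apply: le_mu_real => U oU pU BU; apply: mu_real_le => //;
  exact: subset_trans BU.
Qed.

Lemma mu_star0 : mu_star set0 = 0%E.
Proof.
congr EFin; apply/eqP; rewrite eq_le mu_real_ge0 andbT.
apply: le_trans (_ : rho set0 <= _); first by apply: mu_real_le => //; exact: open0.
by apply: le_trans (rho_le_P _) _; rewrite P0.
Qed.

Lemma mu_star_ge0 A : (0 <= mu_star A)%E.
Proof. by rewrite lee_fin mu_real_ge0. Qed.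

Lemma mu_star_mono : {homo mu_star : A B / A `<=` B >-> (A <= B)%E}.
Proof. by move=> A B AB; rewrite lee_fin mu_real_mono. Qed.

Lemma mu_star_sigma_subadditive : sigma_subadditive mu_star.
Proof.
move=> F; apply/lee_addgt0Pr => e e0.
apply: le_trans (epsilon_trick xpredT (fun i => mu_star_ge0 (F i)) (ltW e0)).
have /choice[U HU] : forall i, exists U, [/\ open U, periodic_set U, F i `<=` U &
    rho U <= mu_real (F i) + e / (2 ^ i.+1)%:R].
  move=> i; have ei : 0 < e / (2 ^ i.+1)%:R :> R by rewrite divr_gt0 // ltr0n expn_gt0.
  have [_ [U [oU pU FU] <-] h] := inf_adherent ei (mu_has_inf (F i)).
  by exists U; split => //; exact: ltW.
set S := (X in (_ <= X)%E).
have S_ge m : ((\sum_(i < m) rho (U i))%:E <= S)%E.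
  apply: (@le_trans _ _ (\sum_(0 <= i < m) (mu_star (F i) + (e / (2 ^ i.+1)%:R)%:E))%E).
    rewrite big_mkord -sumEFin; apply: lee_sum => i _.
    by rewrite /mu_star -EFinD lee_fin; case: (HU i).
  apply: nneseries_lim_ge => i _; rewrite adde_ge0 ?mu_star_ge0 // lee_fin.
  by rewrite divr_ge0 // ltW.
have S0 : (0 <= S)%E by have := S_ge 0%N; rewrite big_ord0.
case: S S_ge S0 => [s| |] // S_ge s0; last by rewrite leey.
rewrite lee_fin; apply: le_trans (_ : rho (\bigcup_i U i) <= _).
  apply: mu_real_le.
  - by apply: bigcup_open => i _; case: (HU i).
  - by move=> q k [i _ Ui]; exists i => //; case: (HU i) => _ pU _ _; exact: pU.
  - by move=> q [i _ Fi]; exists i => //; case: (HU i) => _ _ FU _; exact: FU.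
apply: rho_bigcup_le => [i|i|m]; [by case: (HU i)|by case: (HU i)|].
by have := S_ge m; rewrite lee_fin.
Qed.

HB.instance Definition _ := isOuterMeasure.Build R state mu_star
  mu_star0 mu_star_ge0 mu_star_mono mu_star_sigma_subadditive.

(** F is chosen first, in the part of U inside V, then G in U minus F. Being disjoint closed subsets
    of U they give P F + P G <= rho U. The order matters because U minus V need not be open. *)
Lemma open_caratheodory V : open V -> periodic_set V -> mu_star.-caratheodory V.
Proof.
move=> oV pV; apply: le_caratheodory_measurable => X.
rewrite -EFinD lee_fin; apply: le_mu_real => U oU pU XU.
rewrite -lerBrDr; apply: le_trans (_ : rho (U `&` V) <= _).
  apply: mu_real_le; [exact: openI|by move=> q k [h1 h2]; split; [exact: pU|exact: pV]|].
  by move=> q [/XU].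
apply: rho_le => F cF pF FUV; rewrite lerBrDr addrC -lerBrDr.
apply: le_trans (_ : rho (U `&` ~` F) <= _).
  apply: mu_real_le.
  - by apply: openI => //; exact: closed_openC.
  - move=> q k [h1 h2]; split; first exact: pU.
    by move=> /(periodic_setE pF).
  - by move=> q [/XU Uq nV]; split => // /FUV[].
apply: rho_le => G cG pG GU; rewrite lerBrDr addrC -P_add.
  apply: P_le_rho; first exact: closedU.
  - by move=> q k [h|h]; [left; exact: pF|right; exact: pG].
  - by move=> q [/FUV[]|/GU[]].
by apply/seteqP; split => // q [Fq /GU[]].
Qed.

Lemma closed_caratheodory F : closed F -> periodic_set F -> mu_star.-caratheodory F.
Proof.
move=> cF pF; rewrite -(setCK F); apply: caratheodory_measurable_setC.
apply: open_caratheodory; first exact: closed_openC.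
by move=> q k h /(periodic_setE pF).
Qed.

Let mu_outer : {outer_measure set state -> \bar R} := mu_star.

Lemma modT_preimage_caratheodory (A : set (phaseM R n)) : measurable A ->
  mu_outer.-caratheodory (@modT R n @^-1` A).
Proof.
pose M := [set A : set state | mu_outer.-caratheodory (@modT R n @^-1` A)].
suff : <<s (@open state) >> `<=` M by exact.
apply: smallest_sub.
  split; rewrite /M /=.
  - by rewrite preimage_set0; exact: caratheodory_measurable_set0.
  - move=> B MB; rewrite setTD preimage_setC; exact: caratheodory_measurable_setC.
  - by move=> F MF; rewrite preimage_bigcup; exact: caratheodory_measurable_bigcup.
move=> B oB; rewrite /M /= modT_preimage_open //.
apply: caratheodory_measurable_bigcup => j.
apply: closed_caratheodory => //; first exact: modT_fund_slice_closed.
exact: modT_periodic.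
Qed.

(** The outer measure does not distinguish a set from its periodic hull. Pulling back by the
    reduction makes every Borel set periodic and puts all the mass on the unit cell. *)
Definition limit_measure (A : set (phaseM R n)) : \bar R := mu_outer (@modT R n @^-1` A).

Let nu0 : limit_measure set0 = 0%E.
Proof. by rewrite /limit_measure preimage_set0 outer_measure0. Qed.

Let nu_ge0 A : (0 <= limit_measure A)%E.
Proof. exact: outer_measure_ge0. Qed.

Let nu_sigma : semi_sigma_additive limit_measure.
Proof.
move=> F mF tF mUF; rewrite /limit_measure preimage_bigcup.
apply: (@caratheodory_measure_sigma_additive R state mu_outer
  (fun i => @modT R n @^-1` F i)).
- by move=> i; exact: modT_preimage_caratheodory.
- apply/trivIsetP => i j _ _ ij; rewrite -preimage_setI.
  by move/trivIsetP : tF => /(_ i j I I ij) ->; rewrite preimage_set0.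
- by rewrite -preimage_bigcup; exact: modT_preimage_caratheodory.
Qed.

HB.instance Definition _ := isMeasure.Build _ (phaseM R n) R limit_measure
  nu0 nu_ge0 nu_sigma.

Lemma mu_starT : mu_outer setT = 1%E.
Proof.
congr EFin; apply/eqP; rewrite eq_le; apply/andP; split.
  apply: le_trans (_ : rho setT <= _).
    by apply: mu_real_le => //; exact: openT.
  by rewrite -P_T; apply: rho_le_P.
apply: le_mu_real => // U oU pU TU; rewrite -P_T; apply: P_le_rho => //.
Qed.

Let nuT : limit_measure setT = 1%E.
Proof. by rewrite /limit_measure preimage_setT mu_starT. Qed.

HB.instance Definition _ := Measure_isProbability.Build _ (phaseM R n) R limit_measure nuT.

Definition limit_probability : probability (phaseM R n) R := limit_measure.

Lemma limit_probability_fund : limit_probability (@fund_dom R n) = 1%E.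
Proof.
rewrite /limit_probability /= /limit_measure.
have -> : @modT R n @^-1` (@fund_dom R n) = setT; last exact: mu_starT.
by apply/seteqP; split => // q _ i; exact: fracv_itv.
Qed.

(** The open-set half of weak convergence; alone it controls integrals of nonnegative continuous
    functions from above. *)
Lemma limit_probability_le U : open U -> periodic_set U ->
  (limit_probability U <= (P U)%:E)%E.
Proof.
move=> oU pU; rewrite /limit_probability /= /limit_measure periodic_set_modT //.
rewrite lee_fin; apply: le_trans (_ : rho U <= _); last exact: rho_le_P.
exact: mu_real_le.
Qed.

(** An inequality on open periodic sets extends to Borel sets by outer regularity, and applying it
    to complements turns it into equality. The margins 2 eta and eta allow the dynamics to be
    followed only approximately. *)
Lemma limit_probability_invariant (Psi : state -> state) :
  continuous Psi ->
  (forall q (k : 'rV[int]_n), Psi (q.1 + zvec R k, q.2) = ((Psi q).1 + zvec R k, (Psi q).2)) ->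
  (forall U eta, open U -> periodic_set U -> 0 < eta ->
     P (Psi @^-1` inner U (2 * eta)) <= P (inner U eta)) ->
  forall A : set (phaseM R n), measurable A ->
   limit_probability ((fun q : phaseM R n => (modT (Psi q) : phaseM R n)) @^-1` A) =
   limit_probability A.
Proof.
move=> cPsi trPsi hPsi.
have perPsi B : periodic_set B -> periodic_set (Psi @^-1` B).
  by move=> pB q k; rewrite /preimage /= trPsi => /pB.
have openPsi B : open B -> open (Psi @^-1` B).
  by move=> oB; apply: open_comp => // x _; exact: cPsi.
have le_rho U : open U -> periodic_set U -> rho (Psi @^-1` U) <= rho U.
  move=> oU pU; apply: rho_le => // F cF pF FU.
  have cK : compact (Psi @` (F `&` slab r)).
    apply: continuous_compact; first exact: continuous_subspaceT.
    by rewrite setIC; apply: compact_closedI => //; exact: slab_compact.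
  have [|eta e0 h] := @compact_sub_inner1 _ _ (Psi @` (F `&` slab r)) U cK oU.
    by move=> _ [q [/FU Uq _] <-].
  have e20 : 0 < eta / 2 by rewrite divr_gt0.
  apply: le_trans (_ : P (Psi @^-1` inner U (2 * (eta / 2))) <= _).
    rewrite mulrC divfK //; apply: P_far_mono => q qr Fq.
    have [k sk Fk] := periodic_slab pF Fq qr.
    have : inner U eta (Psi (q.1 + zvec R k, q.2)) by apply: h; exists (q.1 + zvec R k, q.2).
    by rewrite trPsi => /(periodic_setE (@inner_periodic _ _ U eta pU)).
  apply: le_trans (hPsi U _ oU pU e20) _.
  by apply: P_le_rho => //; [exact: inner_closed|exact: inner_periodic|exact: inner_sub].
have le_nu (A : set (phaseM R n)) :
   (limit_probability ((fun q : phaseM R n => (modT (Psi q) : phaseM R n)) @^-1` A) <=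
   limit_probability A)%E.
  rewrite /limit_probability /= /limit_measure.
  have -> : @modT R n @^-1` ((fun q : phaseM R n => (modT (Psi q) : phaseM R n)) @^-1` A)
      = Psi @^-1` (@modT R n @^-1` A).
    have pA : periodic_set (Psi @^-1` (@modT R n @^-1` A)).
      exact: (perPsi _ (@modT_periodic R n A)).
    exact: (periodic_set_modT pA).
  rewrite lee_fin; apply: le_mu_real => // U oU pU AU.
  apply: le_trans (le_rho U oU pU); apply: mu_real_le => //.
  - exact: openPsi.
  - exact: perPsi.
  - by move=> q; exact: AU.
move=> A mA; apply/eqP; rewrite eq_le le_nu andTb.
have mB : measurable ((fun q : phaseM R n => (modT (Psi q) : phaseM R n)) @^-1` A).
  rewrite -[X in measurable X]setTI.
  apply: (measurableT_comp measurable_modT (continuous_measurable_phase cPsi)) => //.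
have := le_nu (~` A); rewrite preimage_setC !probability_setC //.
set a := limit_probability A; set b := limit_probability _.
have : (a \is a fin_num) by exact: fin_num_measure.
have : (b \is a fin_num) by exact: fin_num_measure.
case: b => // b _; case: a => // a _; rewrite -!EFinB !lee_fin; lra.
Qed.

End FinitelyAdditive.

(** * Occupation measures *)

Section Layers.
Context {R : realType}.

(** A discrete layer-cake formula: at most eta above y, at least y up to height M eta, and built
    from the sets {g > i eta}, which are open for continuous g. *)
Definition layers (eta : R) (M : nat) (y : R) : R :=
  \sum_(i < M) eta * ((i%:R * eta < y)%R)%:R.

Lemma layers_le eta M y : 0 < eta -> 0 <= y -> layers eta M y <= y + eta.
Proof.
move=> e0 y0; suff : layers eta M y <= M%:R * eta /\ layers eta M y <= y + eta by case.
rewrite /layers; elim: M => [|M [h1 h2]]; first by rewrite big_ord0 mul0r addr_ge0 // ltW.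
rewrite big_ord_recr /= -natr1 mulrDl mul1r; case: ltP => h; rewrite ?mulr1 ?mulr0; split; lra.
Qed.

Lemma layers_ge eta M y : 0 < eta -> y <= M%:R * eta -> y <= layers eta M y.
Proof.
move=> e0 yM; suff : Num.min y (M%:R * eta) <= layers eta M y by rewrite min_l.
rewrite /layers; elim: M {yM} => [|M h]; first by rewrite big_ord0 mul0r ge_min lexx orbT.
rewrite big_ord_recr /= -natr1 mulrDl mul1r; case: (ltP (M%:R * eta) y) h => h; rewrite ?mulr1 ?mulr0.
  move=> h2; rewrite ge_min; apply/orP; right; rewrite lerD2r; exact: h2.
by move=> h2; rewrite addr0 ge_min h2.
Qed.

End Layers.

Section OccupationLimit.
Context {R : realType} {n : nat}.
Local Notation vec := 'rV[R]_n.
Local Notation state := (phase R n).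

Lemma continuous_measurable_phaseR (f : state -> R) : continuous f ->
  measurable_fun [set: phaseM R n] (f : phaseM R n -> R).
Proof.
move=> cf; apply: (measurability _ (measurable_realfun.RGenOpens.measurableE R)).
move=> _ [_ [a [b ->]] <-]; rewrite setTI; apply: open_measurable_phase.
apply: open_comp => [y _|]; [exact: cf|exact: interval_open].
Qed.

Lemma integral_le_layers (nu : probability (phaseM R n) R) (g : state -> R) r eta M :
  continuous g -> (forall q, 0 <= g q) -> 0 < eta ->
  nu [set q : phaseM R n | r < `|q.2|] = 0%E ->
  (forall q, `|q.2| <= r -> g q <= M%:R * eta) ->
  (\int[nu]_q (g q)%:E <= \sum_(i < M) (eta%:E * nu [set q : phaseM R n | (i%:R * eta < g q)%R]))%E.
Proof.
move=> cg g0 e0 nufar gM.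
have mg := continuous_measurable_phaseR cg.
pose A (i : nat) : set (phaseM R n) := [set q | i%:R * eta < g q].
have mA i : measurable (A i).
  apply: open_measurable_phase.
  have -> : A i = g @^-1` `]i%:R * eta, +oo[%classic.
    by apply/seteqP; split => q; rewrite /A /= in_itv /= andbT.
  by apply: open_comp => [y _|]; [exact: cg|exact: rray_open].
have mi i : measurable_fun [set: phaseM R n] (fun q : phaseM R n => (\1_(A i) q : R)%:E).
  have h : measurable_fun [set: phaseM R n] (\1_(A i) : phaseM R n -> R).
    exact: measurable_indic.
  by move/measurable_EFinP : h.
pose lay (q : phaseM R n) : \bar R := (layers eta M (g q))%:E.
have mf : measurable_fun [set: phaseM R n] lay.
  have -> : lay =
    (fun q => \sum_(i < M) (eta%:E * (\1_(A i) q)%:E))%E.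
    apply/funext => q; rewrite /lay /layers -sumEFin; apply: eq_bigr => i _.
    by rewrite EFinM indicE /A; congr (_ * _%:R%:E)%E; rewrite mem_setE.
  apply: emeasurable_sum => i _; exact: measurable_funeM.
have lay0 q : 0 <= layers eta M (g q).
  by apply: sumr_ge0 => i _; rewrite mulr_ge0 // ltW.
apply: (@le_trans _ _ (\int[nu]_q (layers eta M (g q))%:E)%E).
  apply: ae_ge0_le_integral => //.
  - by move=> q _; rewrite lee_fin.
  - exact/measurable_EFinP.
  - by move=> q _; rewrite lee_fin.
  - exists [set q : phaseM R n | r < `|q.2|]; split => //.
      apply: open_measurable_phase.
      have -> : [set q : state | r < `|q.2|] = (fun q : state => `|q.2|) @^-1` `]r, +oo[%classic.
        by apply/seteqP; split => q; rewrite /= in_itv /= andbT.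
      apply: open_comp => [y _|]; last exact: rray_open.
      by apply: (@continuous_comp _ _ _ snd); [exact: cvg_snd|exact: norm_continuous].
    move=> q /= h; rewrite ltNge; apply/negP => qr; apply: h => _.
    by rewrite lee_fin; apply: layers_ge => //; exact: gM.
rewrite le_eqVlt; apply/orP; left; apply/eqP.
under eq_integral.
  move=> q _; rewrite /layers -sumEFin.
  over.
rewrite ge0_integral_sum //; first last.
- by move=> i q _; rewrite lee_fin mulr_ge0 // ltW.
- move=> i; have -> : (fun q : phaseM R n => (eta * ((i%:R * eta < g q)%R)%:R)%:E) =
    (fun q => (eta%:E * (\1_(A i) q)%:E))%E.
    by apply/funext => q; rewrite EFinM indicE /A; congr (_ * _%:R%:E)%E; rewrite mem_setE.
  exact: measurable_funeM.
apply: eq_bigr => i _.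
transitivity (\int[nu]_q (eta%:E * (\1_(A i) q)%:E))%E.
  by apply: eq_integral => q _; rewrite EFinM indicE /A; congr (_ * _%:R%:E)%E; rewrite mem_setE.
rewrite ge0_integralZl //.
- by rewrite integral_indic // setIT.
- by rewrite lee_fin ltW.
Qed.

Definition average (z : nat -> nat -> state) (N : nat -> nat) (g : state -> R) (j : nat) : R :=
  (\sum_(k < N j) g (z j k)) / (N j)%:R.

Definition frequency z N (A : set state) : nat -> R := average z N (fun q => (`[< A q >])%:R).

Lemma average_mono z N g1 g2 j : (forall k, (k < N j)%N -> g1 (z j k) <= g2 (z j k)) ->
  average z N g1 j <= average z N g2 j.
Proof.
by move=> h; apply: ler_wpM2r; [rewrite invr_ge0|apply: ler_sum => i _; exact: h].
Qed.

(** An ultrafilter makes all frequencies converge at once; extracting subsequences would serve only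
    countably many sets. *)
Lemma frequency_limit z N : (forall j, (0 < N j)%N) ->
  exists (G : set_system nat) (P : set state -> R),
    [/\ ProperFilter G, \oo `<=` G & forall A, frequency z N A @ G --> P A].
Proof.
move=> N0; have [G [UG sG]] := @ultraFilterLemma nat \oo _.
have PG : ProperFilter G by exact: ultra_proper.
suff h : forall A, exists l : R, frequency z N A @ G --> l.
  by have [P HP] := choice h; exists G, P.
move=> A.
have in01 j : 0 <= frequency z N A j <= 1.
  apply/andP; split; first by rewrite divr_ge0 // sumr_ge0.
  rewrite ler_pdivrMr ?ltr0n // mul1r.
  apply: le_trans (_ : \sum_(k < N j) 1 <= _); first by apply: ler_sum => k _; case: `[< _ >].
  by rewrite sumr_const card_ord.
have cl : compact `[0 : R, 1]%classic by exact: segment_compact.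
have FP : ProperFilter (frequency z N A @ G) by exact: fmap_proper_filter.
have [l [_ cl2]] : `[0 : R, 1]%classic `&` cluster (frequency z N A @ G) !=set0.
  have h : (frequency z N A @ G) `[0 : R, 1]%classic.
    by apply: (@filterE _ G) => j; rewrite /= in_itv /= in01.
  exact: cl _ FP h.
exists l => B nB.
have [//|GB] := in_ultra_setVsetC (frequency z N A @^-1` B) UG.
have [y [/= By nBy]] := cl2 (~` B) B GB nB; by [].
Qed.

Section WithLimit.
Variables (z : nat -> nat -> state) (N : nat -> nat) (G : set_system nat) (P : set state -> R).
Variable r : R.
Hypothesis N0 : forall j, (0 < N j)%N.
Hypothesis PG : ProperFilter G.
Hypothesis sG : \oo `<=` G.
Hypothesis cvP : forall A, frequency z N A @ G --> P A.
Hypothesis zr : forall j k, `|(z j k).2| <= r.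

Lemma freq_ge0 A : 0 <= P A.
Proof.
apply: (@ler_cvg_to _ G _ R (cst 0) (frequency z N A) 0); [exact: cvg_cst|exact: cvP|].
by apply: nearW => j /=; rewrite divr_ge0 // sumr_ge0.
Qed.

Lemma freq_add A B : A `&` B = set0 -> P (A `|` B) = P A + P B.
Proof.
move=> AB; have h := cvgD (@cvP A) (@cvP B).
apply: (cvg_unique _ (@cvP (A `|` B))) => //.
suff -> : frequency z N (A `|` B) = frequency z N A + frequency z N B by exact: h.
apply/funext => j; rewrite /frequency /average fctE -mulrDl -big_split /=; congr (_ / _).
apply: eq_bigr => k _; rewrite -natrD; congr (_%:R).
have := AB; rewrite -subset0 => /(_ (z j k)) {}AB.
case: (asboolP (A _)) => a; case: (asboolP (B _)) => b; case: (asboolP ((A `|` B) _)) => c //;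
  first [by exfalso; apply: AB | by case: c; left | by case: c; right | by case: c].
Qed.

Lemma freq_T : P setT = 1.
Proof.
apply: (cvg_unique _ (@cvP setT)) => //.
have -> : frequency z N setT = cst 1; last exact: cvg_cst.
apply/funext => j; rewrite /frequency /average.
under eq_bigr do rewrite asboolT //.
by rewrite sumr_const card_ord divff // pnatr_eq0 -lt0n.
Qed.

Lemma freq_far : P [set q | r < `|q.2|] = 0.
Proof.
apply: (cvg_unique _ (@cvP _)) => //.
have -> : frequency z N [set q | r < `|q.2|] = cst 0; last exact: cvg_cst.
apply/funext => j; rewrite /frequency /average big1 ?mul0r // => k _.
by rewrite asboolF //= => /(le_lt_trans (zr j k)); rewrite ltxx.
Qed.

Let nu := limit_probability freq_ge0 freq_add freq_T freq_far.

(** The staircase [layers] turns both sides into sums over the open periodic sets {g > i eta}, where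
    the limit measure is at most the limit frequency. *)
Lemma limit_integral_le (g : state -> R) a : continuous g -> (forall q, 0 <= g q) ->
  (forall q (k : 'rV[int]_n), g (q.1 + zvec R k, q.2) = g q) ->
  (forall e, 0 < e -> \forall j \near \oo, average z N g j <= a + e) ->
  (\int[nu]_q (g q)%:E <= a%:E)%E.
Proof.
move=> cg g0 pg ha; apply/lee_addgt0Pr => e e0.
(* Half of [e] pays for the staircase, half for the averages. *)
pose eta := e / 2; have eta0 : 0 < eta by rewrite divr_gt0.
have [M0 M00 HM0] := compact_bounded_fun (slab_compact (r := r)) cg.
pose M := (Num.truncn (M0 / eta)).+1.
have gM q : `|q.2| <= r -> g q <= M%:R * eta.
  move=> qr; rewrite -(pg q (floorv q.1)) -fracvE.
  apply: le_trans (ler_norm _) _; apply: le_trans (HM0 _ _) _.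
    by split => //; exact: fracv_norm.
  by rewrite -ler_pdivrMr // ltW // truncnS_gt.
pose A i := [set q : state | i%:R * eta < g q].
have oA i : open (A i).
  have -> : A i = g @^-1` `]i%:R * eta, +oo[%classic.
    by apply/seteqP; split => q; rewrite /A /= in_itv /= andbT.
  by apply: open_comp => [y _|]; [exact: cg|exact: rray_open].
have pA i : periodic_set (A i) by move=> q k; rewrite /A /= pg.
have ofar : open [set q : state | r < `|q.2|].
  have -> : [set q : state | r < `|q.2|] = (fun q : state => `|q.2|) @^-1` `]r, +oo[%classic.
    by apply/seteqP; split => q; rewrite /= in_itv /= andbT.
  apply: open_comp => [y _|]; last exact: rray_open.
  by apply: (@continuous_comp _ _ _ snd); [exact: cvg_snd|exact: norm_continuous].
have nufar : nu [set q : phaseM R n | r < `|q.2|] = 0%E.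
  apply/eqP; rewrite eq_le measure_ge0 andbT.
  by apply: le_trans (limit_probability_le _ _ _ _ ofar _) _ => //; rewrite freq_far.
apply: le_trans (integral_le_layers cg g0 eta0 nufar gM) _.
apply: (@le_trans _ _ (\sum_(i < M) (eta * P (A i))%:E)%E).
  apply: lee_sum => i _; rewrite [X in (_ <= X)%E]EFinM; apply: lee_pmul => //; first by rewrite lee_fin ltW.
  exact: (limit_probability_le _ _ _ _ (oA i) (@pA i)).
rewrite sumEFin -EFinD lee_fin.
have cv : (fun j => \sum_(i < M) eta * frequency z N (A i) j) @ G --> \sum_(i < M) eta * P (A i).
  elim: M {gM} => [|m IH].
    by under eq_fun do rewrite big_ord0; rewrite big_ord0; exact: cvg_cst.
  under eq_fun do rewrite big_ord_recr /=.
  rewrite big_ord_recr /=; apply: cvgD; first exact: IH.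
  by apply: cvgMr; exact: cvP.
apply: (@ler_cvg_to _ _ _ _ _ (cst (a + e)) _ _ cv); first exact: cvg_cst.
have := sG (ha eta eta0); apply: filterS => j hj /=.
have -> : \sum_(i < M) eta * frequency z N (A i) j = average z N (fun q => layers eta M (g q)) j.
  rewrite /frequency /average /layers exchange_big /= mulr_suml; apply: eq_bigr => i _.
  rewrite mulrA mulr_sumr; congr (_ / _); apply: eq_bigr => k _; congr (_ * _%:R).
  by congr nat_of_bool; apply/idP/idP => [/asboolP|h]; [|exact/asboolP].
apply: le_trans (_ : average z N (fun q => g q + eta) j <= _).
  by apply: average_mono => k _; exact: layers_le.
have -> : average z N (fun q => g q + eta) j = average z N g j + eta.
  rewrite /average big_split /= sumr_const card_ord mulrDl; congr (_ + _).
  by rewrite -[eta *+ _]mulr_natr mulfK // pnatr_eq0 -lt0n.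
by move: hj; rewrite /eta; lra.
Qed.

(** Shifting the index by m_j realizes Psi up to eta on the chain and raises a frequency by at most
    m_j / N_j, which tends to 0. *)
Lemma limit_invariant (Psi : state -> state) :
  continuous Psi ->
  (forall q (k : 'rV[int]_n), Psi (q.1 + zvec R k, q.2) = ((Psi q).1 + zvec R k, (Psi q).2)) ->
  (forall eta, 0 < eta -> exists m : nat -> nat,
     (fun j => (m j)%:R / (N j)%:R : R) @ \oo --> (0 : R) /\
     \forall j \near \oo, forall k, (k < N j)%N -> `|z j (k + m j)%N - Psi (z j k)| <= eta) ->
  forall A : set (phaseM R n), measurable A ->
   nu ((fun q : phaseM R n => (modT (Psi q) : phaseM R n)) @^-1` A) = nu A.
Proof.
move=> cPsi trPsi hPsi; apply: limit_probability_invariant => // U eta oU pU e0.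
have [m [cm hm]] := hPsi eta e0.
have cr : (fun j => frequency z N (inner U eta) j + (m j)%:R / (N j)%:R) @ G --> P (inner U eta) + 0.
  by apply: cvgD; [exact: cvP|exact: cvg_trans (cvg_app _ sG) cm].
rewrite addr0 in cr.
apply: (@ler_cvg_to _ _ _ _ _ _ _ _ (@cvP _) cr).
have := sG hm; apply: filterS => j hj.
rewrite /frequency /average -mulrDl; apply: ler_wpM2r; first by rewrite invr_ge0.
pose f k : R := (`[< inner U eta (z j k) >])%:R.
have f0 k : 0 <= f k by rewrite /f.
have f1 k : f k <= 1 by rewrite /f; case: `[< _ >].
apply: le_trans (_ : \sum_(k < N j) f (k + m j)%N <= _).
  apply: ler_sum => k _; rewrite /f; case: (asboolP ((Psi @^-1` _) _)) => // h.
  rewrite asboolT //; apply: (inner_shrink h); exact: hj.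
(* Both windows of length N_j lie in [0, N_j + m_j): the last m_j terms are at most 1 each, and the
   first m_j are dropped as nonnegative. *)
have : \sum_(0 <= k < N j + m j) f k <= \sum_(k < N j) f k + (m j)%:R.
  rewrite (@big_cat_nat _ _ _ (N j)) ?leq_addr //= big_mkord lerD2l.
  apply: le_trans (_ : \sum_(N j <= k < N j + m j) 1 <= _); first exact: ler_sum.
  by rewrite big_const_nat addKn iter_addr addr0.
apply: le_trans.
have E : \sum_(m j <= k < N j + m j) f k = \sum_(k < N j) f (k + m j)%N.
  by rewrite -{1}[m j]add0n big_addn addnK big_mkord.
by rewrite (@big_cat_nat _ _ _ (m j)) ?leq_addl //= E lerDr sumr_ge0.
Qed.

End WithLimit.

End OccupationLimit.

(** * Action of smooth curves *)

Section Primitive.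
Context {R : realType}.

Lemma is_derive_local_eq (f g : R -> R) (a l d : R) : 0 < d ->
  (forall t, `|t - a| < d -> f t = g t) -> is_derive a 1 g l -> is_derive a 1 f l.
Proof.
move=> d0 E hg; apply: is_derive_ed => e e0.
have [d1 d10 h] := is_derive_ed_inv hg e0.
exists (Num.min d d1) => [|t]; first by rewrite lt_min d0.
rewrite lt_min => /andP[td td1]; rewrite !E ?subrr ?normr0 // ?(addrC a) ?addrK //.
by rewrite addrC; exact: h.
Qed.

Lemma is_derive_reflect (f : R -> R) (t l : R) : is_derive (- t) 1 f l ->
  is_derive t 1 (fun s => f (- s)) (- l).
Proof.
move=> h; have h2 : is_derive t 1 (fun s : R => - s) (- 1).
  exact: (is_deriveN (is_derive_id t 1)).
by have := is_derive1_comp h h2; rewrite mulrN1.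
Qed.

Lemma eq0_derive_constant (f : R -> R) (a b : R) :
  (forall t : R, a < t < b -> is_derive t 1 f 0) ->
  forall s t, a < s < b -> a < t < b -> f s = f t.
Proof.
move=> h.
have key s t : a < s -> t < b -> s < t -> f s = f t.
  move=> as_ tb st; have cf : {within `[s, t], continuous f}.
    apply: derivable_within_continuous => x; rewrite in_itv /= => /andP[x1 x2].
    by have [] := h x; rewrite ?(lt_le_trans as_ x1) ?(le_lt_trans x2 tb).
  have [x|x _] := @MVT R f (cst 0) s t st _ cf.
    rewrite in_itv /= => /andP[x1 x2]; apply: h.
    by rewrite (lt_trans as_ x1) (lt_trans x2 tb).
  by rewrite mul0r => /eqP; rewrite subr_eq0 => /eqP.
move=> s t /andP[s1 s2] /andP[t1 t2].
by case: (ltgtP s t) => [/key|/key|->] // ->.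
Qed.

Lemma half_primitive (G : R -> R) (a : R) : continuous G ->
  exists A : R -> R, forall t : R, a < t -> is_derive t 1 A (G t).
Proof.
move=> cG; exists (fun x => \int[lebesgue_measure]_(t in `[a, x]) G t) => t at_.
have tu : t < t + 1 by rewrite ltrDl.
have int : lebesgue_measure.-integrable `[a, t + 1] (EFin \o G).
  apply: continuous_compact_integrable; first exact: segment_compact.
  exact: continuous_subspaceT.
have [d1 d2] := @continuous_FTC1_closed R G a t (t + 1) tu int at_ (@cG t).
exact: (DeriveDef d1 (etrans (esym (derive1E _ _)) d2)).
Qed.

(** An integral from a base point gives a primitive only to its right. A second one, obtained by
    reflection, covers the left, and on the overlap (-1, 1) the two differ by a constant. *)
Lemma primitive (G : R -> R) : continuous G ->
  exists A : R -> R, forall t : R, is_derive t 1 A (G t).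
Proof.
move=> cG; have [A1 h1] := @half_primitive G (- 1) cG.
have cG' : continuous (fun t => G (- t)).
  by apply: continuous_after => //; exact: opp_continuous.
have [A2 h2] := @half_primitive (fun t => G (- t)) (- 1) cG'.
pose B t := - A2 (- t).
have hB (t : R) : t < 1 -> is_derive t 1 B (G t).
  move=> t1; have := h2 (- t); rewrite ltrN2 opprK => /(_ t1)/is_derive_reflect h.
  by rewrite -(opprK (G t)); exact: is_deriveN h.
have E t : - 1 < t < 1 -> A1 t - B t = A1 0 - B 0.
  move=> t1; apply: (@eq0_derive_constant (fun t => A1 t - B t) (- 1) 1) => //; last first.
    by apply/andP; split; lra.
  move=> s /andP[s1 s2]; rewrite -(subrr (G s)).
  exact: is_deriveB (h1 _ s1) (hB _ s2).
pose C := A1 0 - B 0.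
exists (fun t => if t < 0 then B t + C else A1 t) => t.
have hBC (s : R) : s < 1 -> is_derive s 1 (fun t => B t + C) (G s).
  by move=> s1; rewrite -(addr0 (G s)); exact: is_deriveD (hB _ s1) (is_derive_cst _ _ _).
have [t0|t0] := lerP 0 t.
  apply: (@is_derive_local_eq _ A1 _ _ 1) => //; last by apply: h1; lra.
  move=> s; rewrite ltr_norml => /andP[s1 s2]; case: ltP => // s0.
  have := E s; rewrite /C => <-; [ring|]; apply/andP; split; lra.
apply: (@is_derive_local_eq _ (fun t => B t + C) _ _ (- t)); first by rewrite oppr_gt0.
  move=> s; rewrite ltr_norml => /andP[s1 s2]; case: ltP => // s0; lra.
by apply: hBC; lra.
Qed.

Lemma integral_primitive (G A : R -> R) a b : continuous G ->
  (forall t : R, is_derive t 1 A (G t)) -> a < b ->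
  (\int[lebesgue_measure]_(s in `[a, b]) (G s)%:E = (A b - A a)%:E)%E.
Proof.
move=> cG hA ab; have cA : continuous A by move=> t; exact: is_derive_continuous (hA t).
rewrite (@continuous_FTC2 R G A a b ab) ?EFinB //.
- exact: continuous_subspaceT.
- split.
  + by move=> t _; case: (hA t).
  + exact: cvg_at_right_filter (cA a).
  + exact: cvg_at_left_filter (cA b).
- by move=> t _; rewrite derive1E; case: (hA t).
Qed.

End Primitive.

Section SmoothCurves.
Context {R : realType} {n : nat}.
Local Notation vec := 'rV[R]_n.

Definition velocity (g w : R -> vec) :=
  forall (t : R) i, is_derive t 1 (fun s => g s 0 i) (w t 0 i).

Lemma velocity_derive1 g w t : velocity g w -> derive1 g t = w t.
Proof.
move=> gw; have dg : derivable g t 1.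
  by apply/derivable_mxP => i j; rewrite ord1; case: (gw t j).
rewrite derive1E derive_mx //; apply/rowP => i; rewrite mxE; by case: (gw t i).
Qed.

Lemma velocity_continuous g w : velocity g w -> continuous g.
Proof.
by move=> gw; apply: continuous_coord => i t; exact: is_derive_continuous (gw t i).
Qed.

Lemma velocity_increment g w M a b : velocity g w -> a <= b ->
  (forall t, a <= t <= b -> `|w t| <= M) -> `|g b - g a| <= M * (b - a).
Proof.
move=> gw; rewrite le_eqVlt => /predU1P[->|ab] hM; first by rewrite !subrr normr0 mulr0.
have M0 : 0 <= M.
  by apply: le_trans (normr_ge0 _) (hM a _); rewrite lexx ltW.
have ba : 0 <= b - a by rewrite subr_ge0 ltW.
apply: norm_le_coord => [|i]; first by rewrite mulr_ge0.
have [t /andP[t1 t2]] := mvt_open ab (fun t => gw t i).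
rewrite !mxE => ->; rewrite normrM (ger0_norm ba) ler_wpM2r //.
by apply: le_trans (norm_coord _ _) (hM t _); rewrite !ltW.
Qed.

Lemma velocity_abs_cont g w a b : velocity g w -> continuous w -> abs_cont a b g.
Proof.
move=> gw cw e e0.
have [M M0 hM] := compact_bounded_fun (@segment_compact R a b)
  (fun t => @continuous_comp _ _ _ w Num.norm t (@cw t) (@norm_continuous _ _ _)).
exists (e / M) => [|m s t st]; first exact: divr_gt0.
rewrite ltr_pdivlMr // => hs; apply: le_lt_trans hs; rewrite mulr_suml.
apply: ler_sum => k _; have [ask stk tkb _] := st k (ltn_ord k).
rewrite mulrC; apply: velocity_increment gw stk _ => u /andP[u1 u2].
have := hM u; rewrite /= in_itv /= (le_trans ask u1) (le_trans u2 tkb) normr_id.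
exact.
Qed.

Context (H : vec -> vec -> R) (c : vec) (eps h : R) (v : vec -> R).
Hypothesis tonH : tonelli_hamiltonian H.

Definition ell (x xi : vec) : R := lagrangian H x xi - dot c xi + h.

Lemma ell_continuous : continuous (fun q : vec * vec => ell q.1 q.2).
Proof.
have c1 : continuous (fun q : vec * vec => dot c q.2).
  apply: (continuous_after (f := fun q : vec * vec => (c, q.2)) (g := fun q => dot q.1 q.2)).
    by apply: continuous_pair => q; [exact: cst_continuous|exact: cvg_snd].
  exact: dot_continuous.
move=> q; apply: cvgD; last exact: cvg_cst.
exact: cvgB (@lagrangian_continuous _ _ _ tonH q) (c1 q).
Qed.

Lemma ell_periodic : periodic2 ell.
Proof. by move=> x xi k; rewrite /ell lagrangian_periodic. Qed.

Lemma ell_superlinear (K : R) : 0 <= K ->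
  exists2 C, 0 < C & forall x xi, K * `|xi| - C <= ell x xi.
Proof.
(* The extra slope n |c| pays for the term c.xi. *)
move=> K0; have K10 : 0 <= K + n%:R * `|c| by rewrite addr_ge0 // mulr_ge0.
have [C C0 hC] := lagrangian_superlinear tonH K10.
exists (C + `|h|) => [|x xi]; first by rewrite ltr_wpDr.
have := hC x xi; have := le_trans (ler_norm _) (norm_dot c xi).
have : - `|h| <= h by rewrite lerNl; have := ler_norm (- h); rewrite normrN.
rewrite /ell mulrDl mulrA; lra.
Qed.

Lemma ell_lipschitz (r : R) : exists2 K, 0 < K & forall x xi x' xi',
  `|xi| <= r -> `|xi'| <= r -> ell x' xi' - ell x xi <= K * (`|x' - x| + `|xi' - xi|).
Proof.
have [s s0 hs] := momentum_bounded tonH r.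
have [K K0 hK] := periodic_C1_lipschitz s (ham_C1 tonH) (ham_periodic tonH).
exists (K + n%:R * s + n%:R * `|c| + 1) => [|x xi x' xi' xr x'r].
  by rewrite ltr_wpDl // !addr_ge0 ?mulr_ge0 // ltW.
have up := lagrangian_upper tonH x xi x' xi'; set p := momentum H x' xi' in up.
have ps : `|p| <= s by exact: hs.
have h1 : - (H x' p - H x p) <= K * `|x' - x|.
  have := hK (x', p) (x, p) ps ps; rewrite /= opprB => hh.
  apply: le_trans (ler_norm _) _; apply: le_trans hh _; rewrite ler_pM2l //.
  by apply: norm_pair_le => /=; rewrite ?subrr ?normr0 // distrC.
have h2 : dot (xi' - xi) p <= n%:R * s * `|xi' - xi|.
  apply: le_trans (ler_norm _) _; apply: le_trans (norm_dot _ _) _.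
  by rewrite -mulrA ler_wpM2l // mulrC ler_wpM2r.
have h3 : - dot c (xi' - xi) <= n%:R * `|c| * `|xi' - xi|.
  apply: le_trans (ler_norm _) _; rewrite normrN; apply: le_trans (norm_dot _ _) _.
  by rewrite mulrA.
have -> : ell x' xi' - ell x xi = lagrangian H x' xi' - lagrangian H x xi - dot c (xi' - xi).
  by rewrite /ell dotBr; ring.
have n1 := normr_ge0 (x' - x); have n2 := normr_ge0 (xi' - xi).
have ns : 0 <= n%:R * s by rewrite mulr_ge0.
have nc : 0 <= n%:R * `|c| by rewrite mulr_ge0.
apply: le_trans (_ : K * `|x' - x| + n%:R * s * `|xi' - xi| + n%:R * `|c| * `|xi' - xi| <= _).
  by move: up h1 h2 h3; lra.
move: (`|x' - x|) (`|xi' - xi|) (n%:R * s) (n%:R * `|c|) n1 n2 ns nc => a b d f *; nra.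
Qed.

Lemma running_cost_continuous g w : continuous g -> continuous w ->
  continuous (fun s => expR (eps * s) * ell (g s) (w s)).
Proof.
move=> cg cw s; apply: cvgM.
  apply: (@continuous_comp _ _ _ (fun s => eps * s)); last exact: continuous_expR.
  by apply: cvgMr; exact: cvg_id.
apply: (continuous_after (f := fun s => (g s, w s)) (g := fun q => ell q.1 q.2)).
  exact: continuous_pair.
exact: ell_continuous.
Qed.

Lemma action_smooth g w A T : velocity g w -> continuous w -> 0 < T ->
  (forall t : R, is_derive t 1 A (expR (eps * t) * ell (g t) (w t))) ->
  action H c eps h v T g = (A 0 - A (- T) + expR (- (eps * T)) * v (g (- T)))%:E.
Proof.
move=> gw cw T0 hA; rewrite /action EFinD; congr (_ + _)%E.
have cG := running_cost_continuous (velocity_continuous gw) cw.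
rewrite -(integral_primitive cG hA); last by rewrite oppr_lt0.
by apply: eq_integral => s _; rewrite (velocity_derive1 _ gw).
Qed.

Hypothesis var : variational_repr H c eps h v.

Lemma value_le g w A T : velocity g w -> continuous w -> 0 < T ->
  (forall t : R, is_derive t 1 A (expR (eps * t) * ell (g t) (w t))) ->
  v (g 0) <= A 0 - A (- T) + expR (- (eps * T)) * v (g (- T)).
Proof.
move=> gw cw T0 hA; rewrite -lee_fin (@var (g 0) T T0); apply: ereal_inf_lbound.
exists g; last exact: action_smooth gw cw T0 hA.
by split => //; exact: velocity_abs_cont gw cw.
Qed.

(** The segment from y to x run at unit speed is a competitor. Its cost is at most C |x - y|, and
    the discount loss 1 - exp(- eps T) <= eps T contributes eps B. *)
Lemma value_lipschitz : 0 < eps -> continuous v -> Defs.periodic v ->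
  exists2 K, 0 < K & forall x y, v x - v y <= K * `|x - y|.
Proof.
move=> e0 cv pv; have [B B0 hB] := periodic_bounded cv pv.
have [C C0 hC] := periodic_slab_bounded 1 ell_continuous ell_periodic.
exists (C + eps * B) => [|x y]; first by rewrite addr_gt0 // mulr_gt0.
have [->|xy] := eqVneq x y; first by rewrite !subrr normr0 mulr0.
set T := `|x - y|; have T0 : 0 < T by rewrite normr_gt0 subr_eq0.
pose z := T^-1 *: (x - y).
have z1 : `|z| <= 1 by rewrite normrZ normfV normr_id mulVf // gt_eqF.
pose g (s : R) := x + s *: z.
have gw : velocity g (cst z).
  move=> t i.
  have -> : (fun s : R => g s 0 i) = (fun s => x 0 i + s * z 0 i).
    by apply/funext => s; rewrite !mxE.
  rewrite -[X in is_derive _ _ _ X]add0r -[X in 0 + X]mul1r; apply: is_deriveD.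
  exact: (@is_derive_mulr _ id t 1 (z 0 i) (is_derive_id t 1)).
have cw : continuous (cst z : R -> vec) by exact: cst_continuous.
have [A hA] := primitive (running_cost_continuous (velocity_continuous gw) cw).
have := value_le gw cw T0 hA.
have -> : g 0 = x by rewrite /g scale0r addr0.
have -> : g (- T) = y.
  by rewrite /g /z scaleNr scalerA divff ?gt_eqF // scale1r subKr.
have nT : - T < 0 by rewrite oppr_lt0.
have [t /andP[t1 t2]] := mvt_open nT hA.
rewrite sub0r opprK => ->.
have et0 := expR_gt0 (eps * t).
have et1 : expR (eps * t) <= 1.
  by rewrite -expR0 ler_expR; apply: ltW; rewrite pmulr_rlt0.
have hCt : ell (g t) (cst z t) <= C by apply: le_trans (ler_norm _) (hC _ _ _).
have cost : expR (eps * t) * ell (g t) (cst z t) <= C.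
  have [l0|l0] := lerP 0 (ell (g t) (cst z t)).
    by rewrite -[leRHS]mul1r ler_pM // ltW.
  by rewrite (le_trans _ (ltW C0)) // pmulr_rle0 // ltW.
have cT : expR (eps * t) * ell (g t) (cst z t) * T <= C * T by rewrite ler_pM2r.
set E := expR (- (eps * T)).
have E1 : 1 - eps * T <= E by exact: expR_ge1Dx.
have E2 : E <= 1 by rewrite -expR0 ler_expR oppr_le0 mulr_ge0 // ltW.
have vy : (1 - E) * (- v y) <= eps * T * B.
  apply: le_trans (_ : (1 - E) * B <= _).
    apply: ler_wpM2l; first by rewrite subr_ge0.
    by apply: le_trans (ler_norm _) _; rewrite normrN.
  by rewrite ler_pM2r //; lra.
move: cT vy; rewrite mulrDl -/T; lra.
Qed.

End SmoothCurves.

(** * Discrete value functions *)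

Section ContinuityRules.
Context {R : realType} {T : topologicalType} {V : normedModType R}.

Lemma continuous_add (f g : T -> V) : continuous f -> continuous g ->
  continuous (fun t => f t + g t).
Proof. by move=> cf cg t; exact: cvgD (cf t) (cg t). Qed.

Lemma continuous_sub (f g : T -> V) : continuous f -> continuous g ->
  continuous (fun t => f t - g t).
Proof. by move=> cf cg t; exact: cvgB (cf t) (cg t). Qed.

Lemma continuous_scale (a : R) (f : T -> V) : continuous f ->
  continuous (fun t => a *: f t).
Proof. by move=> cf t; exact: cvgZ (cvg_cst a) (cf t). Qed.

Lemma continuous_mull (a : R) (f : T -> R) : continuous f ->
  continuous (fun t => a * f t).
Proof. by move=> cf t; exact: cvgMr (cf t). Qed.

Lemma continuous_mulr (a : R) (f : T -> R) : continuous f ->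
  continuous (fun t => f t * a).
Proof. by move=> cf t; exact: cvgMl (cf t). Qed.

Lemma continuous_const (a : V) : continuous ((fun=> a) : T -> V).
Proof. by move=> t; exact: cvg_cst. Qed.

End ContinuityRules.

Lemma continuous_identity {T : topologicalType} : continuous (fun t : T => t).
Proof. by move=> t; exact: cvg_id. Qed.

Lemma dot_sqB {R : realType} {n : nat} (a b : 'rV[R]_n) :
  dot (a - b) (a - b) = dot a a - 2 * dot a b + dot b b.
Proof. by rewrite dotBl !dotBr (dotC b a); ring. Qed.

Section DiscreteValue.
Context {R : realType} {n : nat}.
Local Notation vec := 'rV[R]_n.
Context (H : vec -> vec -> R) (c : vec) (h eps : R) (v : vec -> R).
Hypothesis tonH : tonelli_hamiltonian H.
Hypothesis eps0 : 0 < eps.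
Local Notation l := (ell H c h).

(** Neither continuity nor periodicity is asked for, so that suprema of subsolutions remain
    subsolutions. *)
Definition discrete_subsolution (d B : R) (w : vec -> R) :=
  (forall x, `|w x| <= B) /\
  forall x xi, w x <= d * l x xi + (1 - eps * d) * w (x - d *: xi).

(** Perron's method. The bounds of m and m' by eps B make the constant - B a subsolution and keep
    the update of a subsolution below B. If the supremum u of all subsolutions missed its equation
    at x0, its update w would be a subsolution exceeding u there. *)
Lemma discrete_fixed_point (d m m' B : R) : 0 < d -> eps * d < 1 ->
  (forall x xi, - m <= l x xi) -> (forall x, l x 0 <= m') ->
  m <= eps * B -> m' <= eps * B ->
  exists u, discrete_subsolution d B u /\ forall x e, 0 < e ->
    exists xi, d * l x xi + (1 - eps * d) * u (x - d *: xi) < u x + e.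
Proof.
move=> d0 ed1 lm lm' mB mB'.
set th := 1 - eps * d; have th0 : 0 < th by rewrite subr_gt0.
have B0 : 0 <= B.
  rewrite -(pmulr_rge0 _ eps0); have := lm 0 0; have := lm' 0; lra.
have subB : discrete_subsolution d B (fun=> - B).
  split => [x|x xi]; first by rewrite normrN ger0_norm.
  have : d * (eps * B) + d * l x xi >= 0.
    by rewrite -mulrDr pmulr_rge0 //; have := lm x xi; lra.
  by rewrite /th; lra.
pose S x := [set w x | w in discrete_subsolution d B].
have Ssup x : has_sup (S x).
  split; first by exists (- B), (fun=> - B).
  by exists B => _ [w [wB _] <-]; apply: le_trans (ler_norm _) (wB x).
pose u x := sup (S x).
have u_ge w x : discrete_subsolution d B w -> w x <= u x.
  by move=> sw; apply: sup_upper_bound => //; exists w.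
have u_le x M : (forall w, discrete_subsolution d B w -> w x <= M) -> u x <= M.
  move=> hM; apply: ge_sup; first by case: (Ssup x).
  by move=> _ [w sw <-]; exact: hM.
have su : discrete_subsolution d B u.
  split => [x|x xi].
    rewrite ler_norml; apply/andP; split; first exact: (u_ge (fun=> - B) x subB).
    by apply: u_le => w [wB _]; apply: le_trans (ler_norm _) (wB x).
  apply: u_le => w sw; case: (sw) => _ hw; apply: le_trans (hw x xi) _.
  by rewrite lerD2l ler_pM2l // u_ge.
exists u; split => // x0 e e0; apply: contrapT => no.
have far xi : u x0 + e <= d * l x0 xi + th * u (x0 - d *: xi).
  by rewrite leNgt; apply/negP => hlt; apply: no; exists xi.
pose Q x := [set d * l x xi + th * u (x - d *: xi) | xi in [set: vec]].
have lowQ x xi : - B <= d * l x xi + th * u (x - d *: xi).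
  case: su => uB _; have := uB (x - d *: xi); rewrite ler_norml => /andP[u1 _].
  have : th * (- B) <= th * u (x - d *: xi) by rewrite ler_pM2l.
  have : d * (eps * B) + d * l x xi >= 0.
    by rewrite -mulrDr pmulr_rge0 //; have := lm x xi; lra.
  by rewrite /th; lra.
have Qinf x : has_inf (Q x).
  split; first by exists (d * l x 0 + th * u (x - d *: 0)), 0.
  by exists (- B) => _ [xi _ <-].
pose w x := inf (Q x).
have w_le x xi : w x <= d * l x xi + th * u (x - d *: xi).
  by apply: ge_inf; [case: (Qinf x)|exists xi].
have uw x : u x <= w x.
  apply: lb_le_inf; first by case: (Qinf x).
  by move=> _ [xi _ <-]; case: su.
have sw : discrete_subsolution d B w.
  split => [x|x xi]; last first.
    by apply: le_trans (w_le x xi) _; rewrite lerD2l ler_pM2l.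
  rewrite ler_norml; apply/andP; split.
    apply: lb_le_inf; first by case: (Qinf x).
    by move=> _ [xi _ <-].
  apply: le_trans (w_le x 0) _.
  have [uB _] := su; have := uB (x - d *: 0); rewrite ler_norml => /andP[_ u2].
  have : th * u (x - d *: 0) <= th * B by rewrite ler_pM2l.
  have : d * l x 0 <= d * (eps * B) by rewrite ler_pM2l // (le_trans (lm' x)).
  by rewrite /th; lra.
have : u x0 + e <= w x0.
  apply: lb_le_inf; first by case: (Qinf x0).
  by move=> _ [xi _ <-].
by have := u_ge _ x0 sw; lra.
Qed.

(** A nearly optimal xi at x', corrected by (x - x') / d, leads from x to the same point x' - d xi.
    The modulus depends on d, which is harmless: continuity only serves to attain the minimum. *)
Lemma discrete_continuous (d B : R) u : 0 < d -> eps * d < 1 -> 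
  discrete_subsolution d B u -> (forall x e, 0 < e ->
    exists xi, d * l x xi + (1 - eps * d) * u (x - d *: xi) < u x + e) ->
  continuous u.
Proof.
move=> d0 ed1 [uB su] ap; set th := 1 - eps * d in su ap.
have th0 : 0 < th by rewrite subr_gt0.
have th1 : th < 1 by rewrite ltrBlDr ltrDl mulr_gt0.
have [C C0 hC] := ell_superlinear c h tonH (ler01 : (0 : R) <= 1).
have B0 : 0 <= B by exact: le_trans (normr_ge0 _) (uB 0).
(* Superlinearity with slope 1 confines the nearly optimal velocities, for errors up to 1. *)
pose r := (2 * B + 1) / d + C.
have [K K0 hK] := ell_lipschitz c h tonH (r + 1).
have bound x e xi : 0 < e -> e <= 1 -> d * l x xi + th * u (x - d *: xi) < u x + e ->
    `|xi| <= r.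
  move=> e0 e1 lt; have := hC x xi; rewrite mul1r => hl.
  rewrite /r -lerBlDr ler_pdivlMr // mulrC.
  have : d * (`|xi| - C) <= d * l x xi by rewrite ler_pM2l.
  have := uB x; rewrite ler_norml => /andP[_ u1].
  have := uB (x - d *: xi); rewrite ler_norml => /andP[u2 _].
  have : th * (- B) <= th * u (x - d *: xi) by rewrite ler_pM2l.
  have : th * B <= B by rewrite ler_piMl // ltW.
  by move: lt; lra.
have key x x' e : 0 < e -> e <= 1 -> `|x - x'| < Num.min d (e / (d * K * (1 + d^-1))) ->
    u x - u x' <= 2 * e.
  move=> e0 e1; rewrite lt_min => /andP[xd xe].
  have [xi hxi] := ap x' e e0; have xir := bound _ _ _ e0 e1 hxi.
  pose z := d^-1 *: (x - x').
  have z1 : `|z| = d^-1 * `|x - x'| by rewrite normrZ gtr0_norm ?invr_gt0.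
  have zle : `|z| <= 1 by rewrite z1 mulrC ler_pdivrMr // mul1r ltW.
  have := su x (xi + z).
  have -> : x - d *: (xi + z) = x' - d *: xi.
    by rewrite scalerDr scalerA mulfV ?gt_eqF // scale1r opprD addrA addrAC subKr.
  have x1 : `|xi| <= r + 1 by apply: le_trans xir _; rewrite lerDl.
  have x2 : `|xi + z| <= r + 1 by apply: le_trans (ler_normD _ _) _; apply: lerD.
  have Ez : xi + z - xi = z by rewrite addrC addKr.
  have := hK x' xi x (xi + z) x1 x2; rewrite Ez z1 => hl.
  have : d * (l x (xi + z) - l x' xi) <= e.
    apply: le_trans (_ : d * (K * (`|x - x'| + d^-1 * `|x - x'|)) <= _).
      by rewrite ler_pM2l.
    have P0 : 0 < d * K * (1 + d^-1) by rewrite !mulr_gt0 // addr_gt0 // invr_gt0.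
    move: xe; rewrite ltr_pdivlMr // => /ltW; apply: le_trans.
    by rewrite le_eqVlt; apply/orP; left; apply/eqP; ring.
  by move: hxi; lra.
move=> x; apply/continuous_ed => e e0.
pose e' := Num.min 1 (e / 4).
have e'0 : 0 < e' by rewrite lt_min ltr01 divr_gt0.
have e'1 : e' <= 1 by rewrite ge_min lexx.
have e'e : e' <= e / 4 by rewrite ge_min lexx orbT.
exists (Num.min d (e' / (d * K * (1 + d^-1)))).
  by rewrite lt_min d0 divr_gt0 // !mulr_gt0 // addr_gt0 // invr_gt0.
move=> y yx; have h1 := key y x e' e'0 e'1 yx.
have h2 : u x - u y <= 2 * e' by apply: key; rewrite // distrC.
by rewrite ltr_norml; apply/andP; split; lra.
Qed.

Lemma discrete_attained (d B : R) u : 0 < d -> eps * d < 1 -> 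
  discrete_subsolution d B u -> (forall x e, 0 < e ->
    exists xi, d * l x xi + (1 - eps * d) * u (x - d *: xi) < u x + e) ->
  forall x, exists xi, u x = d * l x xi + (1 - eps * d) * u (x - d *: xi).
Proof.
move=> d0 ed1 sub ap x; have cu := discrete_continuous d0 ed1 sub ap.
case: sub => uB su; set th := 1 - eps * d in su ap *.
have th0 : 0 < th by rewrite subr_gt0.
have th1 : th < 1 by rewrite ltrBlDr ltrDl mulr_gt0.
have [C C0 hC] := ell_superlinear c h tonH (ler01 : (0 : R) <= 1).
have B0 : 0 <= B by exact: le_trans (normr_ge0 _) (uB 0).
pose r := (2 * B + 1) / d + C.
have bound e xi : 0 < e -> e <= 1 -> d * l x xi + th * u (x - d *: xi) < u x + e ->
    `|xi| <= r.
  move=> e0 e1 lt; have := hC x xi; rewrite mul1r => hl.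
  rewrite /r -lerBlDr ler_pdivlMr // mulrC.
  have : d * (`|xi| - C) <= d * l x xi by rewrite ler_pM2l.
  have := uB x; rewrite ler_norml => /andP[_ u1].
  have := uB (x - d *: xi); rewrite ler_norml => /andP[u2 _].
  have : th * (- B) <= th * u (x - d *: xi) by rewrite ler_pM2l.
  have : th * B <= B by rewrite ler_piMl // ltW.
  by move: lt; lra.
pose f xi := d * l x xi + th * u (x - d *: xi).
have cf : continuous f.
  have c1 : continuous (fun xi => l x xi).
    apply: (continuous_after (f := fun xi : vec => (x, xi)) (g := fun q => l q.1 q.2)).
      by apply: continuous_pair => q; [exact: cst_continuous|exact: cvg_id].
    exact: (@ell_continuous R n H c h tonH).
  have c2 : continuous (fun xi : vec => u (x - d *: xi)).
    apply: (continuous_after (f := fun xi : vec => x - d *: xi)) => //.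
    apply: continuous_sub; first exact: continuous_const.
    exact/continuous_scale/continuous_identity.
  by apply: continuous_add; exact: continuous_mull.
have [xi0 hxi0] := ap x 1 ltr01.
have A0 : [set xi : vec | `|xi| <= r] !=set0 by exists xi0; exact: bound hxi0.
have [xi _ hxi] := compact_EVT_min A0 (closed_ball0_compact (r := r))
  (continuous_subspaceT cf).
exists xi; apply/eqP; rewrite eq_le su /=.
apply/ler_addgt0Pr => e e0.
pose e' := Num.min 1 e.
have e'0 : 0 < e' by rewrite lt_min ltr01.
have e'1 : e' <= 1 by rewrite ge_min lexx.
have e'e : e' <= e by rewrite ge_min lexx orbT.
have [xi1 hxi1] := ap x e' e'0.
have := hxi xi1; rewrite inE => /(_ (bound _ _ e'0 e'1 hxi1)) hle.
by apply: le_trans hle _; apply: le_trans (ltW hxi1) _; rewrite lerD2l.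
Qed.

(* Unit steps give u(x) - u(x - d xi) <= d C (|xi| + 1) with C independent of d. *)
Lemma discrete_speed (m B : R) : (forall x xi, `|xi| <= 1 -> l x xi <= m) ->
  0 <= m -> 0 <= B ->
  exists2 r, 0 < r & forall d u, 0 < d -> eps * d < 1 -> discrete_subsolution d B u ->
   forall x xi, u x = d * l x xi + (1 - eps * d) * u (x - d *: xi) -> `|xi| <= r.
Proof.
move=> lm m0 B0; pose C := m + eps * B.
have C00 : 0 <= C by rewrite addr_ge0 // mulr_ge0 // ltW.
have C10 : 0 <= C + 1 by rewrite addr_ge0.
(* The slope C + 1 is one more than the growth rate C of the increments of u; the difference bounds
   |xi|. *)
have [C3 C30 hC3] := ell_superlinear c h tonH C10.
exists (C + eps * B + C3) => [|d u d0 ed1 [uB su] x xi E].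
  by rewrite ltr_wpDl // addr_ge0 // mulr_ge0 // ltW.
have loss y z : - (eps * d * u (y - d *: z)) <= eps * d * B.
  have := uB (y - d *: z); rewrite ler_norml => /andP[u2 _].
  by rewrite -mulrN ler_pM2l ?mulr_gt0 // lerNl.
have step y z : `|z| <= 1 -> u y - u (y - d *: z) <= d * C.
  move=> z1; have := su y z; rewrite mulrBl mul1r.
  have : d * l y z <= d * m by rewrite ler_pM2l // lm.
  have := loss y z; rewrite /C mulrDr; lra.
have steps j y z : `|z| <= 1 -> u y - u (y - (j%:R * d) *: z) <= j%:R * (d * C).
  move=> z1; elim: j => [|j IH]; first by rewrite !mul0r scale0r subr0 subrr.
  have := step (y - (j%:R * d) *: z) z z1.
  rewrite -addrA -opprD -scalerDl -natr1 !mulrDl !mul1r; lra.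
(* The displacement d xi is split into j steps of speed |xi| / j <= 1. *)
pose j := (Num.truncn `|xi|).+1.
have j0 : 0 < j%:R :> R by rewrite ltr0n.
have jxi : `|xi| < j%:R by exact: truncnS_gt.
have jle : j%:R <= `|xi| + 1.
  by rewrite /j -natr1 lerD2r truncn_le.
have z1 : `|j%:R^-1 *: xi| <= 1.
  by rewrite normrZ ger0_norm ?invr_ge0 // mulrC ler_pdivrMr // mul1r; exact: ltW.
have := steps j x _ z1; rewrite scalerA mulrAC mulfV ?gt_eqF // mul1r => h1.
have h2 : j%:R * (d * C) <= (`|xi| + 1) * (d * C) by rewrite ler_wpM2r // mulr_ge0 // ltW.
have h3 : eps * d * u (x - d *: xi) <= eps * d * B.
  rewrite ler_pM2l ?mulr_gt0 //; apply: le_trans (ler_norm _) (uB _).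
have h4 : d * ((C + 1) * `|xi| - C3) <= d * l x xi by rewrite ler_pM2l.
rewrite -(ler_pM2l d0); move: E; rewrite mulrBl mul1r => E.
have : d * l x xi <= (`|xi| + 1) * (d * C) + eps * d * B by lra.
lra.
Qed.

Hypothesis v_continuous : continuous v.
Hypothesis v_periodic : Defs.periodic v.
Hypothesis v_super : forall (phi : vec -> R) (x0 : vec), C1 phi ->
  (exists2 r : R, 0 < r & forall y, `|y - x0| < r -> v x0 - phi x0 <= v y - phi y) ->
  h <= eps * v x0 + H x0 (c + grad phi x0).

(* The inf-convolution of v with parameter lam, together with the gradient q of the
   paraboloid touching v from below at the minimum point y. *)
Lemma inf_convolution (K lam : R) : 0 < K -> 0 < lam ->
  (forall x y, v x - v y <= K * `|x - y|) ->
  exists w : vec -> R, forall x, w x <= v x /\ exists y q : vec,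
    [/\ x - y = lam *: q, `|q| <= 2 * K, w x = v y + dot (x - y) (x - y) / (2 * lam),
      h <= eps * v y + H y (c + q) &
      forall z, w z <= v y + dot (z - y) (z - y) / (2 * lam)].
Proof.
move=> K0 lam0 vK; have l20 : 0 < 2 * lam by rewrite mulr_gt0.
have [B B0 hB] := periodic_bounded v_continuous v_periodic.
pose f x y := v y + dot (x - y) (x - y) / (2 * lam).
have ex x : exists y, forall z, f x y <= f x z.
  (* Beyond this radius the quadratic term exceeds the Lipschitz gain of v, so a minimum over the
     ball is global. *)
  pose r := 2 * lam * K.
  have cf : continuous (fun y => f x y).
    have cd : continuous (fun y : vec => dot (x - y) (x - y)).
      apply: (continuous_after (f := fun y : vec => (x - y, x - y)) (g := fun q => dot q.1 q.2)).
        have cb : continuous (fun y : vec => x - y).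
          by apply: continuous_sub; [exact: continuous_const|exact: continuous_identity].
        exact: continuous_pair.
      exact: dot_continuous.
    by apply: continuous_add => //; exact: continuous_mulr.
  pose A := [set y : vec | `|x - y| <= r].
  have cA : compact A.
    have -> : A = (fun z => x - z) @` [set z : vec | `|z| <= r].
      apply/seteqP; split => [y yr|_ [z zr <-]]; last by rewrite /A /= subKr.
      by exists (x - y) => //; rewrite subKr.
    apply: continuous_compact; last exact: closed_ball0_compact.
    apply: continuous_subspaceT; apply: continuous_sub; first exact: continuous_const.
    exact: continuous_identity.
  have A0 : A !=set0.
    by exists x; rewrite /A /= subrr normr0 !mulr_ge0 // ltW.
  have [y _ hy] := compact_EVT_min A0 cA (continuous_subspaceT cf).
  exists y => z; have [zr|zr] := lerP `|x - z| r; first by apply: hy; rewrite inE.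
  apply: le_trans (hy x _) _.
    by rewrite inE /A /= subrr normr0 !mulr_ge0 // ltW.
  rewrite /f subrr dot0l mul0r addr0 -lerBlDl; apply: le_trans (vK x z) _.
  rewrite ler_pdivlMr //; apply: le_trans (sqr_norm_le_dot _); rewrite expr2.
  have -> : K * `|x - z| * (2 * lam) = r * `|x - z| by rewrite /r; ring.
  by rewrite ler_wpM2r // ltW.
have [Y HY] := choice ex.
exists (fun x => f x (Y x)) => x; split.
  by apply: le_trans (HY x x) _; rewrite /f subrr dot0l mul0r addr0.
set y := Y x; exists y, (lam^-1 *: (x - y)).
have E : x - y = lam *: (lam^-1 *: (x - y)).
  by rewrite scalerA mulfV ?gt_eqF // scale1r.
split => //; last by move=> z; exact: HY.
  rewrite normrZ gtr0_norm ?invr_gt0 // mulrC ler_pdivrMr //.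
  have := HY x x; rewrite /f subrr dot0l mul0r addr0 -/y => h1.
  have h2 := vK x y; have h3 := sqr_norm_le_dot (x - y).
  have h4 : dot (x - y) (x - y) <= K * `|x - y| * (2 * lam).
    by rewrite -ler_pdivrMr //; lra.
  have [->|xy] := eqVneq `|x - y| 0; first by rewrite !mulr_ge0 // ltW.
  have xy0 : 0 < `|x - y| by rewrite lt_def xy normr_ge0.
  rewrite -(ler_pM2r xy0) -expr2; apply: le_trans h3 _; apply: le_trans h4 _.
  by rewrite le_eqVlt; apply/orP; left; apply/eqP; ring.
(* Up to a constant, the paraboloid touching v from below at y; its gradient there is (x - y) /
   lam. *)
pose phi (z : vec) := - (dot (x - z) (x - z) / (2 * lam)).
have dphi z i (t : R) : is_derive t 1 (fun t => phi (z + t *: ev R i))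
    ((x - z) 0 i / lam - t / lam).
  have -> : (fun t : R => phi (z + t *: ev R i)) =
      (fun t : R => t * ((x - z) 0 i / lam) - (t * t) * (2 * lam)^-1)
      + cst (- (dot (x - z) (x - z) / (2 * lam))).
    apply/funext => s; rewrite fctE /cst /phi opprD addrA.
    rewrite dot_sqB dotZr dot_ev dotZl dotZr dot_ev evE eqxx mulr1.
    by field; rewrite gt_eqF.
  have -> : (x - z) 0 i / lam - t / lam =
      1 * ((x - z) 0 i / lam) - (t * 1 + t * 1) * (2 * lam)^-1 + 0.
    by field; rewrite gt_eqF.
  have hid := is_derive_id t (1 : R).
  apply: is_deriveD; apply: is_deriveB; first exact: (@is_derive_mulr _ id).
  exact: (@is_derive_mulr _ (fun t : R => t * t)).
have dphi0 z i : derivable phi z (ev R i) /\ 'D_(ev R i) phi z = (x - z) 0 i / lam.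
  have [d1 d2] := dphi z i 0; rewrite mul0r subr0 in d2.
  have E1 : (fun t : R => t^-1 *: (phi (t *: ev R i + z) - phi z)) =
     (fun t : R => t^-1 *: (phi (z + (t *: 1 + 0) *: ev R i) - phi (z + (0 : R) *: ev R i))).
    apply/funext => t; have -> : t *: (1 : R) = t by exact: mulr1.
    by rewrite scale0r !addr0 (addrC z).
  by rewrite /derivable /derive E1.
have Cphi : C1 phi.
  split.
    have cb : continuous (fun z : vec => x - z).
      by apply: continuous_sub; [exact: continuous_const|exact: continuous_identity].
    have cd : continuous (fun z : vec => dot (x - z) (x - z)).
      apply: (continuous_after (f := fun z : vec => (x - z, x - z)) (g := fun q => dot q.1 q.2)).
        exact: continuous_pair.
      exact: dot_continuous.
    have cm := continuous_mulr (a := (2 * lam)^-1) cd.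
    by move=> z; exact: cvgN (cm z).
  move=> i; split => [z|]; first by case: (dphi0 z i).
  have -> : pd phi i = (fun z => (x - z) 0 i / lam).
    by apply/funext => z; case: (dphi0 z i).
  apply: continuous_mulr; have cb : continuous (fun z : vec => x - z).
    by apply: continuous_sub; [exact: continuous_const|exact: continuous_identity].
  exact: (continuous_after cb (@coord_continuous _ _ _ 0 i)).
have gphi : grad phi y = lam^-1 *: (x - y).
  apply/rowP => i; rewrite [in RHS]mxE mulrC mxE /pd.
  by case: (dphi0 y i).
rewrite -gphi; apply: v_super => //; exists 1 => // z _.
by have := HY x z; rewrite /f /phi -/y; lra.
Qed.

(** The paraboloid over the inf-convolution w bounds w(x - d xi) by an explicit quadratic in d, so
    the viscosity inequality makes w a supersolution of the discrete problem up to d eta eps. The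
    supremum of u - w then contracts by 1 - eps d, which leaves at most eta. *)
Lemma discrete_comparison (B K : R) : 0 < K ->
  (forall x y, v x - v y <= K * `|x - y|) ->
  forall eta, 0 < eta -> exists2 d0 : R, 0 < d0 & forall d u, 0 < d -> d < d0 ->
    discrete_subsolution d B u -> forall x, u x <= v x + eta.
Proof.
move=> K0 vK eta eta0.
have [rq rq0 hrq] : exists2 rq : R, 0 < rq & forall q : vec, `|q| <= 2 * K -> `|c + q| <= rq.
  exists (`|c| + 2 * K) => [|q qK]; first by rewrite ltr_wpDl // mulr_gt0.
  by apply: le_trans (ler_normD _ _) _; rewrite lerD2l.
have [KH KH0 hKH] := periodic_C1_lipschitz rq (ham_C1 tonH) (ham_periodic tonH).
have [V hV] : exists V : R, forall x p, `|p| <= rq -> `|grad_p H x p| <= V.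
  have cn : continuous (fun q : vec * vec => `|grad_p H q.1 q.2|).
    apply: continuous_after; last exact: norm_continuous.
    exact: C1_2_grad_p_continuous (ham_C1 tonH).
  have pn : periodic2 (fun x p => `|grad_p H x p|).
    by move=> x p k; rewrite grad_p_periodic.
  have [V _ hV] := periodic_slab_bounded rq cn pn.
  by exists V => x p pr; have := hV x p pr; rewrite normr_id.
have V0 : 0 <= V by apply: le_trans (normr_ge0 _) (hV 0 0 _); rewrite normr0 ltW.
(* The change of H between x and the touching point y is at most KH lam 2K; this [lam] keeps it
   below half of eta eps. *)
pose lam := eta * eps / (2 * (KH * (2 * K) + 1)).
have lam0 : 0 < lam by rewrite divr_gt0 ?mulr_gt0 // ltr_wpDl // !mulr_ge0 // ltW.
have [w hw] := inf_convolution K0 lam0 vK.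
pose Q := eps * (n%:R * (V * (2 * K))) + n%:R * (V * V) / (2 * lam) + 1.
have Q0 : 0 < Q.
  have KK : 0 <= 2 * K by rewrite mulr_ge0 // ltW.
  have ll : 0 <= 2 * lam by rewrite mulr_ge0 // ltW.
  have Ve : 0 <= eps * (n%:R * (V * (2 * K))) 
    by apply: mulr_ge0; [exact: ltW|apply: mulr_ge0 => //; exact: mulr_ge0].
  by rewrite ltr_wpDl // addr_ge0 // divr_ge0 // mulr_ge0 // mulr_ge0.
exists (Num.min (eps^-1) (eta * eps / 2 / Q)).
  by rewrite lt_min invr_gt0 eps0 !divr_gt0 // mulr_gt0.
move=> d u d0; rewrite lt_min => /andP[de dQ] [uB su].
have ed1 : eps * d < 1 by rewrite mulrC -ltr_pdivlMr // div1r.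
set th := 1 - eps * d in su; have th0 : 0 < th by rewrite subr_gt0.
have step x : exists xi, d * l x xi + th * w (x - d *: xi) <= w x + d * (eta * eps).
  have [_ [y [q [Exy qK Ew sup wle]]]] := hw x.
  (* The velocity dual to p gives equality in Fenchel's inequality at x, while the viscosity
     inequality holds at y. *)
  pose p := c + q; pose xi := grad_p H x p; exists xi.
  have pr : `|p| <= rq by exact: hrq.
  have xiV : `|xi| <= V by exact: hV.
  have El : l x xi = dot xi q - H x p + h.
    by rewrite /ell lagrangian_grad_p // /p dotDr (dotC c); ring.
  have hH : H y p - H x p <= KH * (lam * (2 * K)).
    apply: le_trans (ler_norm _) _; have := hKH (x, p) (y, p) pr pr => /= hh.
    apply: le_trans hh _; rewrite ler_pM2l //; apply: norm_pair_le => /=.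
      by rewrite distrC Exy normrZ gtr0_norm // ler_pM2l.
    rewrite subrr normr0; apply: mulr_ge0; first exact: ltW.
    by apply: mulr_ge0 => //; exact: ltW.
  have hq : dot xi q <= n%:R * (V * (2 * K)).
    apply: le_trans (ler_norm _) _; apply: le_trans (norm_dot _ _) _.
    by rewrite ler_wpM2l // ler_pM.
  have hx : dot xi xi <= n%:R * (V * V).
    apply: le_trans (ler_norm _) _; apply: le_trans (norm_dot _ _) _.
    by rewrite ler_wpM2l // ler_pM.
  have := wle (x - d *: xi).
  have -> : dot (x - d *: xi - y) (x - d *: xi - y) =
     dot (x - y) (x - y) - 2 * d * lam * dot xi q + d * d * dot xi xi.
    have -> : x - d *: xi - y = (x - y) - d *: xi by rewrite addrAC.
    by rewrite (dot_sqB (x - y) (d *: xi)) (dotZr d (x - y) xi) (dotZr d (d *: xi) xi) (dotZl d xi xi) Exy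
      (dotZl lam q xi) (dotC q); ring.
  have -> : v y + (dot (x - y) (x - y) - 2 * d * lam * dot xi q + d * d * dot xi xi) / (2 * lam)
    = w x - d * dot xi q + d * (d * (dot xi xi / (2 * lam))).
    by rewrite Ew; field; rewrite gt_eqF.
  move=> hw'.
  have vw : v y <= w x.
    by rewrite Ew lerDl divr_ge0 ?dot_ge0 // mulr_ge0 // ltW.
  have e1 : eps * v y <= eps * w x by rewrite ler_pM2l.
  have hxx : dot xi xi / (2 * lam) <= n%:R * (V * V) / (2 * lam).
    by rewrite ler_wpM2r // invr_ge0 mulr_ge0 // ltW.
  have xx0 : 0 <= dot xi xi / (2 * lam) by rewrite divr_ge0 ?dot_ge0 // mulr_ge0 // ltW.
  have main : d * l x xi + th * w (x - d *: xi) <= w x +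
      d * ((h - eps * w x - H x p) + d * (eps * dot xi q + dot xi xi / (2 * lam))).
    have h1 : th * w (x - d *: xi) <= th * (w x - d * dot xi q + d * (d * (dot xi xi / (2 * lam)))).
      by rewrite ler_pM2l.
    have h2 : th * (d * (d * (dot xi xi / (2 * lam)))) <= d * (d * (dot xi xi / (2 * lam))).
      apply: ler_piMl; first by apply: mulr_ge0; [exact: ltW|apply: mulr_ge0 => //; exact: ltW].
      by rewrite lerBlDr lerDl; apply: mulr_ge0; exact: ltW.
    apply: le_trans (_ : d * (dot xi q - H x p + h) + (th * (w x - d * dot xi q)
      + d * (d * (dot xi xi / (2 * lam)))) <= _).
      rewrite El lerD2l; apply: le_trans h1 _; rewrite mulrDr lerD2l; exact: h2.
    by rewrite le_eqVlt; apply/orP; left; apply/eqP; rewrite /th; ring.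
  apply: le_trans main _; rewrite lerD2l ler_pM2l //.
  have b1 : h - eps * w x - H x p <= KH * (lam * (2 * K)).
    by apply: le_trans hH; rewrite /p in sup *; lra.
  have b2 : KH * (lam * (2 * K)) <= eta * eps / 2.
    have D0 : 0 < 2 * (KH * (2 * K) + 1) by rewrite mulr_gt0 // ltr_wpDl // !mulr_ge0 // ltW.
    have -> : KH * (lam * (2 * K)) = (KH * (2 * K)) * (eta * eps / (2 * (KH * (2 * K) + 1))).
      by rewrite /lam; ring.
    rewrite mulrA ler_pdivrMr //.
    have -> : eta * eps / 2 * (2 * (KH * (2 * K) + 1)) = (KH * (2 * K) + 1) * (eta * eps) by field.
    by rewrite ler_pM2r ?mulr_gt0 // lerDl.
  have b3 : d * (eps * dot xi q + dot xi xi / (2 * lam)) <= eta * eps / 2.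
    apply: le_trans (_ : d * Q <= _); last by move: dQ; rewrite ltr_pdivlMr // => /ltW.
    rewrite ler_pM2l // /Q.
    have : eps * dot xi q <= eps * (n%:R * (V * (2 * K))) by rewrite ler_pM2l.
    by lra.
  by lra.
have [Bv Bv0 hBv] := periodic_bounded v_continuous v_periodic.
have wlow x : - Bv <= w x.
  have [_ [y [q [_ _ -> _ _]]]] := hw x.
  have := hBv y; rewrite ler_norml => /andP[v1 _]; apply: le_trans v1 _.
  by rewrite lerDl divr_ge0 ?dot_ge0 // mulr_ge0 // ltW.
(* The supremum need not be attained, as u is not assumed periodic; the contraction inequality is
   derived for the supremum itself. *)
pose S := [set u x - w x | x in [set: vec]].
have Ssup : has_sup S.
  split; first by exists (u 0 - w 0), 0.
  exists (B + Bv) => _ [x _ <-]; have := uB x; rewrite ler_norml => /andP[_ u2].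
  by apply: lerD => //; rewrite lerNl.
have S_ge x : u x - w x <= sup S by apply: sup_upper_bound => //; exists x.
have S_le : sup S <= eta.
  have : sup S <= d * (eta * eps) + th * sup S.
    apply: ge_sup; first by case: Ssup.
    move=> _ [x _ <-]; have [xi hxi] := step x.
    have h1 := su x xi; have h2 := S_ge (x - d *: xi).
    have h3 : th * (u (x - d *: xi) - w (x - d *: xi)) <= th * sup S by rewrite ler_pM2l.
    by rewrite mulrBr in h3; lra.
  have ed0 : 0 < eps * d by rewrite mulr_gt0.
  rewrite /th mulrBl mul1r => hs; rewrite -(ler_pM2l ed0).
  have -> : eps * d * eta = d * (eta * eps) by ring.
  by lra.
move=> x; have := S_ge x; have [wv _] := hw x; move: S_le.
by lra.
Qed.

End DiscreteValue.

(** * Minimizing chains *)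

Section Chain.
Context {R : realType} {n : nat}.
Local Notation vec := 'rV[R]_n.
Local Notation state := (phase R n).
Context (H : vec -> vec -> R) (c : vec) (h eps : R) (v : vec -> R).
Context (Phi : R -> phase R n -> phase R n).
Hypothesis tonH : tonelli_hamiltonian H.
Hypothesis eps0 : 0 < eps.
Hypothesis flow : EL_flow H c eps Phi.
Local Notation l := (ell H c h).

Lemma is_derive_min0 (f : R -> R) (s : R) : is_derive (0 : R) 1 f s ->
  (forall t, f 0 <= f t) -> s = 0.
Proof.
move=> df fmin; apply/eqP; rewrite -normr_le0; apply/ler_addgt0Pr => e e0; rewrite add0r.
have [d d0 hd] := is_derive_ed_inv df e0.
have d20 : 0 < d / 2 by rewrite divr_gt0.
have key t : `|t| = d / 2 -> - (t * s) <= e * (d / 2).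
  move=> td; have := hd t; rewrite td add0r ler_norml => /(_ _)/andP[|_ h1].
    by rewrite ltr_pdivrMr // ltr_pMr //; lra.
  by have := fmin t; lra.
have k1 := key (d / 2) (gtr0_norm d20).
have k2 : - (- (d / 2) * s) <= e * (d / 2) by apply: key; rewrite normrN gtr0_norm.
rewrite ler_norml; apply/andP; split; rewrite -(ler_pM2r d20); lra.
Qed.

Lemma ell_is_derive (x xi w : vec) i (a : R) :
  is_derive (0 : R) 1 (fun t => l (x + t *: (a *: ev R i)) (xi + t *: w))
   (dot w (momentum H x xi) - a * grad_x H x (momentum H x xi) 0 i - dot c w).
Proof.
have d1 := lagrangian_is_derive tonH x xi w i a.
have -> : (fun t : R => l (x + t *: (a *: ev R i)) (xi + t *: w)) =
   (fun t => lagrangian H (x + t *: (a *: ev R i)) (xi + t *: w)) -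
   (fun t => t * dot c w) + cst (h - dot c xi).
  by apply/funext => t; rewrite !fctE /ell dotDr dotZr; ring.
rewrite -[X in is_derive _ _ _ X]addr0; apply: is_deriveD; apply: is_deriveB.
rewrite -[X in is_derive _ _ _ X]mul1r.
exact: (@is_derive_mulr _ id 0 1 (dot c w) (is_derive_id _ _)).
Qed.

Section Steps.
Variables (d B : R) (u : vec -> R) (x xi : nat -> vec).
Hypothesis d0 : 0 < d.
Hypothesis ed1 : eps * d < 1.
Hypothesis sub : discrete_subsolution H c h eps d B u.
Hypothesis opt : forall k, u (x k) = d * l (x k) (xi k) + (1 - eps * d) * u (x k - d *: xi k).
Hypothesis xS : forall k, x k.+1 = x k - d *: xi k.

(* Vary xi_k and xi_(k+1) in opposite directions, so that x_(k+2) stays fixed. *)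
Lemma chain_stationary k :
  momentum H (x k) (xi k) - c =
  (1 - eps * d) *: (momentum H (x k.+1) (xi k.+1) - c -
    d *: grad_x H (x k.+1) (momentum H (x k.+1) (xi k.+1))).
Proof.
set th := 1 - eps * d; have th0 : 0 < th by rewrite subr_gt0.
set p := momentum H (x k) (xi k); set p' := momentum H (x k.+1) (xi k.+1).
apply/rowP => i.
(* Scaled so that x_(k+1) moves by t times the basis vector; hence a = 0 for the first cost and a =
   1 for the second. *)
pose e : vec := d^-1 *: ev R i.
pose f (t : R) := d * l (x k + t *: (0 *: ev R i)) (xi k + t *: (- e)) +
  th * (d * l (x k.+1 + t *: (1 *: ev R i)) (xi k.+1 + t *: e)).
have df := ell_is_derive (x k) (xi k) (- e) i 0.
have df' := ell_is_derive (x k.+1) (xi k.+1) e i 1.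
have dF : is_derive (0 : R) 1 f
   ((dot (- e) p - 0 * grad_x H (x k) p 0 i - dot c (- e)) * d +
    (dot e p' - 1 * grad_x H (x k.+1) p' 0 i - dot c e) * (th * d)).
  have -> : f = (fun t : R => l (x k + t *: (0 *: ev R i)) (xi k + t *: (- e)) * d) +
     (fun t => l (x k.+1 + t *: (1 *: ev R i)) (xi k.+1 + t *: e) * (th * d)).
    by apply/funext => t; rewrite fctE /f; ring.
  by apply: is_deriveD; apply: is_derive_mulr.
have := is_derive_min0 dF _.
rewrite /e dotNl !dotNr !dotZl !dotZr (dotC _ p) (dotC _ p') !dot_ev => E.
have {}E := E _.
rewrite !mxE; apply/eqP; rewrite -subr_eq0; apply/eqP.
have dn : d != 0 by rewrite gt_eqF.
rewrite -oppr0 -(E _); last first.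
  move=> t; rewrite /f !scale0r !addr0 scaler0 addr0 scale1r.
  have [_ su] := sub.
  have h1 := su (x k) (xi k + t *: (- e)).
  have Ex : x k - d *: (xi k + t *: (- e)) = x k.+1 + t *: ev R i.
    rewrite xS scalerDr scalerA scalerN opprD opprK addrA; congr (_ + _).
    by rewrite /e scalerA mulrAC mulfV // mul1r.
  rewrite Ex in h1.
  have h2 := su (x k.+1 + t *: ev R i) (xi k.+1 + t *: e).
  have Ex2 : x k.+1 + t *: ev R i - d *: (xi k.+1 + t *: e) = x k.+1 - d *: xi k.+1.
    rewrite scalerDr scalerA /e scalerA mulrAC mulfV // mul1r opprD.
    by rewrite addrACA subrr addr0.
  rewrite Ex2 in h2.
  have o1 := opt k; have o2 := opt k.+1; rewrite -xS in o1.
  have h3 : th * u (x k.+1 + t *: ev R i) <= th * (d * l (x k.+1 + t *: ev R i) (xi k.+1 + t *: e)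
     + th * u (x k.+1 - d *: xi k.+1)) by rewrite ler_pM2l.
  rewrite -/th in o1 o2 h1; rewrite o1 {1}o2 in h1; lra.
by rewrite -/p -/p' !mxE; field.
Qed.

End Steps.

(** The chain runs backwards in time, hence the plus sign: it is an Euler step of the opposite
    field. The relation of [chain_stationary] is implicit in the new momentum; making it explicit
    costs a multiple of d^2, uniformly over chains of speed at most r. *)
Lemma chain_step_error (r : R) : exists2 A, 0 <= A & forall d B u (x xi : nat -> vec),
  0 < d -> eps * d < 1 -> discrete_subsolution H c h eps d B u ->
  (forall k, u (x k) = d * l (x k) (xi k) + (1 - eps * d) * u (x k - d *: xi k)) ->
  (forall k, x k.+1 = x k - d *: xi k) -> (forall k, `|xi k| <= r) ->
  forall k, `|legendre H (x k.+1, xi k.+1) - legendre H (x k, xi k)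
     + d *: ham_field H c eps (legendre H (x k, xi k))| <= A * d ^+ 2.
Proof.
have [s s0 hs] := momentum_bounded tonH r.
have [K K0 hK] := grad_lipschitz tonH s.
have [M hM] : exists M : R, forall x p, `|p| <= s -> `|grad_x H x p| <= M.
  have cn : continuous (fun q : vec * vec => `|grad_x H q.1 q.2|).
    apply: continuous_after; last exact: norm_continuous.
    exact: C1_2_grad_x_continuous (ham_C1 tonH).
  have pn : periodic2 (fun x p => `|grad_x H x p|).
    by move=> x p k; rewrite grad_x_periodic.
  have [V _ hV] := periodic_slab_bounded s cn pn.
  by exists V => x p pr; have := hV x p pr; rewrite normr_id.
have M0 : 0 <= M by apply: le_trans (normr_ge0 _) (hM 0 0 _); rewrite normr0.
pose D := eps * (s + `|c|) + M.
have D0 : 0 <= D by rewrite addr_ge0 // mulr_ge0 ?(ltW eps0) // addr_ge0.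
have rp : 0 <= `|r| by exact: normr_ge0.
have Q0 : 0 <= eps * D + K * (D + `|r|) + eps * M.
  by rewrite !addr_ge0 // mulr_ge0 // ?(ltW eps0) ?(ltW K0) // addr_ge0.
exists (eps * D + K * (D + `|r|) + eps * M) => //.
move=> d B u x xi d0 ed1 sub opt xS xr k.
have st := chain_stationary d0 ed1 sub opt xS k.
set p := momentum H (x k) (xi k) in st; set p' := momentum H (x k.+1) (xi k.+1) in st.
set g := grad_x H (x k) p; set g' := grad_x H (x k.+1) p' in st.
have ps : `|p| <= s by exact: hs. have p's : `|p'| <= s by exact: hs.
have ed0 : 0 < eps * d by rewrite mulr_gt0.
have g'M : `|g'| <= M by exact: hM.
have incr : p' - p = (eps * d) *: (p' - c) + ((1 - eps * d) * d) *: g'.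
  apply/rowP => i; have := congr1 (fun y : vec => y 0 i) st; rewrite !mxE; lra.
have incr_le : `|p' - p| <= d * D.
  rewrite incr; apply: le_trans (ler_normD _ _) _.
  rewrite (normrZ (eps * d)) (gtr0_norm ed0) normrZ.
  have -> : d * D = eps * d * (s + `|c|) + d * M by rewrite /D; ring.
  apply: lerD.
    rewrite ler_pM2l //; apply: le_trans (ler_normB _ _) _; exact: lerD.
  apply: ler_pM => //; rewrite gtr0_norm ?mulr_gt0 // ?subr_gt0 //.
  by rewrite ger_pMl // lerBlDr lerDl ltW.
have xinc : `|x k.+1 - x k| <= d * `|r|.
  rewrite xS addrAC subrr add0r normrN normrZ gtr0_norm // ler_pM2l //.
  exact: le_trans (xr k) (ler_norm _).
have ginc : `|g' - g| <= K * (d * (D + `|r|)).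
  have [_ hh] := hK (x k.+1, p') (x k, p) p's ps; apply: le_trans hh _.
  rewrite ler_pM2l // mulrDr; apply: norm_pair_le => /=.
    by apply: le_trans xinc _; rewrite lerDr mulr_ge0 // ltW.
  by apply: le_trans incr_le _; rewrite lerDl mulr_ge0 // ltW.
apply: (@norm_pair_le R n) => /=.
  by rewrite /p momentum_crit // xS addrAC subrK subrr normr0; exact: mulr_ge0 Q0 (sqr_ge0 d).
rewrite -/p -/p' -/g.
have -> : p' - p + d *: (eps *: (c - p) - g) =
    (eps * d) *: (p' - p) + d *: (g' - g) - (eps * d * d) *: g'.
  apply/rowP => i; have := congr1 (fun y : vec => y 0 i) incr; rewrite !mxE => E; lra.
apply: le_trans (_ : eps * d * (d * D) + d * (K * (d * (D + `|r|))) + eps * d * d * M <= _).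
  apply: le_trans (ler_normB _ _) _; apply: lerD.
    apply: le_trans (ler_normD _ _) _; apply: lerD; rewrite normrZ gtr0_norm // ler_pM2l //.
  by rewrite normrZ gtr0_norm ?mulr_gt0 // ler_pM2l // mulr_gt0.
by rewrite le_eqVlt; apply/orP; left; apply/eqP; ring.
Qed.

(** [euler_error] covers the full steps, [solution_stays] the remaining time below d, and the
    Lipschitz bound of H_p converts momenta back into velocities. *)
Lemma chain_shadow (r A t eta : R) : 0 <= A -> 0 <= t -> 0 < eta ->
  exists2 d0 : R, 0 < d0 & forall d (z : nat -> state), 0 < d -> d < d0 ->
   (forall k, `|(z k).2| <= r) ->
   (forall k, `|legendre H (z k.+1) - legendre H (z k)
       + d *: ham_field H c eps (legendre H (z k))| <= A * d ^+ 2) ->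
   forall k, `|z (k + Num.truncn (t / d))%N - Phi (- t) (z k)| <= eta.
Proof.
move=> A0 t0 eta0.
have [s s0 hs] := momentum_bounded tonH r.
have [K [M [K0 M0 hL hB]]] :=
  locally_lipschitz_opp (ham_field_locally_lipschitz c eps tonH) (s + 2).
have [K' K'0 hK'] := grad_lipschitz tonH (s + 2).
pose E := expR (K * t) * (t * (A + K * M)).
have E0 : 0 <= E.
  by rewrite mulr_ge0 ?expR_ge0 // mulr_ge0 // addr_ge0 // mulr_ge0 // ltW.
(* Chosen so that d Q < min(1, eta) implies every smallness condition used below. *)
pose Q := (1 + K') * (E + M) + E + M + 1.
have EM : 0 <= E + M by rewrite addr_ge0 // ltW.
have K1 : 0 <= 1 + K' by rewrite addr_ge0 // ltW.
have Q0 : 0 < Q by rewrite ltr_wpDl // -addrA addr_ge0 // mulr_ge0.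
exists (Num.min 1 eta / Q) => [|d z d0 dlt zr zstep k]; first by rewrite divr_gt0 // lt_min ltr01.
have dQ : d * Q < Num.min 1 eta by rewrite -ltr_pdivlMr.
move: dQ; rewrite lt_min => /andP[dQ1 dQeta].
have KE : 0 <= (1 + K') * (E + M) by rewrite mulr_ge0.
have EQ : E <= Q by rewrite /Q; lra.
have MQ : M <= Q by rewrite /Q; lra.
have dE1 : E * d <= 1.
  by rewrite mulrC; apply: le_trans (ltW dQ1); rewrite ler_pM2l.
have dM1 : M * d < 1.
  by rewrite mulrC; apply: le_lt_trans dQ1; rewrite ler_pM2l.
pose m := Num.truncn (t / d); pose w s := legendre H (Phi (- s) (z k)).
have sw : solution (fun q => - ham_field H c eps q) w.
  exact: (solution_opp (flow_solution tonH flow (z k))).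
have w0 : w 0 = legendre H (z k) by rewrite /w oppr0 (flow0 flow).
have td0 : 0 <= t / d by rewrite divr_ge0 // ltW.
have mt : m%:R * d <= t by rewrite -ler_pdivlMr // truncn_le.
have tm : t < m%:R * d + d.
  have -> : m%:R * d + d = m.+1%:R * d by rewrite -natr1 mulrDl mul1r.
  by rewrite -ltr_pdivrMr // truncnS_gt.
have ys j : `|(legendre H (z (k + j)%N)).2| <= s by exact: hs.
have ystep j : (j < m)%N -> `|legendre H (z (k + j.+1)%N) - legendre H (z (k + j)%N)
    - d *: (- ham_field H c eps (legendre H (z (k + j)%N)))| <= A * d ^+ 2.
  by move=> _; rewrite addnS scalerN opprK; exact: zstep.
have small : expR (K * t) * (`|w 0 - legendre H (z (k + 0)%N)| + t * (A + K * M) * d) <= 1.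
  rewrite addn0 w0 subrr normr0 add0r mulrA; exact: dE1.
have := @euler_error R n _ w (fun j => legendre H (z (k + j)%N)) s K M A t d m
  sw K0 M0 A0 d0 hL hB ys ystep mt dM1 small m (leqnn m).
rewrite addn0 w0 subrr normr0 add0r mulrA -/E => err.
have ws : `|(w (m%:R * d)).2| <= s + 1.
  rewrite -(subrK (legendre H (z (k + m)%N)).2 (w (m%:R * d)).2).
  apply: le_trans (ler_normD _ _) _; rewrite addrC; apply: lerD; first exact: hs.
  apply: le_trans (norm_snd (w (m%:R * d) - legendre H (z (k + m)%N))) _.
  exact: le_trans err dE1.
have hB' q : `|q.2| <= s + 1 + 1 -> `|- ham_field H c eps q| <= M.
  by move=> q2; apply: hB; apply: le_trans q2 _; lra.
have Mt : M * (t - m%:R * d) < 1.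
  by apply: le_lt_trans dM1; rewrite ler_pM2l //; lra.
have [|wt2 wt] := @solution_stays R n _ w (s + 1) M (m%:R * d) t sw M0 hB' ws Mt t.
  by rewrite mt lexx.
have wt' : `|w t - w (m%:R * d)| <= M * d.
  by apply: le_trans wt _; rewrite ler_pM2l //; lra.
have dist : `|legendre H (z (k + m)%N) - w t| <= (E + M) * d.
  rewrite distrC -(subrKA (w (m%:R * d))); apply: le_trans (ler_normD _ _) _.
  by rewrite mulrDl addrC; apply: lerD.
rewrite -/m -(legendreK tonH (z (k + m)%N)) -(legendreK tonH (Phi (- t) (z k))).
apply: le_trans (_ : (1 + K') * ((E + M) * d) <= _); last first.
  apply: ltW; apply: le_lt_trans dQeta; rewrite mulrA mulrC ler_pM2l // /Q; lra.
have ws2 : `|(w t).2| <= s + 2 by apply: le_trans wt2 _; lra.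
have zs2 : `|(legendre H (z (k + m)%N)).2| <= s + 2 by apply: le_trans (hs _ _ (zr _)) _; lra.
have [h1 _] := hK' _ _ zs2 ws2.
have D0 : 0 <= (E + M) * d by rewrite mulr_ge0 // ltW.
rewrite mulrDl mul1r; apply: norm_pair_le => /=.
  apply: le_trans (norm_fst (legendre H (z (k + m)%N) - w t)) _; apply: le_trans dist _.
  by rewrite lerDl mulr_ge0 // ltW.
apply: le_trans h1 _; apply: le_trans (_ : K' * ((E + M) * d) <= _).
  by rewrite ler_pM2l.
by rewrite lerDr.
Qed.

End Chain.

(** * Construction of an invariant measure from the occupation of chains *)

Section Existence.
Context {R : realType} {n : nat}.
Local Notation vec := 'rV[R]_n.
Local Notation state := (phase R n).

Lemma integral_probability_cst (mu : probability (phaseM R n) R) (C : R) :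
  (\int[mu]_q cst C%:E q = C%:E)%E.
Proof.
rewrite integral_cst; last exact: measurableT.
by rewrite -[RHS]mule1; congr (_ * _)%E; exact: (@probability_setT _ _ _ mu).
Qed.

(** Cost integrands change sign and are only bounded below. Either inequality forces g to be
    integrable: in the first, the negative part of g - C is at most |C|, so the bound controls the
    positive part. *)
Lemma integral_shift_le (mu : probability (phaseM R n) R) (g : phaseM R n -> R) (C a : R) :
  measurable_fun setT g -> (forall q, 0 <= g q) ->
  ((\int[mu]_q (g q - C)%:E <= a%:E)%E <-> (\int[mu]_q (g q)%:E <= (a + C)%:E)%E).
Proof.
move=> mg g0.
have mEg : measurable_fun setT (EFin \o g) by exact/measurable_EFinP.
have icst (x : R) : mu.-integrable setT (cst x%:E).
  by apply: finite_measure_integrable_cst; exact: measurableT.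
have key : mu.-integrable setT (EFin \o g) ->
    (\int[mu]_q (g q - C)%:E = \int[mu]_q (g q)%:E - C%:E)%E.
  move=> ig; under eq_integral do rewrite EFinB.
  by rewrite (integralB measurableT ig (icst C)) -[X in _ = (_ - X)%E](integral_probability_cst mu C).
split=> hle.
  pose f : phaseM R n -> \bar R := EFin \o (fun q => g q - C).
  have mf : measurable_fun setT f.
    by apply/measurable_EFinP; exact: measurable_funB.
  have neg : (\int[mu]_q f^\- q <= `|C|%:E)%E.
    rewrite -[X in (_ <= X)%E]mule1 -(@probability_setT _ _ _ mu) -integral_cst //.
    apply: ge0_le_integral => //; first exact: measurable_funeneg.
    move=> q _; rewrite funenegE /f /= -EFin_max lee_fin ge_max normr_ge0 andbT opprB.
    by apply: le_trans (ler_norm C); rewrite lerBlDr lerDl.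
  have pos : (\int[mu]_q f^\+ q <= (a + `|C|)%:E)%E.
    move: hle; rewrite integralE -/f EFinD leeBlDr; last first.
      by rewrite ge0_fin_numE; [exact: le_lt_trans neg (ltry _)|exact: integral_ge0].
    by move=> /le_trans; apply; rewrite leeD2l.
  have ig : mu.-integrable setT (EFin \o g).
    have if' : mu.-integrable setT f.
      apply/integrableP; split=> //.
      have -> : (fun q => `|f q|)%E = (fun q => f^\+ q + f^\- q)%E by exact: fune_abse.
      rewrite ge0_integralD //; [|exact: measurable_funepos|exact: measurable_funeneg].
      by apply: lte_add_pinfty; [exact: le_lt_trans pos (ltry _)|exact: le_lt_trans neg (ltry _)].
    have -> : EFin \o g = (f \+ cst C%:E)%E.
      by apply/funext => q /=; rewrite /f /= -EFinD subrK.
    exact: integrableD.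
  by move: hle; rewrite key // leeBlDr // EFinD.
have ig : mu.-integrable setT (EFin \o g).
  apply/integrableP; split=> //.
  under eq_integral do rewrite gee0_abs ?lee_fin //.
  exact: le_lt_trans hle (ltry _).
by rewrite key // leeBlDr // -EFinD.
Qed.

Lemma eventually_inv_le (M e : R) : 0 < e -> \forall j \near \oo, M / j.+1%:R <= e.
Proof.
move=> e0; exists (Num.truncn (M / e)) => // j /= jM.
rewrite ler_pdivrMr // mulrC -ler_pdivrMr //; apply: ltW.
apply: lt_le_trans (truncnS_gt _) _; by rewrite ler_nat ltnS.
Qed.

Context (H : vec -> vec -> R) (c : vec) (h eps : R) (v : vec -> R).
Context (Phi : R -> state -> state).
Hypothesis tonH : tonelli_hamiltonian H.
Hypothesis eps0 : 0 < eps.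
Hypothesis flow : EL_flow H c eps Phi.
Local Notation l := (ell H c h).

Lemma modT_flow s q : modT (Phi s (modT q)) = modT (Phi s q).
Proof.
rewrite {2}/modT fracvE (flow_translate tonH flow s q).
by rewrite /modT /= fracvD.
Qed.

Lemma measurable_modT_flow s :
  measurable_fun setT (fun q : phaseM R n => (modT (Phi s q) : phaseM R n)).
Proof.
have m := continuous_measurable_phase (@flow_continuous R n H c eps Phi tonH flow s).
exact: (measurableT_comp measurable_modT m).
Qed.

(** Divided by d, the dynamic programming identity telescopes. Replacing eps u by eps v needs only
    the upper bound on u, which is why a one-sided comparison is enough. *)
Lemma chain_sum_le (d B eta : R) (u : vec -> R) (x xi : nat -> vec) N : 0 < d ->
  (forall y, `|u y| <= B) ->
  (forall k, u (x k) = d * l (x k) (xi k) + (1 - eps * d) * u (x k - d *: xi k)) ->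
  (forall k, x k.+1 = x k - d *: xi k) -> (forall y, u y <= v y + eta) ->
  \sum_(k < N) (l (x k) (xi k) - eps * v (x k)) <=
    2 * B / d + 2 * B * eps + N%:R * (eps * eta).
Proof.
move=> d0 uB opt xS uv.
have step : \sum_(k < N) (l (x k) (xi k) - eps * v (x k)) <=
    (u (x 0) - u (x N)) / d + eps * (u (x N) - u (x 0)) + N%:R * (eps * eta).
  elim: N => [|N IH]; first by rewrite big_ord0 !subrr mul0r mulr0 mul0r !addr0.
  rewrite big_ord_recr /= -natr1; apply: le_trans (lerD IH (lexx _)) _.
  have lN : l (x N) (xi N) = (u (x N) - u (x N.+1)) / d + eps * u (x N.+1).
    have := opt N; rewrite -xS => ->; field; exact: lt0r_neq0.
  have := uv (x N); rewrite -(ler_pM2l eps0) lN; move: (u _) (u _) (u _) (v _) => a b e f.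
  rewrite !mulrDl; set X := d^-1 => hh; nra.
apply: le_trans step _; rewrite lerD2r.
have /andP[a1 a2] : - B <= u (x 0) <= B by rewrite -ler_norml.
have /andP[b1 b2] : - B <= u (x N) <= B by rewrite -ler_norml.
apply: lerD.
  by rewrite ler_pM2r ?invr_gt0 //; lra.
rewrite mulrC ler_pM2r //; lra.
Qed.

Lemma invariant_measure_exists : continuous v -> Defs.periodic v ->
  (forall (phi : vec -> R) (x0 : vec), C1 phi ->
         (exists2 r : R, 0 < r & forall y, `|y - x0| < r ->
            v x0 - phi x0 <= v y - phi y) ->
         h <= eps * v x0 + H x0 (c + grad phi x0)) ->
  (exists2 K, 0 < K & forall x y, v x - v y <= K * `|x - y|) ->
  exists2 nu : probability (phaseM R n) R, Defs.invariant Phi nu &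
    (functional H c eps v nu <= (- h)%:E)%E.
Proof.
move=> cv pv vsup [K K0 vK].
have [Cm Cm0 hm] := @ell_superlinear R n H c h tonH 0 (lexx 0).
have cl := @ell_continuous R n H c h tonH.
have [C1 C10 hC1] := periodic_slab_bounded 1 cl (ell_periodic c h tonH).
have [BV BV0 hBV] := periodic_bounded cv pv.
(* Then eps B = Cm + C1 dominates both the lower bound - Cm of the cost and its upper bound C1 at
   rest, as [discrete_fixed_point] requires. *)
pose B := (Cm + C1) / eps.
have B0 : 0 <= B by rewrite divr_ge0 ?addr_ge0 // ltW.
have epsB : eps * B = Cm + C1 by rewrite /B mulrC divfK // gt_eqF.
have [r r0 hr] : exists2 r, 0 < r & forall d u, 0 < d -> eps * d < 1 ->
    discrete_subsolution H c h eps d B u ->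
    forall x xi, u x = d * l x xi + (1 - eps * d) * u (x - d *: xi) -> `|xi| <= r.
  apply: (@discrete_speed R n H c h eps tonH eps0 C1 B) => //; last exact: ltW.
  by move=> x xi /(hC1 x); apply: le_trans; exact: ler_norm.
have [A A0 hA] := chain_step_error c h tonH eps0 r.
(* The largest step satisfies eps ds = 1 / 2, below the threshold 1. *)
pose ds := (2 * eps)^-1; have ds0 : 0 < ds by rewrite invr_gt0 mulr_gt0.
pose de j : R := ds / j.+1%:R.
have de0 j : 0 < de j by rewrite divr_gt0.
have de1 j : eps * de j < 1.
  rewrite /de mulrA ltr_pdivrMr // mul1r; apply: lt_le_trans (_ : 1 <= _); last by rewrite ler1n.
  by rewrite /ds invfM mulrCA mulfV ?mulr1 ?gt_eqF // invf_lt1 // ltr1n.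
have /choice[w hw] : forall j, exists w : (vec -> R) * ((nat -> vec) * (nat -> vec)),
   [/\ discrete_subsolution H c h eps (de j) B w.1,
    forall k, w.1 (w.2.1 k) = de j * l (w.2.1 k) (w.2.2 k) +
       (1 - eps * de j) * w.1 (w.2.1 k - de j *: w.2.2 k) &
    forall k, w.2.1 k.+1 = w.2.1 k - de j *: w.2.2 k].
  move=> j.
  have [u [su apu]] := @discrete_fixed_point R n H c h eps eps0 (de j) Cm C1 B (de0 j) (de1 j)
    (fun x xi => ltac:(by have := hm x xi; rewrite mul0r sub0r))
    (fun x => ltac:(by have := hC1 x 0; rewrite normr0 => /(_ ler01); apply: le_trans; exact: ler_norm))
    ltac:(by rewrite epsB lerDl ltW) ltac:(by rewrite epsB lerDr ltW).
  have /choice[Xi hXi] := @discrete_attained R n H c h eps tonH eps0 (de j) B u (de0 j) (de1 j) su apu.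
  pose x := fix x k := if k is k'.+1 then x k' - de j *: Xi (x k') else (0 : vec).
  by exists (u, (x, fun k => Xi (x k))); split => //= k; exact: hXi.
pose z j k : state := ((w j).2.1 k, (w j).2.2 k).
have zr j k : `|(z j k).2| <= r.
  by have [su op _] := hw j; exact: (hr _ _ (de0 j) (de1 j) su _ _ (op k)).
(* The covered time N_j d_j grows like j + 1, so the boundary terms of [chain_sum_le] and the
   relative index shifts both vanish in the averages. *)
pose N j := (j.+1 ^ 2)%N; have N0 j : (0 < N j)%N by rewrite expn_gt0.
have [G [P [PG sG cvP]]] := frequency_limit z N0.
exists (limit_probability (freq_ge0 PG cvP) (freq_add PG cvP) (freq_T N0 PG cvP) (freq_far PG cvP zr)).
  have inv s : s <= 0 -> forall X : set (phaseM R n), measurable X ->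
     limit_probability (freq_ge0 PG cvP) (freq_add PG cvP) (freq_T N0 PG cvP) (freq_far PG cvP zr)
       ((fun q : phaseM R n => (modT (Phi s q) : phaseM R n)) @^-1` X) =
     limit_probability (freq_ge0 PG cvP) (freq_add PG cvP) (freq_T N0 PG cvP) (freq_far PG cvP zr) X.
    move=> s0; have t0 : 0 <= - s by rewrite oppr_ge0.
    apply: limit_invariant => //.
    - exact: (@flow_continuous R n H c eps Phi tonH flow s).
    - exact: (@flow_translate R n H c eps Phi tonH flow s).
    move=> eta et0; have [d1 d10 hd1] := chain_shadow tonH flow r A0 t0 et0.
    exists (fun j => Num.truncn (- s / de j)); split.
      apply/cvgrPdist_le => e e0; have := eventually_inv_le (- s / ds) e0.
      apply: filterS => j; apply: le_trans; rewrite sub0r normrN ger0_norm ?divr_ge0 //.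
      rewrite ler_pdivrMr ?ltr0n //.
      have sj : 0 <= - s / de j by rewrite divr_ge0 // ltW.
      have /andP[trj _] := truncn_itv sj; apply: le_trans trj _.
      rewrite le_eqVlt; apply/orP; left; apply/eqP; rewrite /N /de natrX; field.
      by rewrite nat1r pnatr_eq0 /= gt_eqF.
    have d20 : 0 < d1 / 2 by rewrite divr_gt0.
    apply: filterS (eventually_inv_le ds d20) => j dj k _.
    rewrite -[s in Phi s]opprK; have [su op xS] := hw j.
    apply: (hd1 (de j)) => //; first by apply: le_lt_trans dj _; lra.
    apply: (hA _ _ _ _ _ (de0 j) (de1 j) su op xS) => k'; exact: zr.
  split=> [|s X mX]; first exact: limit_probability_fund.
  (* Chains follow the flow only backwards. Invariance for s > 0 results from that for - s by the
     group law, and the case s = 0 accounts for the reduction that remains. *)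
  have [s0|s0] := leP s 0; first exact: inv.
  have sN : - s <= 0 by rewrite oppr_le0 ltW.
  have mPhi : measurable ((fun q : phaseM R n => (modT (Phi s q) : phaseM R n)) @^-1` X).
    by rewrite -[X in measurable X]setTI; exact: measurable_modT_flow.
  rewrite -(inv _ sN _ mPhi) /preimage /=; rewrite -(inv _ (lexx 0) _ mX); congr (_ _); apply/funext => q.
  by rewrite /preimage /= modT_flow -(flowD tonH flow) addrN.
rewrite /functional; set nu := limit_probability _ _ _ _.
(* Makes the integrand nonnegative, as [limit_integral_le] requires. *)
pose C0 := Cm + eps * BV.
pose g (q : state) := l q.1 q.2 - eps * v q.1 + C0.
have g0 q : 0 <= g q.
  have := hm q.1 q.2; rewrite mul0r sub0r => h1.
  have := le_trans (ler_norm _) (hBV q.1); rewrite -(ler_pM2l eps0) => h2.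
  by rewrite /g /C0; lra.
have cg : continuous g.
  apply: continuous_add; last exact: continuous_const.
  apply: continuous_sub; first exact: cl.
  apply: continuous_mull; apply: continuous_after cv => q; exact: cvg_fst.
have -> : (fun q : phaseM R n => (lagrangian H q.1 q.2 - dot c q.2 - eps * v q.1)%:E) =
    (fun q => (g q - (C0 + h))%:E).
  by apply/funext => q; rewrite /g /ell; congr (_%:E); ring.
apply/integral_shift_le => //; first exact: continuous_measurable_phaseR.
rewrite addrCA addNr addr0; apply: limit_integral_le => //.
  by move=> q k; rewrite /g /= ell_periodic // pv.
move=> e e0; pose eta := e / (2 * eps); have eta0 : 0 < eta by rewrite divr_gt0 // mulr_gt0.
have [d1 d10 hd1] := @discrete_comparison R n H c h eps v tonH eps0 cv pv vsup B K K0 vK eta eta0.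
have d20 : 0 < d1 / 2 by rewrite divr_gt0.
have e20 : 0 < e / 2 by rewrite divr_gt0.
apply: filterS2 (eventually_inv_le ds d20) (eventually_inv_le (2 * B / ds + 2 * B * eps) e20) => j dj Mj.
have [su op xS] := hw j; have [uB _] := su.
have uv := hd1 (de j) _ (de0 j) (ltac:(by apply: le_lt_trans dj _; lra)) su.
have := chain_sum_le (N j) (de0 j) uB op xS uv => hS.
rewrite /average ler_pdivrMr ?ltr0n // /g big_split /= sumr_const card_ord -[C0 *+ _]mulr_natr.
apply: le_trans (lerD hS (lexx _)) _.
have Nj0 : 0 < (N j)%:R :> R by rewrite ltr0n.
rewrite addrC [(C0 + e) * _]mulrDl lerD2l.
have -> : eps * eta = e / 2 by rewrite /eta; field; rewrite gt_eqF.
rewrite [X in _ <= X](_ : _ = (N j)%:R * (e / 2) + (N j)%:R * (e / 2)); last by field.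
rewrite lerD2r -ler_pdivrMl //; apply: le_trans Mj.
set a : R := j.+1%:R; have a1 : 1 <= a by rewrite ler1n.
have a0 : 0 < a by apply: lt_le_trans a1.
have -> : (N j)%:R = a ^+ 2 by rewrite /N natrX.
rewrite /de -/a [X in X <= _](_ : _ = 2 * B / ds / a + 2 * B * eps / a / a); last first.
  by field; rewrite !gt_eqF.
rewrite [(_ + _) / a]mulrDl lerD2l ler_pdivrMr // ler_peMr // divr_ge0 ?(ltW a0) // mulr_ge0 ?(ltW eps0) //.
by rewrite mulr_ge0.
Qed.

End Existence.

(** * Calibrated orbits *)

Section Riemann.
Context {R : realType}.

(** Compactness of [-1, 0] gives uniform continuity of G, and on each cell the mean value theorem
    writes the increment of A through a value of G. *)
Lemma riemann_sum (G A : R -> R) : continuous G -> (forall t : R, is_derive t 1 A (G t)) ->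
  (fun N => (\sum_(k < N.+1) G (- (k%:R / N.+1%:R))) / N.+1%:R) @ \oo --> A 0 - A (- 1).
Proof.
move=> cG dA; apply/cvgrPdist_le => e e0.
have cov : near_covering (`[- 1, 0]%classic : set R).
  by apply/compact_near_coveringP; exact: segment_compact.
pose P (N : nat) (x' : R) := forall s : R, `|s - x'| <= N.+1%:R^-1 -> `|G s - G x'| <= e.
have unif : forall x, (`[- 1, 0]%classic : set R) x ->
    \forall x' \near x & N \near \oo, P N x'.
  move=> x _; have [d d0 hd] := (continuous_ed G x).1 (cG x) (e / 2) (divr_gt0 e0 (ltr0n _ 2)).
  have d20 : 0 < d / 2 by rewrite divr_gt0.
  have d30 : 0 < d / 3 by rewrite divr_gt0.
  exists ([set x' | `|x' - x| < d / 2], [set N | 1 / N.+1%:R <= d / 3]) => /=.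
    split; last exact: eventually_inv_le.
    by exists (d / 2) => //= y; rewrite /ball_ /= distrC.
  move=> [y N] /= [yx Nd] s sy.
  have h1 := hd s; have h2 := hd y; rewrite mul1r in Nd.
  have : `|s - x| < d.
    rewrite -(subrKA y); apply: le_lt_trans (ler_normD _ _) _.
    apply: lt_trans (ler_ltD (le_trans sy Nd) yx) _; lra.
  move=> /h1 {}h1; have {}h2 := h2 (ltac:(by apply: lt_trans yx _; lra)).
  rewrite -(subrKA (G x)); apply: le_trans (ler_normD _ _) _; rewrite (distrC (G x)); lra.
have near_all : \forall N \near \oo, `[- 1, 0]%classic `<=` P N := cov _ _ P _ unif.
have [N0 _ hN0] := near_all; exists N0 => // N /hN0 hN.
set M : R := N.+1%:R; have M0 : 0 < M by rewrite ltr0n.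
have -> : A 0 - A (- 1) = \sum_(k < N.+1) (A (- (k%:R / M)) - A (- (k.+1%:R / M))).
  have := @telescope_sumr R 0 N.+1 (fun k => - A (- (k%:R / M))) isT.
  rewrite mulfV ?gt_eqF // mul0r oppr0 opprK addrC big_mkord => <-.
  by apply: eq_bigr => k _; rewrite opprK addrC.
rewrite mulr_suml -sumrB; apply: le_trans (ler_norm_sum _ _ _) _.
apply: le_trans (_ : \sum_(k < N.+1) (e / M) <= _); last first.
  by rewrite sumr_const card_ord -mulr_natr divfK ?gt_eqF.
apply: ler_sum => k _.
have [t /andP[t0 t1] ->] := mvt_between (- (k.+1%:R / M)) (- (k%:R / M)) dA.
have -> : - (k%:R / M) - - (k.+1%:R / M) = M^-1 by rewrite -natr1; field; rewrite gt_eqF.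
rewrite -mulrBl normrM [X in _ * X]gtr0_norm ?invr_gt0 // ler_pM2r ?invr_gt0 //.
apply: hN.
  rewrite /= in_itv /= lerNl opprK oppr_le0 ler_pdivrMr // mul1r ler_nat ltnW ?ltnS //=.
    by rewrite divr_ge0 // ltW.
  by rewrite -ltnS ltn_ord.
have -> : - (k.+1%:R / M) + t / M - - (k%:R / M) = (t - 1) / M.
  by rewrite -natr1; field; rewrite gt_eqF.
rewrite normrM [X in _ * X]gtr0_norm ?invr_gt0 // ger_pMl ?invr_gt0 // ler_norml; lra.
Qed.

Lemma is_derive_expR_mul (a t : R) : is_derive t 1 (fun s => expR (a * s)) (expR (a * t) * a).
Proof.
have d1 := @is_derive_mulr R id t 1 a (is_derive_id t (1 : R)).
have := @is_derive1_comp R expR (fun s => id s * a) t _ _ (is_derive_expR _) d1.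
rewrite mul1r [a * t]mulrC (_ : expR \o _ = fun s => expR (a * s)) //.
by apply/funext => s /=; rewrite mulrC.
Qed.

Lemma continuous_sum {T : topologicalType} (N : nat) (f : nat -> T -> R) :
  (forall k, continuous (f k)) -> continuous (fun q => \sum_(k < N) f k q).
Proof.
move=> cf; elim: N => [|N IH].
  rewrite (_ : (fun q => _) = cst 0); first exact: continuous_const.
  by apply/funext => q; rewrite big_ord0.
rewrite (_ : (fun q => _) = fun q => \sum_(k < N) f k q + f N q).
  exact: continuous_add.
by apply/funext => q; rewrite big_ord_recr.
Qed.

End Riemann.

Lemma EFin_cvg {R : realType} (u : nat -> R) (a : R) : u @ \oo --> a ->
  (fun j => (u j)%:E) @ \oo --> a%:E.
Proof. by move=> h; apply: cvg_EFin => //; exact: nearW. Qed.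

Section Calibration.
Context {R : realType} {n : nat}.
Local Notation vec := 'rV[R]_n.
Local Notation state := (phase R n).
Context (H : vec -> vec -> R) (c : vec) (h eps : R) (v : vec -> R).
Context (Phi : R -> state -> state).
Hypothesis tonH : tonelli_hamiltonian H.
Hypothesis eps0 : 0 < eps.
Hypothesis flow : EL_flow H c eps Phi.
Local Notation l := (ell H c h).

Section Invariant.
Variable mu : probability (phaseM R n) R.
Hypothesis inv : Defs.invariant Phi mu.

(** The invariance concerns the flow followed by reduction, and periodicity of g makes the reduction
    invisible. *)
Lemma invariant_integral (g : state -> R) s : continuous g -> (forall q, 0 <= g q) ->
  (forall q (k : 'rV[int]_n), g (q.1 + zvec R k, q.2) = g q) ->
  (\int[mu]_q (g (Phi s q))%:E = \int[mu]_q (g q)%:E)%E.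
Proof.
move=> cg g0 pg; have mg := (measurable_EFinP _ _).2 (continuous_measurable_phaseR cg).
pose psi (q : phaseM R n) : phaseM R n := modT (Phi s q).
have mpsi : measurable_fun setT psi := measurable_modT_flow tonH flow s.
have gmod q : g (modT q) = g q by rewrite /modT fracvE pg.
have := @ge0_integral_pushforward _ _ _ _ R psi mpsi mu setT _ measurableT mg (fun q _ => g0 q).
rewrite preimage_setT /= => E.
have -> : (\int[mu]_q (g (Phi s q))%:E = \int[mu]_q (g (psi q))%:E)%E.
  by apply: eq_integral => q _; rewrite gmod.
rewrite -E; apply: eq_measure_integral => A mA _; rewrite /pushforward.
exact: (inv.2 s A mA).
Qed.

(** Riemann sums stand in for an exchange of the two integrals: each node contributes the same
    integral by invariance, the averaged weights tend to (1 - exp(- eps)) / eps, and the pointwise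
    limit also yields measurability of J. *)
Lemma orbit_integral_le (f J : state -> R) (F : R) : continuous f -> (forall q, 0 <= f q) ->
  (forall q (k : 'rV[int]_n), f (q.1 + zvec R k, q.2) = f q) ->
  (forall q, exists A : R -> R, (forall t : R, is_derive t 1 A (expR (eps * t) * f (Phi t q))) /\
     J q = A 0 - A (- 1)) ->
  (\int[mu]_q (f q)%:E <= F%:E)%E ->
  measurable_fun setT (J : phaseM R n -> R) /\
  (\int[mu]_q (J q)%:E <= (((1 - expR (- eps)) / eps) * F)%:E)%E.
Proof.
move=> cf f0 pf hJ hF.
pose W (N k : nat) : R := expR (eps * - (k%:R / N.+1%:R)).
pose RS N (q : state) := (\sum_(k < N.+1) W N k * f (Phi (- (k%:R / N.+1%:R)) q)) / N.+1%:R.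
have cRS N : continuous (RS N).
  apply: continuous_mulr; 
  apply: (@continuous_sum _ _ N.+1 (fun k q => W N k * f (Phi (- (k%:R / N.+1%:R)) q))) => k.
  apply: continuous_mull.
  apply: continuous_after cf; exact: (@flow_continuous R n H c eps Phi tonH flow).
have mRS N := continuous_measurable_phaseR (cRS N).
have RSJ q : (fun N => RS N q) @ \oo --> J q.
  have [A [dA ->]] := hJ q.
  have cG : continuous (fun t => expR (eps * t) * f (Phi t q)).
    move=> t; apply: cvgM.
      apply: (@continuous_comp _ _ _ (fun s => eps * s)); last exact: continuous_expR.
      by apply: cvgMr; exact: cvg_id.
    exact: (@continuous_after _ _ _ (fun s => Phi s q) f (@flow_time_continuous R n H c eps Phi tonH flow q) cf).
  exact: riemann_sum cG dA.
split; first exact: (measurable_realfun.measurable_fun_cvg mRS (fun q _ => RSJ q)).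
pose S N : R := (\sum_(k < N.+1) W N k) / N.+1%:R.
have cS : S @ \oo --> (1 - expR (- eps)) / eps.
  have -> : (1 - expR (- eps)) / eps = expR (eps * 0) / eps - expR (eps * (- 1)) / eps.
    by rewrite mulr0 expR0 mulrN1 mulrBl.
  apply: (@riemann_sum R (fun t => expR (eps * t)) (fun t => expR (eps * t) / eps)).
    move=> t; apply: (@continuous_comp _ _ _ (fun s => eps * s)); last exact: continuous_expR.
    by apply: cvgMr; exact: cvg_id.
  move=> t; rewrite -[X in is_derive _ _ _ X](mulfK (lt0r_neq0 eps0)).
  apply: is_derive_mulr.
  exact: is_derive_expR_mul.
have [I [I0 EI IF]] : exists I : R, [/\ 0 <= I, (\int[mu]_q (f q)%:E = I%:E)%E & I <= F].
  have i0 : (0 <= \int[mu]_q (f q)%:E)%E by apply: integral_ge0 => q _; rewrite lee_fin.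
  have fi : (\int[mu]_q (f q)%:E)%E \is a fin_num.
    by rewrite ge0_fin_numE //; exact: le_lt_trans hF (ltry _).
  exists (fine (\int[mu]_q (f q)%:E)%E); rewrite fineK // -!lee_fin fineK //.
have RSint N : (\int[mu]_q (RS N q)%:E = (S N * I)%:E)%E.
  have M0 : 0 <= (N.+1%:R)^-1 :> R by rewrite invr_ge0.
  pose b k : R := W N k / N.+1%:R.
  have b0 k : 0 <= b k by rewrite divr_ge0 // expR_ge0.
  have cfk k : continuous (fun q => f (Phi (- (k%:R / N.+1%:R)) q)).
    exact: (@continuous_after _ _ _ _ f (@flow_continuous R n H c eps Phi tonH flow _) cf).
  have mfk k := (measurable_EFinP _ _).2 (continuous_measurable_phaseR (cfk k)).
  under eq_integral => q _.
    have -> : (RS N q)%:E = (\sum_(k < N.+1) (b k)%:E * (f (Phi (- (k%:R / N.+1%:R)) q))%:E)%E.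
      rewrite /RS mulr_suml -sumEFin; apply: eq_bigr => k _.
      by rewrite -EFinM mulrAC.
    over.
  rewrite (@ge0_integral_sum _ _ _ mu setT measurableT 'I_N.+1
    (fun k q => (b k)%:E * (f (Phi (- (k%:R / N.+1%:R)) q))%:E)%E); first last.
  - by move=> k q _; rewrite -EFinM lee_fin mulr_ge0.
  - by move=> k; apply: measurable_funeM; exact: mfk.
  rewrite /S mulr_suml mulr_suml -sumEFin; apply: eq_bigr => k _.
  rewrite ge0_integralZl_EFin //; first by rewrite invariant_integral // EI -EFinM.
  - by move=> q _; rewrite lee_fin.
  - exact: mfk.
have Ffat := @fatou _ (phaseM R n) R mu setT measurableT (fun N q => (RS N q)%:E)
  (fun N => (measurable_EFinP _ _).2 (mRS N)) _.
apply: le_trans (_ : (limn_einf (fun N => \int[mu]_q (RS N q)%:E) <= _)%E).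
  apply: le_trans (Ffat _); last first.
    move=> N q _; rewrite lee_fin divr_ge0 // sumr_ge0 // => k _.
    by rewrite mulr_ge0 // expR_ge0.
  rewrite le_eqVlt; apply/orP; left; apply/eqP; apply: eq_integral => q _.
  have cE : (fun N => (RS N q)%:E) @ \oo --> (J q)%:E by apply: EFin_cvg; exact: RSJ.
  by rewrite (cvg_limn_einf_sup cE).1.
have cE : (fun N => \int[mu]_q (RS N q)%:E)%E @ \oo --> (((1 - expR (- eps)) / eps) * I)%:E.
  rewrite (_ : (fun N => _) = fun N => (S N * I)%:E); last by apply/funext => N; rewrite RSint.
  by apply: EFin_cvg; apply: cvgMl.
rewrite (cvg_limn_einf_sup cE).1 lee_fin ler_wpM2l // divr_ge0 ?(ltW eps0) // subr_ge0.
by rewrite -expR0 ler_expR oppr_le0 ltW.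
Qed.

End Invariant.
End Calibration.

Section Calibrated.
Context {R : realType} {n : nat}.
Local Notation vec := 'rV[R]_n.
Local Notation state := (phase R n).
Context (H : vec -> vec -> R) (c : vec) (h eps : R) (v : vec -> R).
Context (Phi : R -> state -> state).
Hypothesis tonH : tonelli_hamiltonian H.
Hypothesis eps0 : 0 < eps.
Hypothesis flow : EL_flow H c eps Phi.
Hypothesis v_continuous : continuous v.
Hypothesis v_periodic : Defs.periodic v.
Hypothesis var : variational_repr H c eps h v.
Local Notation l := (ell H c h).

Definition orbit_cost q (s : R) : R := expR (eps * s) * l (Phi s q).1 (Phi s q).2.

Definition cost_primitive q (A : R -> R) := forall t : R, is_derive t 1 A (orbit_cost q t).

Lemma orbit_velocity q : velocity (fun s => (Phi s q).1) (fun s => (Phi s q).2).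
Proof. by move=> t i; exact: (@flow_is_derive R n H c eps Phi flow q t i). Qed.

Lemma orbit_velocity_continuous q : continuous (fun s => (Phi s q).2).
Proof.
apply: (@continuous_after _ _ _ (fun s => Phi s q) snd).
  exact: (@flow_time_continuous R n H c eps Phi tonH flow q).
by move=> p; exact: cvg_snd.
Qed.

Lemma orbit_cost_continuous q : continuous (orbit_cost q).
Proof.
exact: (@running_cost_continuous R n H c eps h tonH (fun s => (Phi s q).1)
  (fun s => (Phi s q).2) (velocity_continuous (@orbit_velocity q)) (@orbit_velocity_continuous q)).
Qed.

Lemma cost_primitive_exists q : exists A, cost_primitive q A.
Proof. exact: primitive (@orbit_cost_continuous q). Qed.

Lemma cost_primitive_shift q A t : cost_primitive q A ->
  cost_primitive (Phi t q) (fun s => A (s + t) * expR (- (eps * t))).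
Proof.
move=> dA s.
have h2 : is_derive s 1 (fun s : R => s + t) 1.
  by rewrite -[X in is_derive _ _ _ X]addr0; apply: is_deriveD.
have h3 := @is_derive1_comp R A (fun s : R => s + t) s _ _ (dA (s + t)) h2.
have := is_derive_mulr (expR (- (eps * t))) h3.
rewrite mulr1 /orbit_cost (flowD tonH flow).
have -> : expR (eps * (s + t)) = expR (eps * s) * expR (eps * t) by rewrite -expRD mulrDr.
have E : expR (eps * t) * expR (- (eps * t)) = 1 by rewrite -expRD addrN expR0.
rewrite mulrAC -(mulrA (expR (eps * s))) E mulr1.
exact: id.
Qed.

(** Nonincreasing in s along every orbit, and constant exactly on the time intervals where the orbit
    minimizes. The choice of A shifts it by a constant. *)
Definition discounted_value q A (s : R) := expR (eps * s) * v (Phi s q).1 - A s.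

Lemma discounted_value_nincr q A s t : cost_primitive q A -> s <= t ->
  discounted_value q A t <= discounted_value q A s.
Proof.
move=> dA; rewrite le_eqVlt => /predU1P[->//|st].
have T0 : 0 < t - s by rewrite subr_gt0.
have := value_le tonH var (orbit_velocity (Phi t q)) (@orbit_velocity_continuous (Phi t q)) T0
  (cost_primitive_shift t dA).
have et := expR_gt0 (eps * t).
rewrite -(ler_pM2l et) (flow0 flow) -(flowD tonH flow) opprB subrK add0r.
have E : expR (eps * t) * expR (- (eps * t)) = 1 by rewrite -expRD addrN expR0.
rewrite /discounted_value; have -> : expR (eps * s) = expR (eps * t) * expR (- (eps * (t - s))).
  by rewrite -expRD; congr expR; ring.
rewrite mulrDr mulrBr !(mulrCA (expR (eps * t)) (A _)) E !mulr1 mulrA.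
lra.
Qed.

(** An integral rather than an increment of a primitive, so that no choice depending on q is
    involved. *)
Definition orbit_action q : R :=
  fine (\int[lebesgue_measure]_(s in `[(- 1)%R, 0%R]) (orbit_cost q s)%:E)%E.

Definition defect q : R := orbit_action q + expR (- eps) * v (Phi (- 1) q).1 - v q.1.

Lemma orbit_actionE q A : cost_primitive q A -> orbit_action q = A 0 - A (- 1).
Proof.
move=> dA; rewrite /orbit_action.
by rewrite (integral_primitive (@orbit_cost_continuous q) dA) //= oppr_lt0.
Qed.

Lemma defectE q A t : cost_primitive q A ->
  expR (eps * t) * defect (Phi t q) = discounted_value q A (t - 1) - discounted_value q A t.
Proof.
move=> dA; rewrite /defect (orbit_actionE (cost_primitive_shift t dA)) add0r.
rewrite -(flowD tonH flow) (addrC (- 1)) /discounted_value.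
have E : expR (eps * (t - 1)) = expR (eps * t) * expR (- eps) by rewrite -expRD; congr expR; ring.
have E2 : expR (eps * t) * expR (- (eps * t)) = 1 by rewrite -expRD addrN expR0.
rewrite E; move: E2; move: (expR _) (expR (- (eps * t))) (expR (- eps)) => a b d ab.
rewrite mulrBr mulrDr -mulrBl mulrCA ab; ring.
Qed.

Lemma defect_ge0 q : 0 <= defect q.
Proof.
have [A dA] := cost_primitive_exists q; have := defectE 0 dA.
rewrite (flow0 flow) mulr0 expR0 mul1r => ->; rewrite subr_ge0.
by apply: discounted_value_nincr => //; rewrite sub0r lerN10.
Qed.

Lemma defect_translate q (k : 'rV[int]_n) : defect (q.1 + zvec R k, q.2) = defect q.
Proof.
rewrite /defect /= (flow_translate tonH flow) /= !v_periodic; congr (_ + _ - _).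
rewrite /orbit_action; congr fine; apply: eq_integral => s _.
by rewrite /orbit_cost (flow_translate tonH flow) /= ell_periodic.
Qed.

(* The value k = 0 asks for calibration up to time 1: the lower bound in
   [graph_estimate] starts from a point slightly ahead on the orbit. *)
Definition calibrated : set state :=
  [set q | forall k : nat, defect (Phi (1 - k%:R) q) = 0].

(** Zero defects make the values at the times 1 - k agree; monotonicity then leaves no room in
    between. *)
Lemma calibrated_constant q A s : calibrated q -> cost_primitive q A -> s <= 1 ->
  discounted_value q A s = discounted_value q A 1.
Proof.
move=> cal dA s1.
have step k : discounted_value q A (1 - k%:R) = discounted_value q A 1.
  elim: k => [|k IH]; first by rewrite subr0.
  have := defectE (1 - k%:R) dA; rewrite cal mulr0 IH => /eqP; rewrite eq_sym subr_eq0 => /eqP <-.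
  by rewrite -natr1 opprD addrA.
apply/eqP; rewrite eq_le; apply/andP; split; last exact: discounted_value_nincr.
have := step (Num.truncn (1 - s)).+1 => <-; apply: discounted_value_nincr => //.
by have := truncnS_gt (1 - s); lra.
Qed.

Lemma calibrated_minimizing q : calibrated q ->
  minimizing_curve H c eps h v q.1 (fun s => (Phi s q).1).
Proof.
move=> cal; split=> [|T T0]; first by rewrite (flow0 flow).
split; first exact: velocity_abs_cont (orbit_velocity q) (@orbit_velocity_continuous q).
have [A dA] := cost_primitive_exists q.
rewrite (action_smooth v tonH (orbit_velocity q) (@orbit_velocity_continuous q) T0 dA).
have e0 := calibrated_constant cal dA ler01.
have eT : discounted_value q A (- T) = discounted_value q A 1.
  by apply: calibrated_constant => //; lra.
move: e0; rewrite -eT /discounted_value mulr0 expR0 mul1r (flow0 flow) mulrN => E.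
by congr (_%:E); lra.
Qed.

Lemma integral_add_ge0 (mu : probability (phaseM R n) R) (f g : phaseM R n -> R) :
  measurable_fun setT f -> measurable_fun setT g ->
  (forall q, 0 <= f q) -> (forall q, 0 <= g q) ->
  (\int[mu]_q (f q + g q)%:E = \int[mu]_q (f q)%:E + \int[mu]_q (g q)%:E)%E.
Proof.
move=> mf mg f0 g0; under eq_integral do rewrite EFinD.
rewrite ge0_integralD //; by [move=> q _; rewrite lee_fin | exact/measurable_EFinP].
Qed.

Lemma integral_scale_ge0 (mu : probability (phaseM R n) R) (a : R) (f : phaseM R n -> R) :
  measurable_fun setT f -> 0 <= a -> (forall q, 0 <= f q) ->
  (\int[mu]_q (a * f q)%:E = a%:E * \int[mu]_q (f q)%:E)%E.
Proof.
move=> mf a0 f0; under eq_integral do rewrite EFinM.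
rewrite ge0_integralZl_EFin //; by [move=> q _; rewrite lee_fin | exact/measurable_EFinP].
Qed.

Section AlmostEverywhere.
Variable mu : probability (phaseM R n) R.
Hypothesis inv : Defs.invariant Phi mu.
Hypothesis mu_le : (functional H c eps v mu <= (- h)%:E)%E.

(** Cost at most - h means that the mean of l is at most eps times the mean of v; by
    [orbit_integral_le] the mean action is then at most 1 - exp(- eps) times the mean of v, exactly
    what the other two terms of the defect take away. The constants [Cm] and [BV] keep the
    integrands nonnegative and cancel at the end. *)
Lemma defect_integral_le0 : measurable_fun setT (defect : phaseM R n -> R) /\
  (\int[mu]_q (defect q)%:E <= 0)%E.
Proof.
have [Cm Cm0 hm] := @ell_superlinear R n H c h tonH 0 (lexx 0).
have [BV BV0 hBV] := periodic_bounded v_continuous v_periodic.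
have cl := @ell_continuous R n H c h tonH.
have cfst : continuous (fun q : state => v q.1).
  by apply: (@continuous_after _ _ _ fst) => // q; exact: cvg_fst.
pose f (q : state) := l q.1 q.2 + Cm.
pose W (q : state) := v q.1 + BV.
pose g (q : state) := l q.1 q.2 - eps * v q.1 + (Cm + eps * BV).
have W0 q : 0 <= W q by have /andP[] : - BV <= v q.1 <= BV by [rewrite -ler_norml]; rewrite /W; lra.
have W2 q : W q <= 2 * BV by have /andP[] : - BV <= v q.1 <= BV by [rewrite -ler_norml]; rewrite /W; lra.
have f0 q : 0 <= f q by have := hm q.1 q.2; rewrite /f; lra.
have fg q : f q + 2 * (eps * BV) = g q + eps * W q by rewrite /f /g /W; ring.
have g0 q : 0 <= g q.
  have h2 : eps * W q <= 2 * (eps * BV) by rewrite mulrCA ler_pM2l.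
  by have := fg q; have := f0 q; lra.
have cf : continuous f by apply: continuous_add; [exact: cl|exact: continuous_const].
have cW : continuous W by apply: continuous_add; [exact: cfst|exact: continuous_const].
have cg : continuous g.
  apply: continuous_add; last exact: continuous_const.
  by apply: continuous_sub; [exact: cl|exact: continuous_mull].
have mf := continuous_measurable_phaseR cf.
have mW := continuous_measurable_phaseR cW.
have mg := continuous_measurable_phaseR cg.
have [w Ew] : exists w : R, (\int[mu]_q (W q)%:E = w%:E)%E.
  exists (fine (\int[mu]_q (W q)%:E)%E); rewrite fineK // ge0_fin_numE; last first.
    by apply: integral_ge0 => q _; rewrite lee_fin.
  apply: le_lt_trans (ltry (2 * BV)); rewrite -(integral_probability_cst mu (2 * BV)).
  apply: ge0_le_integral => //; first by move=> q _; rewrite lee_fin.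
  - exact/measurable_EFinP.
  - by move=> q _; rewrite lee_fin.
have ig : (\int[mu]_q (g q)%:E <= (Cm + eps * BV)%:E)%E.
  rewrite (_ : Cm + eps * BV = - h + (Cm + eps * BV + h)); last by ring.
  apply/(@integral_shift_le R n mu g (Cm + eps * BV + h) (- h) mg g0); move: mu_le; rewrite /functional.
  congr (_ <= _)%E; apply: eq_integral => q _; congr (_%:E); rewrite /g /ell; ring.
pose F := Cm + eps * w - eps * BV.
have iF : (\int[mu]_q (f q)%:E <= F%:E)%E.
  have E : (\int[mu]_q (f q + 2 * (eps * BV))%:E <= (Cm + eps * BV + eps * w)%:E)%E.
    under eq_integral do rewrite fg.
    rewrite integral_add_ge0 //; first last.
    - by move=> q; rewrite mulr_ge0 // ltW.
    - exact: measurable_funM.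
    by rewrite integral_scale_ge0 ?(ltW eps0) // Ew -EFinM [X in (_ <= X)%E]EFinD leeD2r.
  have mf2 : measurable_fun setT (fun q : phaseM R n => f q + 2 * (eps * BV)).
    exact: measurable_funD.
  rewrite (_ : F = Cm + eps * BV + eps * w - 2 * (eps * BV)); last by rewrite /F; ring.
  have f20 q : 0 <= f q + 2 * (eps * BV) by rewrite fg addr_ge0 // mulr_ge0 // ltW.
  have := (@integral_shift_le R n mu _ (2 * (eps * BV)) (Cm + eps * BV + eps * w - 2 * (eps * BV)) mf2 f20).2.
  rewrite subrK => /(_ E); congr (_ <= _)%E; apply: eq_integral => q _; congr (_%:E); ring.
set S := (1 - expR (- eps)) / eps.
pose J q := orbit_action q + Cm * S.
have hJ q : exists A : R -> R, (forall t : R, is_derive t 1 A (expR (eps * t) * f (Phi t q))) /\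
     J q = A 0 - A (- 1).
  have [A dA] := cost_primitive_exists q.
  exists (A + (fun t => expR (eps * t) * (Cm / eps))); split=> [t|].
    rewrite /f mulrDr; apply: is_deriveD; first exact: dA.
    rewrite (_ : expR (eps * t) * Cm = expR (eps * t) * eps * (Cm / eps)); last first.
      by field; exact: lt0r_neq0.
    by apply: is_derive_mulr; exact: is_derive_expR_mul.
  rewrite /J (orbit_actionE dA) !fctE mulr0 expR0 mulrN1 /S; field; exact: lt0r_neq0.
have pf q (k : 'rV[int]_n) : f (q.1 + zvec R k, q.2) = f q by rewrite /f /= ell_periodic.
have [mJ iJ] := orbit_integral_le tonH eps0 flow inv cf f0 pf hJ iF.
have J0 q : 0 <= J q.
  have [A [dA ->]] := hJ q; have [t _ ->] := mvt_between (- 1) 0 dA.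
  by rewrite sub0r opprK mulr1 mulr_ge0 // expR_ge0.
have cPhi : continuous (fun q : state => W (Phi (- 1) q)).
  exact: (@continuous_after _ _ _ _ W (@flow_continuous R n H c eps Phi tonH flow (- 1)) cW).
have mPhi := continuous_measurable_phaseR cPhi.
(* Every group of terms in this identity is nonnegative, so its integral splits without
   integrability. *)
have ident q : defect q + (W q + (Cm * S + expR (- eps) * BV)) =
    J q + (expR (- eps) * W (Phi (- 1) q) + BV).
  by rewrite /defect /J /W; ring.
have mdef : measurable_fun setT (defect : phaseM R n -> R).
  rewrite (_ : defect = fun q => J q + (expR (- eps) * W (Phi (- 1) q) + BV)
     - (W q + (Cm * S + expR (- eps) * BV))); last by apply/funext => q; rewrite -ident addrK.
  apply: measurable_funB.
    by apply: measurable_funD => //; apply: measurable_funD => //; exact: measurable_funM.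
  by apply: measurable_funD.
split=> //.
have S0 : 0 <= S.
  by rewrite divr_ge0 ?(ltW eps0) // subr_ge0 -expR0 ler_expR oppr_le0 ltW.
have K0 : 0 <= Cm * S + expR (- eps) * BV by rewrite addr_ge0 // mulr_ge0 ?expR_ge0 // ltW.
set K := Cm * S + expR (- eps) * BV in K0 ident *.
have : (\int[mu]_q (defect q + (W q + K))%:E = \int[mu]_q (J q + (expR (- eps) * W (Phi (- 1) q) + BV))%:E)%E.
  by apply: eq_integral => q _; rewrite ident.
have eW q : 0 <= expR (- eps) * W (Phi (- 1) q) by rewrite mulr_ge0 // expR_ge0.
have meW : measurable_fun setT (fun q : phaseM R n => expR (- eps) * W (Phi (- 1) q)).
  exact: measurable_funM.
have mWK : measurable_fun setT (fun q : phaseM R n => W q + K) by exact: measurable_funD.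
have meWB : measurable_fun setT (fun q : phaseM R n => expR (- eps) * W (Phi (- 1) q) + BV).
  exact: measurable_funD.
have WK0 q : 0 <= W q + K by rewrite addr_ge0.
have eWB0 q : 0 <= expR (- eps) * W (Phi (- 1) q) + BV by rewrite addr_ge0 // ltW.
have cst_ae (a : R) : measurable_fun setT (cst a : phaseM R n -> R) by exact: measurable_cst.
rewrite (integral_add_ge0 mu mdef mWK defect_ge0 WK0).
rewrite (integral_add_ge0 mu mW (cst_ae K) W0 (fun=> K0)).
rewrite (integral_add_ge0 mu mJ meWB J0 eWB0).
rewrite (integral_add_ge0 mu meW (cst_ae BV) eW (fun=> ltW BV0)).
rewrite (integral_scale_ge0 mu mPhi (expR_ge0 _)) //.
have pW q (k : 'rV[int]_n) : W (q.1 + zvec R k, q.2) = W q by rewrite /W /= v_periodic.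
rewrite (invariant_integral tonH flow inv (- 1) cW W0 pW) Ew.
rewrite (integral_probability_cst mu K) (integral_probability_cst mu BV) -EFinM -!EFinD => E.
have {}E : (\int[mu]_q (defect q)%:E + (w + K)%:E <= (w + K)%:E)%E.
  rewrite E (_ : w + K = S * F + (expR (- eps) * w + BV)); last first.
    by rewrite /K /S /F; field; exact: lt0r_neq0.
  by rewrite [X in (_ <= X)%E]EFinD leeD2r.
by move: E; rewrite -leeBrDr // subee.
Qed.

(** The set of nonzero defect is null, and by invariance so are its preimages under the flow at the
    times 1 - k. Sampling [calibrated] at integers keeps their union countable. *)
Lemma calibrated_full : mu.-negligible (~` (calibrated : set (phaseM R n))).
Proof.
have [mdef dle] := defect_integral_le0.
have d0 : (\int[mu]_q `|(defect q)%:E| = 0)%E.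
  apply/eqP; rewrite eq_le integral_ge0 // andbT.
  by under eq_integral do rewrite gee0_abs ?lee_fin ?defect_ge0 //.
have mE : measurable_fun setT (EFin \o (defect : phaseM R n -> R)) by exact/measurable_EFinP.
have := (@ae_eq_integral_abs _ _ _ mu setT measurableT _ mE).1 d0 => ae.
pose Z : set (phaseM R n) := [set q | defect q != 0].
have mZ : measurable Z.
  have := mdef measurableT (~` [set 0]) (measurableC (measurable_set1 _)); rewrite setTI.
  by congr measurable; apply/seteqP; split => q /= /eqP.
have Z0 : mu Z = 0%E.
  apply: measure_negligible => //; apply: negligibleS ae => q /= /eqP qn h'.
  by apply: qn; have [] := h' I.
have step k : mu.-negligible ((fun q : phaseM R n => (modT (Phi (1 - k%:R) q) : phaseM R n)) @^-1` Z).
  apply/negligibleP.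
    rewrite -[X in measurable X]setTI; exact: (measurable_modT_flow tonH flow _ measurableT mZ).
  exact: (etrans (inv.2 _ _ mZ) Z0).
apply: negligibleS (negligible_bigcup step) => q /= nq.
apply: contrapT => nZ; apply: nq => k; apply: contrapT => dk; apply: nZ; exists k => //=.
by rewrite /Z /= /modT fracvE defect_translate; apply/eqP.
Qed.

End AlmostEverywhere.

End Calibrated.

(** * The graph property *)

Section Graph.
Context {R : realType} {n : nat}.
Local Notation vec := 'rV[R]_n.
Local Notation state := (phase R n).
Context (H : vec -> vec -> R) (c : vec) (h eps : R) (v : vec -> R).
Context (Phi : R -> state -> state).
Hypothesis tonH : tonelli_hamiltonian H.
Hypothesis eps0 : 0 < eps.
Hypothesis flow : EL_flow H c eps Phi.
Hypothesis v_continuous : continuous v.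
Hypothesis v_periodic : Defs.periodic v.
Hypothesis var : variational_repr H c eps h v.
Local Notation l := (ell H c h).
Local Notation slope p := (momentum H p.1 p.2 - c).

(** Over time tau the velocity change b z / tau contributes b z.(m - c) at first order, while the
    displacement, at most |z|, contributes only K tau |z|. The number [e] bounds the distance of the
    perturbed momentum from the reference m. *)
Lemma ell_perturbed (x xi x' z m : vec) (b tau K e : R) : 0 < tau -> `|b| <= 1 ->
  `|x' - x| <= `|z| -> `|momentum H x' (xi + (b / tau) *: z) - m| <= e -> 0 <= K ->
  `|H x' (momentum H x' (xi + (b / tau) *: z)) - H x (momentum H x' (xi + (b / tau) *: z))|
    <= K * `|x' - x| ->
  tau * (l x' (xi + (b / tau) *: z) - l x xi) <=
    b * dot z (m - c) + (n%:R * e + K * tau) * `|z|.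
Proof.
move=> tau0 b1 xz; set P := momentum H x' _ => Pm K0 HK.
have up := lagrangian_upper tonH x xi x' (xi + (b / tau) *: z).
rewrite -/P (_ : xi + (b / tau) *: z - xi = (b / tau) *: z) in up; last by rewrite addrAC subrr add0r.
have hz := norm_dot z (P - m).
have -> : tau * (l x' (xi + (b / tau) *: z) - l x xi) =
    tau * (lagrangian H x' (xi + (b / tau) *: z) - lagrangian H x xi) - b * dot z c.
  rewrite /ell dotDr dotZr (dotC c z); field; exact: lt0r_neq0.
apply: le_trans (_ : tau * ((b / tau) * dot z P + K * `|z|) - b * dot z c <= _).
  rewrite lerD2r ler_pM2l //; apply: le_trans up _; rewrite dotZl lerD2l.
  apply: le_trans (ler_norm _) _; rewrite normrN; apply: le_trans HK _; exact: ler_wpM2l.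
have -> : tau * ((b / tau) * dot z P + K * `|z|) - b * dot z c =
    b * dot z (m - c) + b * dot z (P - m) + K * tau * `|z|.
  rewrite !dotBr; field; exact: lt0r_neq0.
rewrite mulrDl -!addrA lerD2l lerD2r.
apply: le_trans (ler_norm _) _; rewrite normrM; apply: le_trans (_ : 1 * `|dot z (P - m)| <= _).
  exact: ler_wpM2r.
rewrite mul1r; apply: le_trans hz _; rewrite -mulrA ler_wpM2l // mulrC ler_wpM2r //.
Qed.

(** With tau = |z| / ka the velocity changes by at most ka, a bound independent of z: the momentum
    stays near that of p while tau tends to 0 with z. The discount factor appears at an intermediate
    time because the two actions are compared by the mean value theorem. *)
Lemma perturbed_orbit_cost (p : state) (eta : R) : 0 < eta ->
  exists2 ka : R, 0 < ka & exists2 d : R, 0 < d &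
  forall (q : state) (z : vec) (a b : R), `|q - p| < d -> z != 0 -> `|z| < d -> `|b| <= 1 ->
  let tau := `|z| / ka in
  (forall s, - tau <= s <= 0 -> `|a + b * s / tau| <= 1) ->
  forall A Ag, cost_primitive H c h eps Phi q A ->
  (forall t : R, is_derive t 1 Ag (expR (eps * t) *
     l ((Phi t q).1 + (a + b * t / tau) *: z) ((Phi t q).2 + (b / tau) *: z))) ->
  exists2 s, - tau <= s <= 0 &
   Ag 0 - Ag (- tau) - (A 0 - A (- tau)) <= expR (eps * s) * (b * dot z (slope p) + eta * `|z|).
Proof.
move=> eta0; set m := momentum H p.1 p.2.
pose e := eta / (2 * (n%:R + 1)); have n10 : 0 < n%:R + 1 :> R by rewrite ltr_wpDl.
have e0 : 0 < e by rewrite divr_gt0 // mulr_gt0.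
have ne : n%:R * e <= eta / 2.
  rewrite /e mulrA ler_pdivrMr ?mulr_gt0 // (_ : eta / 2 * _ = eta * (n%:R + 1)); last by field.
  rewrite mulrC ler_pM2l //; lra.
have [d1 d10 hd1] := (continuous_ed _ p).1 (@momentum_continuous R n H tonH p) e e0.
have [K K0 hK] := periodic_C1_lipschitz (`|m| + e) (ham_C1 tonH) (ham_periodic tonH).
have [d2 d20 hd2] := flow_small_time tonH flow p (divr_gt0 d10 (ltr0n _ 2)).
(* A perturbation of size d1 / 4 and a drift of the orbit below d1 / 2 stay within d1, where the
   momentum varies by less than [e]. *)
pose ka := d1 / 4; have ka0 : 0 < ka by rewrite divr_gt0.
exists ka => //.
exists (Num.min d2 (Num.min (d2 * ka) (Num.min ka (eta * ka / (2 * K))))).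
  by rewrite !lt_min d20 ka0 mulr_gt0 //= divr_gt0 ?mulr_gt0.
move=> q z a b; rewrite !lt_min => /andP[qd _] z0 /andP[_ /andP[zd2 /andP[zka zK]]] b1 tau hab A Ag dA dAg.
have zn0 : 0 < `|z| by rewrite normr_gt0.
have tau0 : 0 < tau by rewrite divr_gt0.
have taud2 : tau < d2 by rewrite ltr_pdivrMr.
have Ktau : K * tau <= eta / 2.
  apply: ltW; rewrite /tau mulrA ltr_pdivrMr // mulrC -ltr_pdivlMr //.
  by rewrite (_ : _ / K = eta * ka / (2 * K)) //; field; rewrite gt_eqF.
have dF t : is_derive t (1 : R) (Ag - A) (expR (eps * t) *
     l ((Phi t q).1 + (a + b * t / tau) *: z) ((Phi t q).2 + (b / tau) *: z) - orbit_cost H c h eps Phi q t).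
  exact: is_deriveB.
have [t /andP[t0 t1]] := mvt_between (- tau) 0 dF.
rewrite sub0r opprK; set s := - tau + t * tau => E.
have s_itv : - tau <= s <= 0.
  by rewrite /s lerDl mulr_ge0 ?(ltW tau0) //= addrC subr_le0 ler_piMl // ltW.
exists s => //.
have -> : Ag 0 - Ag (- tau) - (A 0 - A (- tau)) = (Ag - A) 0 - (Ag - A) (- tau).
  by rewrite !fctE; ring.
rewrite E /orbit_cost.

rewrite -[_ - _]mulrBr -[leLHS]mulrA ler_pM2l ?expR_gt0 // [_ * tau]mulrC.
set x' := (Phi s q).1 + _; set xi' := (Phi s q).2 + _.
have xx : `|x' - (Phi s q).1| <= `|z|.
  rewrite /x' addrAC subrr add0r normrZ -[leRHS]mul1r; apply: ler_wpM2r => //; exact: hab.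
have xx2 : `|xi' - (Phi s q).2| <= ka.
  rewrite /xi' addrAC subrr add0r normrZ normrM normfV (gtr0_norm tau0) /tau invf_div.
  by rewrite mulrA divfK ?gt_eqF // -[leRHS]mul1r ler_pM2r.
have near1 : `|(x', xi') - p| < d1.
  rewrite -(subrKA (Phi s q)); apply: le_lt_trans (ler_normD _ _) _.
  have h1 : `|(x', xi') - Phi s q| <= ka.
    by apply: norm_pair_le => //=; apply: le_trans xx _; exact: ltW.
  have h2 : `|Phi s q - p| < d1 / 2.
    apply: hd2 => //; rewrite ler_norml; case/andP: s_itv => s1 s2; apply/andP; split; lra.
  have := ler_ltD h1 h2; rewrite /ka => hh; apply: lt_trans hh _; lra.
have Pm : `|momentum H x' xi' - m| <= e by apply: ltW; exact: (hd1 (x', xi')).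
have Pb : `|momentum H x' xi'| <= `|m| + e.
  by rewrite -(subrK m (momentum H x' xi')) addrC; apply: le_trans (ler_normD _ _) _; rewrite lerD2l.
have HK := hK ((Phi s q).1, momentum H x' xi') (x', momentum H x' xi') Pb Pb.
have HK' : `|H x' (momentum H x' xi') - H (Phi s q).1 (momentum H x' xi')| <= K * `|x' - (Phi s q).1|.
  apply: le_trans HK _; rewrite ler_pM2l //; apply: norm_pair_le => //=.
  by rewrite subrr normr0.
apply: le_trans (ell_perturbed tau0 b1 xx Pm (ltW K0) HK') _.
rewrite lerD2l; apply: ler_wpM2r => //; lra.
Qed.

Lemma perturbed_velocity q z a b tau :
  velocity (fun s => (Phi s q).1 + (a + b * s / tau) *: z) (fun s => (Phi s q).2 + (b / tau) *: z).
Proof.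
move=> t i; rewrite (_ : (fun s => _) = (fun s => (Phi s q).1 0 i) + (fun s => s * (b / tau * z 0 i)) +
   cst (a * z 0 i)); last by apply/funext => s; rewrite !fctE !mxE; ring.
rewrite !mxE -[X in is_derive _ _ _ X]addr0; apply: is_deriveD.
apply: is_deriveD; first exact: (@flow_is_derive R n H c eps Phi flow q t i).
by rewrite -[X in is_derive _ _ _ X]mul1r; exact: (@is_derive_mulr R id t 1 _ (is_derive_id t (1 : R))).
Qed.

Lemma perturbed_velocity_continuous q (z : vec) (k : R) :
  continuous (fun s => (Phi s q).2 + k *: z).
Proof.
apply: continuous_add; last exact: continuous_const.
exact: (@orbit_velocity_continuous R n H c eps Phi tonH flow q).
Qed.

(** The factor a + b s / tau equals a at time 0 and a - b at time - tau; the pairs (1, 1) and (0,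
    -1) used below each pin one end to the orbit. *)
Lemma perturbed_value_le q z a b tau : 0 < tau -> exists2 Ag : R -> R,
  (forall t : R, is_derive t 1 Ag (expR (eps * t) *
     l ((Phi t q).1 + (a + b * t / tau) *: z) ((Phi t q).2 + (b / tau) *: z))) &
  v (q.1 + a *: z) <= Ag 0 - Ag (- tau) +
    expR (- (eps * tau)) * v ((Phi (- tau) q).1 + (a - b) *: z).
Proof.
move=> tau0; have gw := perturbed_velocity q z a b tau.
have cw := @perturbed_velocity_continuous q z (b / tau).
have [Ag dAg] := primitive (@running_cost_continuous R n H c eps h tonH _ _ (velocity_continuous gw) cw).
exists Ag => //; have := value_le tonH var gw cw tau0 dAg.
rewrite (flow0 flow) mulr0 mul0r addr0 (_ : a + b * - tau / tau = a - b) //.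
by field; exact: lt0r_neq0.
Qed.

(** Replaces by 1 the discount factor x, which is within th of 1; the first-order term D is of size
    M w, so th M <= eta / 4 makes the change negligible. *)
Lemma factor_bound (x D w M eta th : R) : 0 < eta -> 0 <= w -> `|D| <= M * w ->
  `|x - 1| <= th -> th <= 1 -> th * M <= eta / 4 ->
  x * (D + eta / 4 * w) <= D + eta * w.
Proof.
move=> eta0 w0 DM x1 th1 thM.
have h1 : (x - 1) * D <= eta / 4 * w.
  apply: le_trans (ler_norm _) _; rewrite normrM; apply: le_trans (_ : th * (M * w) <= _).
    by apply: ler_pM.
  by rewrite mulrA; apply: ler_wpM2r.
have x2 : x <= 2 by have := le_trans (ler_norm _) x1; lra.
have h2 : x * (eta / 4 * w) <= 2 * (eta / 4 * w).
  by apply: ler_wpM2r => //; rewrite mulr_ge0 // ltW // divr_gt0.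
have h3 : 0 <= eta / 4 * w by rewrite mulr_ge0 // ltW // divr_gt0.
rewrite mulrDr (_ : x * D = D + (x - 1) * D); last by ring.
rewrite (_ : eta * w = eta / 4 * w + (2 * (eta / 4 * w) + eta / 4 * w)); last by field.
lra.
Qed.

(** A curve that leaves the orbit and ends at q.1 + z bounds v(q.1 + z) from above; one that starts
    at q.1 + z and joins the orbit at time tau bounds it from below. Calibration supplies equality
    along the orbit, on [- tau, 0] for the first and on [0, tau] for the second. *)
Lemma graph_estimate p (eta : R) : 0 < eta -> exists2 d : R, 0 < d &
  forall q, calibrated H c h eps v Phi q -> `|q - p| < d -> forall z, `|z| < d ->
  `|v (q.1 + z) - v q.1 - dot z (slope p)| <= eta * `|z|.
Proof.
move=> eta0; have eta40 : 0 < eta / 4 by rewrite divr_gt0.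
have [ka ka0 [d0 d00 pert]] := perturbed_orbit_cost p eta40.
pose M := n%:R * `|slope p|; have M0 : 0 <= M by rewrite mulr_ge0.
have M10 : 0 < M + 1 by rewrite ltr_wpDl.
pose th := Num.min 1 (eta / 4 / (M + 1)).
have th0 : 0 < th by rewrite lt_min ltr01 divr_gt0.
have th1 : th <= 1 by rewrite ge_min lexx.
have thM : th * M <= eta / 4.
  apply: le_trans (_ : eta / 4 / (M + 1) * M <= _).
    by apply: ler_wpM2r => //; rewrite ge_min lexx orbT.
  rewrite mulrAC ler_pdivrMr // ler_pM2l //; lra.
have [d3 d30 hd3] := (continuous_ed (@expR R) 0).1 (@continuous_expR R 0) th th0.
have [d4 d40 hd4] := flow_small_time tonH flow p d00.
exists (Num.min d0 (Num.min d4 (Num.min ka (Num.min (d4 * ka) (d3 * ka / eps))))).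
  by rewrite !lt_min d00 d40 ka0 mulr_gt0 //= divr_gt0 // mulr_gt0.
move=> q cal; rewrite !lt_min => /andP[qd0 /andP[qd4 _]] z.
rewrite !lt_min => /andP[zd0 /andP[_ /andP[zka /andP[zd4 zd3]]]].
have [->|zn] := eqVneq z 0; first by rewrite addr0 subrr sub0r dot0l oppr0 !normr0 mulr0.
have z0 : 0 < `|z| by rewrite normr_gt0.
set D := dot z (slope p).
have DM : `|D| <= M * `|z| by apply: le_trans (norm_dot _ _) _; rewrite mulrCA mulrC.
pose tau := `|z| / ka; have tau0 : 0 < tau by rewrite divr_gt0.
have tau1 : tau <= 1 by rewrite ler_pdivrMr // mul1r ltW.
have taud4 : tau <= d4 by rewrite ler_pdivrMr // ltW.
have etau : eps * tau < d3 by rewrite mulrA ltr_pdivrMr // mulrC -ltr_pdivlMr.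
have expb (x : R) : - tau <= x <= tau -> `|expR (eps * x) - 1| <= th.
  move=> /andP[x1 x2]; rewrite -(@expR0 R); apply: ltW; apply: hd3; rewrite subr0.
  rewrite normrM gtr0_norm //; apply: le_lt_trans etau; rewrite ler_pM2l // ler_norml; lra.
have [A dA] := cost_primitive_exists h tonH flow q.
have cal0 := calibrated_constant tonH flow var cal dA ler01.
have s_tau (s : R) : - tau <= s <= 0 -> -1 <= s / tau <= 0.
  by move=> /andP[s1 s2]; rewrite ler_pdivlMr // ler_pdivrMr // mulN1r mul0r s1 s2.
have upper : v (q.1 + z) - v q.1 <= D + eta * `|z|.
  have [Ag dAg vle] := perturbed_value_le q z 1 1 tau0.
  have hab s : - tau <= s <= 0 -> `|1 + 1 * s / tau| <= 1.
    by move=> /s_tau /andP[s1 s2]; rewrite mul1r ler_norml; apply/andP; split; lra.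
  have [s] := pert q z 1 1 qd0 zn zd0 (ltac:(by rewrite normr1)) hab A Ag dA dAg.
  rewrite -/tau mul1r -/D => s_itv hs.
  have es : `|expR (eps * s) - 1| <= th by apply: expb; case/andP: s_itv => ? ?; apply/andP; split; lra.
  have := factor_bound eta0 (ltW z0) DM es th1 thM; move: vle.
  have calT := calibrated_constant tonH flow var cal dA (ltac:(by lra) : - tau <= 1).
  move: calT; rewrite -cal0 /discounted_value mulr0 expR0 mul1r (flow0 flow) mulrN.
  rewrite scale1r subrr scale0r addr0; lra.
have lower : v q.1 - v (q.1 + z) <= - D + eta * `|z|.
  have [Ag dAg vle] := perturbed_value_le (Phi tau q) z 0 (- 1) tau0.
  have hab s : - tau <= s <= 0 -> `|0 + -1 * s / tau| <= 1.
    by move=> /s_tau /andP[s1 s2]; rewrite add0r mulN1r mulNr normrN ler_norml; apply/andP; split; lra.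
  have near_p : `|Phi tau q - p| < d0 by apply: hd4 => //; rewrite gtr0_norm.
  have [s] := pert (Phi tau q) z 0 (- 1) near_p zn zd0 (ltac:(by rewrite normrN1)) hab _ Ag
    (cost_primitive_shift tonH flow tau dA) dAg.
  rewrite -/tau mulN1r -/D add0r addNr => s_itv hs.
  have Dn : `|- D| <= M * `|z| by rewrite normrN.
  have es : `|expR (eps * (tau + s)) - 1| <= th by apply: expb; case/andP: s_itv => ? ?; apply/andP; split; lra.
  have := factor_bound eta0 (ltW z0) Dn es th1 thM; move: vle hs.
  have calT := calibrated_constant tonH flow var cal dA tau1.
  move: calT; rewrite -cal0 /discounted_value mulr0 expR0 mul1r (flow0 flow) -(flowD tonH flow).
  rewrite addNr (flow0 flow) scale0r addr0 sub0r opprK scale1r.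
  have -> : expR (eps * (tau + s)) = expR (eps * tau) * expR (eps * s) by rewrite -expRD mulrDr.
  have E : expR (eps * tau) * expR (- (eps * tau)) = 1 by rewrite -expRD addrN expR0.
  have et := expR_gt0 (eps * tau).
  move: (expR (eps * tau)) et (expR (- (eps * tau))) E => x x0 y xy c1 c2 c3; rewrite -mulrA => c4.
  move: c2 c3; rewrite -(ler_pM2l x0) mulrDr mulrA xy mul1r => c2.
  by rewrite -(ler_pM2l x0) mulrBr -mulrBl (mulrC _ y) mulrA xy mul1r => c3; lra.
rewrite ler_norml; apply/andP; split; lra.
Qed.

End Graph.

(** * Recurrence *)

Section Recurrence.
Context {R : realType} {n : nat}.
Local Notation vec := 'rV[R]_n.
Local Notation state := (phase R n).
Context (H : vec -> vec -> R) (c : vec) (eps : R).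
Context (Phi : R -> state -> state).
Hypothesis tonH : tonelli_hamiltonian H.
Hypothesis flow : EL_flow H c eps Phi.

Lemma tball_open (p : state) r : open (tball p r : set state).
Proof.
rewrite (_ : tball p r = (\bigcup_k [set q : state | `|q.1 - p.1 - zvec R k| < r])
    `&` [set q : state | `|q.2 - p.2| < r]); last first.
  by apply/seteqP; split => q; [move=> [[k hk] h2]; split => //; exists k
    |move=> [[k _ hk] h2]; split => //; exists k].
apply: openI.
  apply: bigcup_open => k _; apply: (@open_comp _ _ (fun q : state => `|q.1 - p.1 - zvec R k|) [set x | x < r]).
    move=> q _; apply: (@continuous_after _ _ _ (fun q : state => q.1 - p.1 - zvec R k)).
      apply: continuous_sub; last exact: continuous_const.
      by apply: continuous_sub; [move=> y; exact: cvg_fst|exact: continuous_const].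
    exact: norm_continuous.
  exact: open_lt.
apply: (@open_comp _ _ (fun q : state => `|q.2 - p.2|) [set x | x < r]); last exact: open_lt.
move=> q _; apply: (@continuous_after _ _ _ (fun q : state => q.2 - p.2)).
  by apply: continuous_sub; [move=> y; exact: cvg_snd|exact: continuous_const].
exact: norm_continuous.
Qed.

Lemma tball_periodic (p : state) r : periodic_set (tball p r).
Proof.
move=> q k [[j hj] h2]; split => //; exists (j + k).
rewrite (_ : _ - _ = q.1 - p.1 - zvec R j) //= zvecD.
by move: (zvec R j) (zvec R k) => a b; apply/rowP => i; rewrite !mxE; ring.
Qed.

Definition returns (U : set state) (N : nat) : set state :=
  \bigcup_(k in [set k | (N <= k)%N]) (Phi (- k%:R) @^-1` U).

Lemma returns_open U N : open U -> open (returns U N).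
Proof.
move=> oU; apply: bigcup_open => k _; apply: open_comp => // q _.
exact: (@flow_continuous R n H c eps Phi tonH flow).
Qed.

Lemma returns_periodic U N : periodic_set U -> periodic_set (returns U N).
Proof.
move=> pU q k [j Nj hj]; exists j => //.
by rewrite /preimage /= (flow_translate tonH flow); exact: pU.
Qed.

Lemma returns_shift U N : Phi (- 1) @^-1` returns U N = returns U N.+1.
Proof.
have E k q : Phi (- k%:R) (Phi (- 1) q) = Phi (- k.+1%:R) q.
  by rewrite -(flowD tonH flow) -natr1 opprD.
apply/seteqP; split => q /=.
  by move=> [k Nk hk]; exists k.+1 => //=; rewrite /preimage /= -E.
by move=> [[//|k] Nk hk]; exists k => //=; rewrite /preimage /= E.
Qed.

(** The sets [returns U N] decrease with N and, by [returns_shift] and invariance, have the same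
    finite measure, so each differs by a null set from [returns U 0], which contains U. *)
Lemma recurrence (mu : probability (phaseM R n) R) (U : set (phaseM R n)) :
  Defs.invariant Phi mu -> open (U : set state) -> periodic_set U ->
  mu.-negligible (U `&` ~` (\bigcap_N (returns U N : set (phaseM R n)))).
Proof.
move=> inv oU pU.
have mr N : measurable (returns U N : set (phaseM R n)).
  by apply: open_measurable_phase; exact: returns_open.
have step N : mu (returns U N.+1) = mu (returns U N).
  rewrite -(inv.2 (- 1) _ (mr N)) -returns_shift; congr (mu _).
  by rewrite -[in LHS](periodic_set_modT (returns_periodic pU)).
have eq0 N : mu (returns U N) = mu (returns U 0) by elim: N => // N IH; rewrite step.
have neg N : mu.-negligible (returns U 0 `\` (returns U N : set (phaseM R n))).
  apply/negligibleP; first exact: measurableD.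
  rewrite measureD // ?(setIidr _) ?eq0 ?subee //.
  - apply: etrans (congr1 (fun a => (mu (returns U 0) - a)%E) (eq0 N)) _.
    by apply: subee; exact: (fin_num_measure mu _ (mr 0%N)).
  - by move=> q [k _ hk]; exists k.
  by apply: (@le_lt_trans _ _ 1%E); [exact: probability_le1|exact: ltry].
apply: negligibleS (negligible_bigcup neg) => q [Uq nq].
apply: contrapT => nE; apply: nq => N _; apply: contrapT => nN; apply: nE.
exists N => //; split => //; exists 0%N => //=.
by case: inv => _ _; rewrite /preimage /= oppr0 (flow0 flow).
Qed.

(** Returns to a ball only produce an alpha-limit within r of x; this suffices because [Malpha] is a
    closure. Translating the returns into one compact ball provides the cluster point. *)
Lemma alpha_limit_near (g : R -> vec) (x : vec) (r : R) :
  (forall N : nat, exists2 k : nat, (N <= k)%N & exists z, `|g (- k%:R) - x - zvec R z| < r) ->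
  exists2 y, alpha_limit g y & `|y - x| <= r.
Proof.
move=> ret.
have /choice[k hk] : forall N, exists k : nat, (N <= k)%N /\ exists z, `|g (- k%:R) - x - zvec R z| < r.
  by move=> N; have [k] := ret N; exists k.
have /choice[z hz] : forall N, exists z, `|g (- (k N)%:R) - x - zvec R z| < r.
  by move=> N; case: (hk N).
pose y N := g (- (k N)%:R) - zvec R (z N).
pose K := [set w : vec | `|w - x| <= r].
have cK : compact K.
  rewrite (_ : K = (fun w => w + x) @` [set w : vec | `|w| <= r]).
    apply: continuous_compact; last exact: closed_ball0_compact.
    apply: continuous_subspaceT; apply: continuous_add; [exact: continuous_identity|exact: continuous_const].
  apply/seteqP; split => w /=; first by move=> wr; exists (w - x); rewrite ?subrK.
  by move=> [u ur <-]; rewrite /K /= addrK.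
have yK N : K (y N) by rewrite /K /= /y addrAC ltW.
have yK' : (y @ \oo) K by exists 0%N => // N _; exact: yK.
have [w [Kw cw]] := cK (y @ \oo) _ yK'.
have /choice[j hj] : forall m : nat, exists j, (m <= j)%N /\ `|w - y j| < m.+1%:R^-1.
  move=> m; have := cw [set u | exists2 i, (m <= i)%N & y i = u] (ball w (m.+1%:R^-1)).
  case.
  - by exists m => // i /= mi; exists i.
  - exact: nbhsx_ballx.
  by move=> _ [[i mi <-] hb]; exists i; split=> //; move: hb; rewrite -ball_normE.
exists w => //; exists (fun m => - (k (j m))%:R), (fun m => - z (j m)); split.
  apply/cvgrNyPle => A; exists (Num.truncn (- A)).+1 => // m /= Am.
  rewrite lerNl; apply: ltW; apply: lt_le_trans (truncnS_gt _) _; rewrite ler_nat.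
  by apply: leq_trans Am _; apply: leq_trans (hj m).1 _; exact: (hk _).1.
apply/cvgrPdist_le => e e0; apply: filterS (eventually_inv_le 1 e0) => m hm.
by rewrite zvecN -/(y _); apply: le_trans hm; rewrite mul1r; apply: ltW; exact: (hj m).2.
Qed.

End Recurrence.

(** * Supports of invariant measures carried by calibrated states *)

Section Inclusion.
Context {R : realType} {n : nat}.
Local Notation vec := 'rV[R]_n.
Local Notation state := (phase R n).
Context (H : vec -> vec -> R) (c : vec) (h eps : R) (v : vec -> R).
Context (Phi : R -> state -> state).
Hypothesis tonH : tonelli_hamiltonian H.
Hypothesis eps0 : 0 < eps.
Hypothesis flow : EL_flow H c eps Phi.
Hypothesis v_continuous : continuous v.
Hypothesis v_periodic : Defs.periodic v.
Hypothesis var : variational_repr H c eps h v.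
Local Notation slope p := (momentum H p.1 p.2 - c).
Local Notation cal := (calibrated H c h eps v Phi).

Lemma grad_expansion (x m : vec) :
  (forall eta : R, 0 < eta -> exists2 d : R, 0 < d & forall z, `|z| < d ->
     `|v (x + z) - v x - dot z m| <= eta * `|z|) -> grad v x = m.
Proof.
move=> hv; apply/rowP => i; rewrite mxE /pd /derive; apply: cvg_lim => //.
apply/cvgrPdist_le => e e0; have [d d0 hd] := hv e e0.
have ev1 : `|ev R i| <= 1.
  by apply: norm_le_coord => // j; rewrite !mxE eqxx /=; case: (_ == _); rewrite ?normr1 ?normr0.
exists d => //= t; rewrite /ball_ /= sub0r normrN => td t0.
have tz : `|t *: ev R i| <= `|t| by rewrite normrZ -[leRHS]mulr1; exact: ler_wpM2l.
have := hd (t *: ev R i) (le_lt_trans tz td).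
rewrite dotZl dotC dot_ev => hh; have t1 : 0 < `|t| by rewrite normr_gt0.
rewrite -(ler_pM2l t1) -normrM mulrBr distrC (_ : t * (t^-1 *: _) = v (t *: ev R i + x) - v x); last first.
  by rewrite /GRing.scale /= mulrA mulfV // mul1r.
rewrite (addrC (t *: _)); apply: le_trans hh _; rewrite mulrC; apply: ler_wpM2r => //; exact: ltW.
Qed.

Lemma calibrated_translate q (k : 'rV[int]_n) : cal q -> cal (q.1 + zvec R k, q.2).
Proof.
move=> hq j; rewrite (flow_translate tonH flow) defect_translate //; exact: hq.
Qed.

(** The radius in [graph_estimate] depends on p and eta alone and the slope is frozen at p, so
    continuity of v carries the expansion from calibrated states tending to p over to p. *)
Lemma closure_calibrated_graph (p : state) : closure (cal : set state) p ->
  p = (p.1, grad_p H p.1 (c + grad v p.1)).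
Proof.
move=> clp; suff -> : grad v p.1 = slope p.
  by rewrite addrC subrK momentum_crit // -surjective_pairing.
apply: grad_expansion => eta eta0.
have [d d0 hd] := graph_estimate tonH eps0 flow var p eta0.
exists d => // z zd; apply/ler_addgt0Pr => e e0.
have cF : continuous (fun q : state => v (q.1 + z) - v q.1 - dot z (slope p)).
  apply: continuous_sub; last exact: continuous_const.
  apply: continuous_sub; last first.
    by apply: (@continuous_after _ _ _ fst) => // q; exact: cvg_fst.
  apply: (@continuous_after _ _ _ (fun q : state => q.1 + z)) => //.
  by apply: continuous_add; [move=> q; exact: cvg_fst|exact: continuous_const].
have [d1 d10 hd1] := (continuous_ed _ p).1 (cF p) e e0.
have m0 : 0 < Num.min d d1 by rewrite lt_min d0.
have [q [cq]] := clp _ (nbhsx_ballx p _ m0).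
rewrite -ball_normE /= distrC lt_min => /andP[qd qd1].
have h1 := hd q cq qd z zd; have h2 := ltW (hd1 q qd1).
rewrite distrC in h2; set a := v (p.1 + z) - _ - _ in h2 *.
set b := v (q.1 + z) - _ - _ in h1 h2.
rewrite -(subrK b a) addrC; apply: le_trans (ler_normD _ _) _; exact: lerD.
Qed.

Section Support.
Variable mu : probability (phaseM R n) R.
Hypothesis inv : Defs.invariant Phi mu.
Hypothesis full : mu.-negligible (~` (cal : set (phaseM R n))).

(** A ball of positive measure is not covered by two null sets. *)
Lemma supp_meets (p : state) r (A : set (phaseM R n)) : supp mu p -> 0 < r ->
  mu.-negligible (tball p r `&` ~` A) -> exists2 q, tball p r q & A q /\ cal q.
Proof.
move=> sp r0 neg; apply: contrapT => nex; have := sp r r0.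
suff -> : mu (tball p r) = 0%E by rewrite ltxx.
apply: measure_negligible; first by apply: open_measurable_phase; exact: tball_open.
apply: negligibleS (negligibleU neg full) => q Uq.
have [Aq|nA] := pselect (A q); last by left.
by right => cq; apply: nex; exists q.
Qed.

Lemma supp_closure_calibrated (p : state) : supp mu p -> closure (cal : set state) p.
Proof.
move=> sp B /nbhs_ballP[r /= r0 rB].
have [|q [[k hk] h2] [_ cq]] := @supp_meets p r setT sp r0.
  by rewrite setCT setI0; exact: negligible_set0.
(* Balls in [supp] are taken modulo Z^n; the calibrated state is translated back next to p. *)
exists (q.1 - zvec R k, q.2); split.
  by rewrite -zvecN; exact: calibrated_translate.
apply: rB; rewrite -ball_normE /= distrC prod_normE /= gt_max h2 andbT.
by rewrite addrAC.
Qed.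

(** Recurrence is applied to a ball around p itself: almost every calibrated state in it returns at
    arbitrarily negative times, so its minimizing curve has an alpha-limit near p.1. *)
Lemma supp_Malpha (p : state) : supp mu p -> Malpha H c eps h v p.1.
Proof.
move=> sp B /nbhs_ballP[e /= e0 eB]; have r0 : 0 < e / 2 by rewrite divr_gt0.
have rec := recurrence tonH flow inv (@tball_open R n p (e / 2)) (@tball_periodic R n p (e / 2)).
have [q _ [ret cq]] := supp_meets sp r0 rec.
have [|y ay yp] := @alpha_limit_near R n (fun s => (Phi s q).1) p.1 (e / 2).
  move=> N; have [k Nk [[z hz] _]] := ret N I; exists k => //.
  by exists z.
exists y; split.
  exists q.1, (fun s => (Phi s q).1); split => //.
  exact: calibrated_minimizing.
by apply: eB; rewrite -ball_normE /= distrC; apply: le_lt_trans yp _; lra.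
Qed.

End Support.

End Inclusion.

Unset Implicit Arguments.

Theorem theorem3p7 (R : realType) (n : nat) (H : 'rV[R]_n -> 'rV[R]_n -> R)
    (c : 'rV[R]_n) (h : R) (eps : R) (v : 'rV[R]_n -> R)
    (Phi : R -> phase R n -> phase R n) :
  tonelli_hamiltonian H ->
  (exists u : 'rV[R]_n -> R, visc_sol H c 0 h u) ->
  0 < eps ->
  visc_sol H c eps h v ->
  variational_repr H c eps h v ->
  EL_flow H c eps Phi ->
  Mset H c eps v Phi `<=` Malpha H c eps h v /\
  Mt H c eps v Phi `<=` Malpha_t H c eps h v.
Proof.
move=> tonH _ eps0 [cv pv _ vsup] var flow.
have vK := value_lipschitz tonH var eps0 cv pv.
have [nu inu nule] := invariant_measure_exists tonH eps0 flow cv pv vsup vK.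
have full mu : minimizing_measure H c eps v Phi mu -> Defs.invariant Phi mu /\
    mu.-negligible (~` (calibrated H c h eps v Phi : set (phaseM R n))).
  move=> [imu mmu]; split=> //; apply: (calibrated_full tonH eps0 flow cv pv var imu).
  (* A minimizing measure costs no more than [nu], hence at most - h. *)
  by rewrite mmu; apply: le_trans nule; apply: ereal_inf_lbound; exists nu.
have proj : Mset H c eps v Phi `<=` Malpha H c eps h v.
  move=> _ [p clp <-].
  (* [Mt] is the closure of a union of supports, so points of supports suffice once the target is
     closed. *)
  have cl : closed (fst @^-1` Malpha H c eps h v : set (phase R n)).
    apply: closed_comp; last exact: closed_closure.
    by move=> q _; exact: cvg_fst.
  apply: cl; apply: closureS clp => q [mu /full[imu neg] sq].
  exact: (supp_Malpha tonH flow var imu neg sq).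
split=> // p clp; exists p.1; first by apply: proj; exists p.
apply/esym.
have graph := @closure_calibrated_graph R n H c h eps v Phi tonH eps0 flow cv var p.
apply: graph.
(* Supports lie in the closure of the calibrated states, hence so does the closure of their
   union. *)
apply: (@closed_closure _ (calibrated H c h eps v Phi : set (phase R n))).
apply: closureS clp => q [mu /full[imu neg] sq].
exact: (supp_closure_calibrated tonH flow pv neg sq).
Qed.
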